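(* Let $n\ge 2$, let $F\subset\mathbb R^m$ be an arbitrary set, let $0<s<1$ and $1\le p<\infty$ with $sp<n$. Let $\Omega,\omega$ be two smooth open bounded subsets of $\mathbb R^n$ such that $\overline\Omega\subset\omega$, and let $f\in W^{s,p}(\omega;F)$. Let $j$ be an integer such that $[sp]\le j\le n-1$. Then there exist a sequence $\{\mathcal C^k\}$ of finite meshes such that $\overline\Omega\subset\mathcal C^k\subset\omega$, and a sequence of maps $f_k:\mathcal C^k\to F$ such that: (a) each $f_k$ is piecewise $j$-homogeneous on $\mathcal C^k$, i.e., $f_k$ is the $j$-homogeneous extension of its restriction to the $j$-dimensional skeleton $\mathcal S^k$ of $\mathcal C^k$; (b) each $f_k$ belongs to $W^{s,p}(\mathcal C^k;F)$; (c) $f_k\to f$ in $W^{s,p}(\Omega)$ as $k\to\infty$.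
   Context: $[\,\cdot\,]$ is the integer part. For a set $U\subset\mathbb R^n$, $W^{s,p}(U;F)$ is the set of $u\in W^{s,p}(U;\mathbb R^m)$ with $u(x)\in F$ a.e.; the norm is $\|u\|_{L^p(U)}+|u|_{W^{s,p}(U)}$ with $|u|_{W^{s,p}(U)}^p=\int_U\int_U \frac{|u(x)-u(y)|^p}{|x-y|^{n+sp}}\,dx\,dy$. Meshes: let $|\cdot|$ also denote the sup norm on $\mathbb R^n$. A finite mesh is a finite collection of closed cubes of the form $T+2\varepsilon K+[-\varepsilon,\varepsilon]^n$, with $K\in\mathbb Z^n$, for some fixed $T\in\mathbb R^n$ and $\varepsilon>0$; it is identified with the union of its cubes. Its $j$-dimensional skeleton is the union of all $j$-dimensional faces of its cubes (vertices for $j=0$, edges for $j=1$, etc.). Homogeneous extension: given a map $g$ on the $\ell$-skeleton of the mesh ($0\le\ell\le n-1$), its homogeneous extension to the $(\ell+1)$-skeleton is defined on each $(\ell+1)$-dimensional face $\mathfrak C$ with center $0_{\mathfrak C}$ by $X\mapsto g\left(0_{\mathfrak C}+\varepsilon\frac{X-0_{\mathfrak C}}{|X-0_{\mathfrak C}|}\right)$, $X\in\mathfrak C\setminus\{0_{\mathfrak C}\}$. Given a map on the $j$-skeleton, its $j$-homogeneous extension to the mesh is obtained by performing this operation successively from the $j$-skeleton to the $(j+1)$-skeleton, and so on up to the $n$-dimensional cubes ($n-j$ steps); it is defined almost everywhere on the mesh. *)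

(* Defs.v *)
From HB Require Import structures.
From mathcomp Require Import all_boot all_order all_algebra finmap.
From mathcomp Require Import all_classical all_reals all_analysis.

Set Implicit Arguments.
Unset Strict Implicit.
Unset Printing Implicit Defensive.

Import Order.TTheory GRing.Theory Num.Theory.
Import numFieldNormedType.Exports.

Local Open Scope classical_set_scope.
Local Open Scope ring_scope.

Section borel_rV.
Context (R : realType) (n : nat).

Let coord (i : 'I_n) (x : 'rV[R]_n) : R := x ord0 i.

Let rV_measurable0 : g_sigma_preimage coord set0.
Proof. exact: sigma_algebra0. Qed.

Let rV_measurableC A :
  g_sigma_preimage coord A -> g_sigma_preimage coord (~` A).
Proof. exact: sigma_algebraC. Qed.

Let rV_measurable_bigcup (F : (set 'rV[R]_n)^nat) :
  (forall i, g_sigma_preimage coord (F i)) ->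
  g_sigma_preimage coord (\bigcup_i (F i)).
Proof. exact: sigma_algebra_bigcup. Qed.

(* The Borel sigma-algebra of R^n, as the product sigma-algebra. *)
HB.instance Definition _ :=
  @isMeasurable.Build (measure_tuple_display default_measure_display)
    'rV[R]_n (g_sigma_preimage coord)
    rV_measurable0 rV_measurableC rV_measurable_bigcup.

Lemma measurable_coord (i : 'I_n) :
  measurable_fun [set: 'rV[R]_n] (fun x : 'rV[R]_n => x ord0 i).
Proof.
move=> _ Y mY; rewrite setTI; apply: sub_sigma_algebra => /=.
rewrite -bigcup_seq/=; exists i => /=; first by rewrite mem_index_enum.
by exists Y => //; rewrite setTI.
Qed.

Lemma measurable_fun_rVP d (T : measurableType d) (f : T -> 'rV[R]_n) :
  (forall i, measurable_fun [set: T] (fun t => f t ord0 i)) ->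
  measurable_fun [set: T] f.
Proof.
move=> mf _ A mA; rewrite setTI; move: A mA.
apply: smallest_sub => /=.
  split => [|A mA|F mF] /=.
  - by rewrite preimage_set0.
  - by rewrite setTD preimage_setC; exact: measurableC.
  - by rewrite preimage_bigcup; exact: bigcupT_measurable.
rewrite -bigcup_seq/= => A [i _ [B mB <-]]/=; rewrite setTI.
by rewrite -[X in measurable X]setTI; exact: mf.
Qed.

End borel_rV.

Section lebesgue_rV.
Context (R : realType).

Definition consrV n (z : measurableTypeR R * 'rV[R]_n) : 'rV[R]_n.+1 :=
  \row_i oapp (z.2 ord0) z.1 (unlift ord0 i).

Lemma measurable_consrV n : measurable_fun setT (@consrV n).
Proof.
apply: measurable_fun_rVP => i; under eq_fun do rewrite mxE.
case: (unliftP ord0 i) => [j _|_] /=; last exact: measurable_fst.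
exact: (measurableT_comp (@measurable_coord R n j) measurable_snd).
Qed.

Section step.
Context n (mu : {sigma_finite_measure set 'rV[R]_n -> \bar R}).

Definition lebesgue_rVS : set 'rV[R]_n.+1 -> \bar R :=
  pushforward ((@lebesgue_measure R) \x mu)%E (@consrV n).

Let m : {measure set 'rV[R]_n.+1 -> \bar R} :=
  measure_function_pushforward__canonical__measure_function_Measure
    ((@lebesgue_measure R) \x mu)%E (@measurable_consrV n).

HB.instance Definition _ := isMeasure.Build _ _ _ lebesgue_rVS
  (measure0 m) (measure_ge0 m) (@measure_semi_sigma_additive _ _ _ m).

Let lebesgue_rVS_sigma_finite : sigma_finite setT lebesgue_rVS.
Proof.
have /sigma_finiteP[F [FT ndF Foo]] := sigma_finiteT (@lebesgue_measure R).
have /sigma_finiteP[G [GT ndG Goo]] := sigma_finiteT mu.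
pose unc (x : 'rV[R]_n.+1) : measurableTypeR R * 'rV[R]_n :=
  (x ord0 ord0, \row_i x ord0 (lift ord0 i)).
have uncK : cancel (@consrV n) unc.
  move=> [a y]; congr pair; first by rewrite mxE unlift_none.
  by apply/rowP => i; rewrite !mxE liftK.
have munc : measurable_fun setT unc.
  apply: measurable_fun_pair; first exact: measurable_coord.
  apply: measurable_fun_rVP => i; under eq_fun do rewrite mxE.
  exact: measurable_coord.
exists (fun k => unc @^-1` (F k `*` G k)).
  apply/esym; rewrite -subTset => x _.
  have [i _ Fi] : (\bigcup_i F i) (unc x).1 by rewrite -FT.
  have [j _ Gj] : (\bigcup_i G i) (unc x).2 by rewrite -GT.
  exists (maxn i j) => //; split.
    by move: Fi; exact/subsetPset/ndF/leq_maxl.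
  by move: Gj; exact/subsetPset/ndG/leq_maxr.
move=> k; have [mF Fk] := Foo k; have [mG Gk] := Goo k; split.
  by rewrite -[X in measurable X]setTI; apply: munc => //; exact: measurableX.
rewrite /lebesgue_rVS /pushforward -comp_preimage.
rewrite (_ : unc \o _ = id); last by apply/funext => z /=; rewrite uncK.
by rewrite preimage_id product_measure1E// lte_mul_pinfty// ge0_fin_numE.
Qed.

HB.instance Definition _ := Measure_isSigmaFinite.Build _ _ _ lebesgue_rVS
  lebesgue_rVS_sigma_finite.

End step.

(* Lebesgue measure on (the Borel sets of) R^n, as the n-fold product of the
   one-dimensional Lebesgue measure. *)
Fixpoint lebesgue_rV n : {sigma_finite_measure set 'rV[R]_n -> \bar R} :=
  match n with
  | 0 => \d_(0 : 'rV[R]_0)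
  | k.+1 => lebesgue_rVS (lebesgue_rV k)
  end.

End lebesgue_rV.

Lemma lebesgue_rV_box (R : realType) n (B : 'I_n -> set R) :
  (forall i, measurable (B i)) ->
  lebesgue_rV R n [set x | forall i, B i (x ord0 i)] =
  (\prod_(i < n) (@lebesgue_measure R) (B i))%E.
Proof.
elim: n B => [|n IH] B mB.
  rewrite big_ord0 /= diracE mem_set//=; by case.
rewrite big_ord_recl /= /lebesgue_rVS /pushforward.
have -> : @consrV R n @^-1` [set x | forall i, B i (x ord0 i)] =
    B ord0 `*` [set y : 'rV[R]_n | forall i, B (lift ord0 i) (y ord0 i)].
  apply/seteqP; split => [[a y] /= h|[a y] /= [h0 h] i].
    split; first by have := h ord0; rewrite mxE unlift_none.
    by move=> i; have := h (lift ord0 i); rewrite mxE liftK.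
  by rewrite mxE; case: unliftP => [j ->|->] //=; exact: h.
have mBl : measurable [set y : 'rV[R]_n | forall i, B (lift ord0 i) (y ord0 i)].
  rewrite [X in measurable X](_ : _ =
      \bigcap_(i in [set: 'I_n]) (fun y : 'rV[R]_n => y ord0 i) @^-1` B (lift ord0 i)); last first.
    by apply/seteqP; split => [y h i _|y h i]; exact: h.
  apply: fin_bigcap_measurable => // i _.
  by rewrite -[X in measurable X]setTI; exact: measurable_coord.
rewrite product_measure1E//; last exact: (mB ord0).
by congr (_ * _)%E; apply: (IH (fun i => B (lift ord0 i))) => i; exact: mB.
Qed.

Section sobolev.
Context (R : realType) (n m : nat).
Implicit Types (U : set 'rV[R]_n) (u : 'rV[R]_n -> 'rV[R]_m).

(* The Euclidean norm; the library norm [`|x|] of a matrix is the sup norm. *)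
Definition enorm d (x : 'rV[R]_d) : R := Num.sqrt (\sum_i x ord0 i ^+ 2).

(* Measurability with respect to the completed (Lebesgue) sigma-algebra. *)
Definition lebesgue_measurable U u : Prop :=
  exists2 v : 'rV[R]_n -> 'rV[R]_m, measurable_fun setT v &
    {ae lebesgue_rV R n, forall x, U x -> u x = v x}.

Definition Lp_norm (p : R) U u : \bar R :=
  ((\int[lebesgue_rV R n]_(x in U) (enorm (u x) `^ p)%:E) `^ p^-1)%E.

Definition gagliardo_seminorm (s p : R) U u : \bar R :=
  ((\int[lebesgue_rV R n]_(x in U) \int[lebesgue_rV R n]_(y in U)
      (enorm (u x - u y) `^ p / enorm (x - y) `^ (n%:R + s * p))%:E)
    `^ p^-1)%E.

Definition sobolev_norm (s p : R) U u : \bar R :=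
  (Lp_norm p U u + gagliardo_seminorm s p U u)%E.

Definition sobolev (s p : R) U (F : set 'rV[R]_m) :
    set ('rV[R]_n -> 'rV[R]_m) :=
  [set u | [/\ lebesgue_measurable U u,
               (sobolev_norm s p U u < +oo)%E &
               {ae lebesgue_rV R n, forall x, U x -> F (u x)}]].

End sobolev.

Section smooth_domain.
Context (R : realType).

Fixpoint Ck d (k : nat) (g : 'rV[R]_d -> R) : Prop :=
  match k with
  | 0 => continuous g
  | k'.+1 => continuous g /\ forall i : 'I_d,
      (forall x, derivable g x (delta_mx ord0 i)) /\
      Ck k' (fun x => 'D_(delta_mx ord0 i) g x)
  end.

Definition smooth d (g : 'rV[R]_d -> R) : Prop := forall k, Ck k g.

(* Near each boundary point, [U] is the region strictly on one side of the
   graph of a smooth function expressing one coordinate through the others. *)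
Definition smooth_open n (U : set 'rV[R]_n) : Prop :=
  open U /\
  forall x, (closure U `\` U) x ->
    exists (r : R) (i : 'I_n) (b : bool) (g : 'rV[R]_n.-1 -> R),
      [/\ 0 < r, smooth g &
          forall y, ball x r y ->
            U y <-> 0 < (-1) ^+ b * (y ord0 i - g (col' i y))].

End smooth_domain.

Section meshes.
Context (R : realType) (n : nat).

Record mesh := Mesh {
  mesh_origin : 'rV[R]_n ;
  mesh_radius : R ;
  mesh_radius_gt0 : 0 < mesh_radius ;
  mesh_cells : {fset 'rV[int]_n} }.

Implicit Types (M : mesh) (K : 'rV[int]_n) (S : {set 'I_n})
  (b : {ffun 'I_n -> bool}).

Definition cube_center M K : 'rV[R]_n :=
  mesh_origin M + (2 * mesh_radius M) *: map_mx intr K.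

Definition mesh_set M : set 'rV[R]_n :=
  [set X : 'rV[R]_n | exists2 K, K \in mesh_cells M &
     forall i, `|X ord0 i - cube_center M K ord0 i| <= mesh_radius M].

(* A face of the cube [K] is encoded by the set [S] of its free directions (so
   that its dimension is [#|S|]) and by the signs [b] selecting, in the other
   directions, one of the two sides of the cube; [b] is irrelevant on [S]. *)
Definition face_center M K S b : 'rV[R]_n :=
  \row_i (cube_center M K ord0 i +
          (if i \in S then 0 else (-1) ^+ b i * mesh_radius M)).

Definition face M K S b : set 'rV[R]_n :=
  [set X : 'rV[R]_n | forall i,
     (i \in S -> `|X ord0 i - face_center M K S b ord0 i| <= mesh_radius M) /\
     (i \notin S -> X ord0 i = face_center M K S b ord0 i)].

Definition skeleton l M : set 'rV[R]_n :=
  [set X | exists K S b,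
     [/\ K \in mesh_cells M, #|S| = l & face M K S b X]].

End meshes.

Section homogeneous_extension.
Context (R : realType) (n : nat) (V : Type).
Implicit Types (M : mesh R n) (G : 'rV[R]_n -> V -> Prop).

(* Since homogeneous extensions are not defined at the centers of the faces,
   maps are represented here by their graphs: [G X v] means that the map is
   defined at [X], with value [v]. The norm [`|X - c|] is the sup norm, so that
   [X] is projected radially from [c] onto the boundary of the face. *)
Definition homogeneous_step M (l : nat) G : 'rV[R]_n -> V -> Prop :=
  fun X v => exists K S b,
    let c := face_center M K S b in
    [/\ K \in mesh_cells M, #|S| = l.+1, face M K S b X, X != c &
        G (c + (mesh_radius M / `|X - c|) *: (X - c)) v].

(* Extension of [g] from the j-skeleton to the (j + d)-skeleton. *)
Fixpoint homogeneous_ext M (g : 'rV[R]_n -> V) (j d : nat) :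
    'rV[R]_n -> V -> Prop :=
  match d with
  | 0 => fun X v => skeleton j M X /\ g X = v
  | k.+1 => homogeneous_step M (j + k) (homogeneous_ext M g j k)
  end.

Definition piecewise_homogeneous (j : nat) M (g : 'rV[R]_n -> V) : Prop :=
  forall X v, homogeneous_ext M g j (n - j) X v -> g X = v.

End homogeneous_extension.

(* Main.v *)
(* The j-homogeneous extension of f to the mesh of origin T and radius e is
   f o Phi, where Phi is the composition of the radial projections. In the unit
   mesh, write u_i = 2 k_i + r_i with |r_i| <= 1 and let a(u) be the (n - j)-th
   largest of the |r_i|; then Phi(u)_i = 2 k_i + r_i / max(a(u), |r_i|). Thus
   Phi moves points by at most e and is Lipschitz with constant 4 / a, and a^{-sp}
   is locally integrable, since sp < j + 1 and {a <= t} is a union of product sets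
   of measure O(t^{j+1}).

   Replacing |f(A) - f(B)| by averages of |f(A) - f(c)| + |f(c) - f(B)| over c in
   a ball of radius |A - B| gives, with the local energy
   W(A) = \int_{|A - c| <= 3 e} |f(A) - f(c)|^p |A - c|^{-n-sp} dc,
   the bound
   |f o Phi - f|_{W^{s,p}}^p <= C \int a^{-sp} (W o Phi) + C \int W.
   In the average over the origin T, the change of variables x = T + u turns
   W o Phi into translates of W, so that the right-hand side is on average at
   most C' \int W, which tends to 0 with e because f is in W^{s,p}. Some origin
   is at least as good as the average. *)

Require Import Defs.
From HB Require Import structures.
From mathcomp Require Import all_boot all_order all_algebra finmap.
From mathcomp Require Import all_classical all_reals all_analysis.
From mathcomp Require Import measurable_realfun.
From mathcomp Require Import ring lra zify.

Set Implicit Arguments.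
Unset Strict Implicit.
Unset Printing Implicit Defensive.

Import Order.TTheory GRing.Theory Num.Theory.
Import numFieldNormedType.Exports.

Local Open Scope classical_set_scope.
Local Open Scope ring_scope.

(** * Radial projections in dimension one and on the unit mesh *)

(** The first projection turns the largest |r_i| into 1 and divides the others by it; each further
    one does the same with the next largest, so the quotients telescope. After n - j steps the n - j
    largest are 1 and the others are divided by the (n - j)-th largest, which is the closed formula
    for Phi.

    The obstacle is that Phi sends almost every point into the j-skeleton, a null set. First, no
    change of variables along Phi is possible. The averages over c replace it: after them y enters
    only through |x - y| and can be integrated out, which leaves the kernel at (Phi(x), c).
    Secondly, f is determined and F-valued only almost everywhere, so f o Phi could depend on the
    representative. The choice of the origin settles this too: W may be set to +oo on the
    exceptional null set of a Borel representative without changing its integral. For the chosen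
    origin the weighted integral is then finite, so Phi(x) avoids that set for almost every x near
    Omega, and the remaining values may be replaced by any point of F. *)

Section radial.
Context {R : realType}.
Implicit Types (a d t w : R) (K : int).

Definition cell t : int := Num.floor ((t + 1) / 2).
Definition res t : R := t - 2 * (cell t)%:~R.
(* [push 0 0 = 0] by the convention on division, hence [push 0] is the sign
   function; this makes the invariance under radial projections hold at the singular points too. *)
Definition push a w : R := w / Num.max a `|w|.
Definition push_cell a t : R := 2 * (cell t)%:~R + push a (res t).

Lemma res_itv t : -1 <= res t < 1.
Proof.
have /andP[h1 h2] := @mem_rg1_floor R ((t + 1) / 2).
rewrite /res /cell; apply/andP; split; lra.
Qed.

Lemma res_le1 t : `|res t| <= 1.
Proof. by have /andP[h1 h2] := res_itv t; rewrite ler_norml h1 ltW. Qed.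

(** Cells are half-open, whereas the cubes of a mesh are closed. The two indexings disagree only at
    a right end point, where the residue has modulus 1 and [push] is the identity, so the formulas
    below can be read in any cube that contains the point. *)
Lemma cellP K t : `|t - 2 * K%:~R| <= 1 ->
  cell t = K \/ (cell t = K + 1 /\ t = 2 * K%:~R + 1).
Proof.
rewrite ler_norml => /andP[h1 h2].
have [h3|h3] := ltP t (2 * K%:~R + 1); [left|right].
  apply: floor_def; apply/andP; split; rewrite ?rmorphD/=; lra.
have {}h3 : t = 2 * K%:~R + 1 by lra.
split=> //; apply: floor_def; rewrite h3 !rmorphD/=; apply/andP; split; lra.
Qed.

Lemma push1 a w : a <= 1 -> `|w| = 1 -> push a w = w.
Proof. by move=> a1 w1; rewrite /push w1 (max_idPr a1) divr1. Qed.

Lemma res_cell K t : `|t - 2 * K%:~R| <= 1 -> `|res t| = `|t - 2 * K%:~R|.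
Proof.
rewrite /res => /cellP[->//|[-> ->]].
rewrite rmorphD/= (_ : _ - _ = -1) ?normrN1; last by ring.
by rewrite (_ : _ - _ = 1) ?normr1//; ring.
Qed.

Lemma push_cellE K a t : a <= 1 -> `|t - 2 * K%:~R| <= 1 ->
  push_cell a t = 2 * K%:~R + push a (t - 2 * K%:~R).
Proof.
move=> a1; rewrite /push_cell /res => /cellP[->//|[-> ->]].
rewrite rmorphD/= (_ : _ - _ = -1); last by ring.
rewrite (_ : _ - _ = 1); last by ring.
by rewrite !push1// ?normrN1 ?normr1//; ring.
Qed.

Lemma normr_push a w : 0 <= a -> `|push a w| <= 1.
Proof.
move=> a0; rewrite /push normrM normfV (@ger0_norm _ (Num.max _ _)); last first.
  by rewrite le_max normr_ge0 orbT.
have [->|w0] := eqVneq w 0; first by rewrite normr0 mul0r.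
have w1 : 0 < `|w| by rewrite normr_gt0.
by rewrite ler_pdivrMr ?lt_max ?w1 ?orbT// mul1r le_max lexx orbT.
Qed.

(** In this range [push a] keeps the sign, does not decrease the modulus, and stays in [-1, 1]. *)
Lemma push_dist a w : 0 <= a <= 1 -> `|w| <= 1 -> `|push a w - w| <= 1.
Proof.
move=> /andP[a0 a1] w1.
have h : `|w| <= `|push a w|.
  rewrite /push normrM normfV (@ger0_norm _ (Num.max _ _)); last first.
    by rewrite le_max a0.
  have [->|w0] := eqVneq w 0; first by rewrite normr0 mul0r.
  have w2 : 0 < `|w| by rewrite normr_gt0.
  rewrite ler_pdivlMr ?lt_max ?w2 ?orbT// -[leRHS]mulr1 ler_wpM2l//.
  by rewrite ge_max a1.
have s : 0 <= push a w * w.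
  rewrite /push mulrAC -expr2; apply: divr_ge0; first exact: sqr_ge0.
  by rewrite le_max a0.
have := normr_push w a0; move: h s w1.
set q := push a w.
by case: (ler0P w) => ?; case: (ler0P q) => ?; move=> *; rewrite ler_norml; nra.
Qed.

(** With m = max(a, |w|) >= a, multiplying by m clears the first denominator: m (w/m - w'/m') = (w -
    w') + (w'/m') (m' - m), where |w'/m'| <= 1 and |m - m'| <= d. *)
Lemma push_lip a a' w w' d : 0 <= a -> `|a - a'| <= d -> `|w - w'| <= d ->
  a * `|push a w - push a' w'| <= d + d.
Proof.
move=> a0 ad wd.
have d0 : 0 <= d by apply: le_trans ad.
set m := Num.max a `|w|; set m' := Num.max a' `|w'|.
have am : a <= m by rewrite le_max lexx.
have [m0|m0] := eqVneq m 0.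
  by rewrite (_ : a = 0) ?mul0r ?addr_ge0//; apply/eqP; rewrite eq_le a0 -m0 am.
have mp : 0 < m by rewrite lt_neqAle eq_sym m0 (le_trans a0).
apply: (@le_trans _ _ (m * `|push a w - push a' w'|)).
  by rewrite ler_wpM2r.
have -> : m * `|push a w - push a' w'| = `|m * (push a w - push a' w')|.
  by rewrite normrM gtr0_norm.
have mm : `|m - m'| <= d.
  rewrite /m /m'; move: ad wd; rewrite !ler_norml => /andP[h1 h2] /andP[h3 h4].
  have := lerB_dist w w'; have := lerB_dist w' w; rewrite distrC.
  have : `|w - w'| <= d by rewrite ler_norml h3.
  by case: (leP a `|w|) => ?; case: (leP a' `|w'|) => ? *; lra.
have q1 : `|w' / m'| <= 1.
  rewrite normrM normfV.
  have m'0 : 0 <= m' by rewrite le_max normr_ge0 orbT.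
  rewrite (ger0_norm m'0).
  have [->|w0] := eqVneq w' 0; first by rewrite normr0 mul0r.
  have w1 : 0 < `|w'| by rewrite normr_gt0.
  by rewrite ler_pdivrMr ?lt_max ?w1 ?orbT// mul1r le_max lexx orbT.
have -> : m * (push a w - push a' w') = (w - w') + (w' / m') * (m' - m).
  rewrite /push -/m -/m' mulrBr mulrC divfK//.
  rewrite mulrBr.
  have -> : w' / m' * m' = w'.
    have [m'0|m'0] := eqVneq m' 0; last by rewrite divfK.
    rewrite m'0 mulr0; apply/esym/eqP; rewrite -normr_le0.
    by rewrite -m'0 le_max lexx orbT.
  by ring.
apply: le_trans (ler_normD _ _) _; apply: lerD => //.
rewrite normrM distrC -[leRHS]mul1r; apply: ler_pM => //.
Qed.

Lemma push_cell_lip a a' t t' d : 0 <= a <= 1 -> 0 <= a' <= 1 ->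
  `|a - a'| <= d -> `|t - t'| <= d -> d <= 1 ->
  a * `|push_cell a t - push_cell a' t'| <= 4 * d.
Proof.
move=> /andP[a0 a1] /andP[a'0 a'1] ad td d1.
have d0 : 0 <= d by apply: le_trans ad.
have same K : `|t - 2 * K%:~R| <= 1 -> `|t' - 2 * K%:~R| <= 1 ->
    a * `|push_cell a t - push_cell a' t'| <= d + d.
  move=> tK t'K; rewrite (@push_cellE K)// (@push_cellE K a')//.
  rewrite (_ : _ - _ = push a (t - 2 * K%:~R) - push a' (t' - 2 * K%:~R)); last by ring.
  apply: push_lip => //; rewrite (_ : _ - _ = t - t')//; ring.
have [/andP[l1 l2] /andP[l3 l4]] := (res_itv t, res_itv t').
set k := cell t in l1 l2; set k' := cell t' in l3 l4.
have kE : `|t - 2 * k%:~R| <= 1 by exact: res_le1.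
have k'E : `|t' - 2 * k'%:~R| <= 1 by exact: res_le1.
(* In adjacent cells the estimate passes through their common end point [b], which is fixed for
   every depth. Each half costs 2 d, whence the constant 4. *)
have cross b (e : R) : `|e| = 1 -> b = 2 * k%:~R + e -> b = 2 * k'%:~R - e ->
    `|t - b| <= d -> `|b - t'| <= d -> a * `|push_cell a t - push_cell a' t'| <= 4 * d.
  move=> e1 bE bE' tb bt'.
  have h1 : a * `|push_cell a t - b| <= d + d.
    rewrite (@push_cellE k)// bE.
    rewrite (_ : _ - _ = push a (t - 2 * k%:~R) - push a e); last first.
      by rewrite (@push1 a e)//; ring.
    apply: push_lip => //; first by rewrite subrr normr0.
    by rewrite -addrA -opprD -bE.
  have h2 : a * `|b - push_cell a' t'| <= d + d.
    rewrite (@push_cellE k' a')// bE'.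
    rewrite (_ : _ - _ = push a (- e) - push a' (t' - 2 * k'%:~R)); last first.
      by rewrite (@push1 a (- e)) ?normrN//; ring.
    apply: push_lip => //.
    by rewrite (_ : _ - _ = b - t')// bE'; ring.
  have := ler_distD b (push_cell a t) (push_cell a' t').
  by move=> h3; nra.
move: td; rewrite ler_norml => /andP[td1 td2].
rewrite /res in l1 l2 l3 l4; rewrite -/k -/k' in l1 l2 l3 l4.
have [kk|kk|kk] := ltgtP k k'.
- have kk1 : k' = k + 1.
    apply/eqP; rewrite eq_le; apply/andP; split; last by rewrite addrC lez1D.
    rewrite addrC -ltz1D -(ltr_int R) !rmorphD/=; lra.
  apply: (cross (2 * k%:~R + 1) 1) => //; rewrite ?normr1// ?kk1 ?rmorphD/=; try ring.
    rewrite ler_norml; move: l3; rewrite kk1 rmorphD/= => l3; apply/andP; split; lra.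
  rewrite ler_norml; move: l3; rewrite kk1 rmorphD/= => l3; apply/andP; split; lra.
- have kk1 : k = k' + 1.
    apply/eqP; rewrite eq_le; apply/andP; split; last by rewrite addrC lez1D.
    rewrite addrC -ltz1D -(ltr_int R) !rmorphD/=; lra.
  move: l1; rewrite kk1 rmorphD/= => l1.
  apply: (cross (2 * k'%:~R + 1) (-1)) => //; rewrite ?normrN1// ?kk1 ?rmorphD/=; try ring.
    rewrite ler_norml; apply/andP; split; lra.
  rewrite ler_norml; apply/andP; split; lra.
- by apply: le_trans (same k kE _) _; rewrite ?kk//; lra.
Qed.

(** [|res t|] is the distance from t to 2 Z, and the even integer closest to t' is at least that far
    from t. *)
Lemma res_lip t t' : `|res t| <= `|t - t'| + `|res t'|.
Proof.
have /andP[h1 h2] := res_itv t; rewrite /res in h1 h2 *.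
set k := cell t in h1 h2 *; set k' := cell t'.
apply: (@le_trans _ _ `|t - 2 * k'%:~R|); last first.
  by apply: le_trans (ler_distD t' _ _) _.
have [->//|kk] := eqVneq k k'.
apply: (@le_trans _ _ 1); first by rewrite ler_norml h1 ltW.
have : (1 <= `|k - k'|)%R by lia.
rewrite -(ler_int R) intr_norm rmorphB/= ler_normr => /orP[] h; rewrite ler_normr.
  by apply/orP; left; lra.
by apply/orP; right; lra.
Qed.

End radial.

Section rV_norm.
Context {R : realType} {n : nat}.
Implicit Types (x y : 'rV[R]_n) (r : R).

Lemma rV_normE x : `|x| = \big[Num.max/0]_i `|x ord0 i|.
Proof.
rewrite [LHS]mx_normrE; apply/eqP; rewrite eq_le; apply/andP; split.
  apply/bigmax_leP; split; first exact: bigmax_ge_id.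
  by move=> [i k] _ /=; rewrite (ord1 i); exact: le_bigmax.
apply/bigmax_leP; split; first exact: bigmax_ge_id.
by move=> i _; apply: (@le_bigmax _ _ _ 0 (fun ij => `|x ij.1 ij.2|) (ord0, i)).
Qed.

Lemma rV_norm_leP x r : 0 <= r -> `|x| <= r <-> forall i, `|x ord0 i| <= r.
Proof.
move=> r0; rewrite rV_normE; split; first by move=> /bigmax_leP[_ h] i; exact: h.
by move=> h; apply/bigmax_leP.
Qed.

Lemma rV_coord_le x i : `|x ord0 i| <= `|x|.
Proof. by rewrite rV_normE; exact: (@le_bigmax _ _ _ 0 (fun i => `|x ord0 i|)). Qed.

End rV_norm.

Section depth.
Context {R : realType} {n : nat}.
Variable j : nat.
Implicit Types (u x y : 'rV[R]_n) (t r d : R) (S : {set 'I_n}).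

(** Minimizing this over the sets with j + 1 elements yields the (j + 1)-th smallest residue without
    sorting. In min-max form the depth is visibly 1-Lipschitz and measurable, and its sublevel sets
    are unions of boxes. *)
Definition face_depth S u : R := \big[Num.max/0]_(i in S) `|res (u ord0 i)|.

(* The (n - j)-th largest distance of a coordinate of [u] to [2 Z]. *)
Definition depth u : R :=
  \big[Num.min/1]_(S : {set 'I_n} | #|S| == j.+1) face_depth S u.

(* The composition of the radial projections onto the faces of the unit mesh
   [2 Z^n + [-1, 1]^n], down to dimension [j]. *)
Definition mesh_proj u : 'rV[R]_n := \row_i push_cell (depth u) (u ord0 i).

Lemma face_depth_ge0 S u : 0 <= face_depth S u.
Proof. exact: bigmax_ge_id. Qed.

Lemma face_depth_ge S u i : i \in S -> `|res (u ord0 i)| <= face_depth S u.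
Proof. by move=> iS; rewrite /face_depth; apply: le_bigmax_cond. Qed.

Lemma depth_itv u : 0 <= depth u <= 1.
Proof.
apply/andP; split; last exact: bigmin_le_id.
by apply/bigmin_geP; split => // S _; exact: face_depth_ge0.
Qed.

Lemma depth_ge0 u : 0 <= depth u. Proof. by case/andP: (depth_itv u). Qed.

Lemma depth_le1 u : depth u <= 1. Proof. by case/andP: (depth_itv u). Qed.

Lemma depth_leP u t : t < 1 -> depth u <= t ->
  exists2 S : {set 'I_n}, #|S| = j.+1 & forall i, i \in S -> `|res (u ord0 i)| <= t.
Proof.
move=> t1 /bigmin_leP[|[S /eqP cS]]; first by rewrite leNgt t1.
by move=> /bigmax_leP[_ h]; exists S.
Qed.

Lemma depth_lip u v d : `|u - v| <= d -> depth u <= depth v + d.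
Proof.
move=> uvd; rewrite -lerBlDr; apply/bigmin_geP.
have d0 : 0 <= d by apply: le_trans uvd.
split; first by rewrite lerBlDr (le_trans (depth_le1 u))// lerDl.
move=> S cS; rewrite lerBlDr.
apply: (@le_trans _ _ (face_depth S u)); first exact: bigmin_le_cond.
apply/bigmax_leP; split; first by rewrite addr_ge0// face_depth_ge0.
move=> i iS; rewrite addrC; apply: le_trans (res_lip _ (v ord0 i)) _.
apply: lerD.
  by rewrite (le_trans _ uvd)//; have := rV_coord_le (u - v) i; rewrite !mxE.
exact: face_depth_ge.
Qed.

Lemma mesh_proj_dist u : `|mesh_proj u - u| <= 1.
Proof.
apply/rV_norm_leP => // i; rewrite !mxE /push_cell.
have -> : 2 * (cell (u ord0 i))%:~R + push (depth u) (res (u ord0 i)) - u ord0 i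
  = push (depth u) (res (u ord0 i)) - res (u ord0 i) by rewrite /res; ring.
apply: push_dist; [exact: depth_itv|exact: res_le1].
Qed.

Lemma mesh_proj_lip u v : `|u - v| <= 1 ->
  depth u * `|mesh_proj u - mesh_proj v| <= 4 * `|u - v|.
Proof.
move=> uv1; have [->|u0] := eqVneq (depth u) 0.
  by rewrite mul0r mulr_ge0.
have up : 0 < depth u by rewrite lt_neqAle eq_sym u0 depth_ge0.
rewrite mulrC -ler_pdivlMr//; apply/rV_norm_leP.
  by rewrite divr_ge0 ?depth_ge0// mulr_ge0.
move=> i; rewrite !mxE ler_pdivlMr// mulrC; apply: push_cell_lip => //.
- exact: depth_itv.
- exact: depth_itv.
- rewrite ler_norml; have := @depth_lip u v _ (lexx _).
  have := @depth_lip v u _ (lexx _); rewrite distrC => h1 h2.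
  by apply/andP; split; lra.
- by have := rV_coord_le (u - v) i; rewrite !mxE.
Qed.

(* On a face of the cube [K] with free directions [S], the depth is attained
   inside [S], hence it is homogeneous of degree 1 from the center. *)
Lemma mesh_proj_face_step (K : 'rV[int]_n) S r u u' :
  (j < #|S|)%N -> 0 < r <= 1 ->
  (forall i, i \in S -> `|u ord0 i - 2 * (K ord0 i)%:~R| <= r) ->
  (forall i, i \notin S -> `|u ord0 i - 2 * (K ord0 i)%:~R| = 1) ->
  (forall i, i \in S -> u' ord0 i - 2 * (K ord0 i)%:~R =
     (u ord0 i - 2 * (K ord0 i)%:~R) / r) ->
  (forall i, i \notin S -> u' ord0 i = u ord0 i) ->
  mesh_proj u' = mesh_proj u.
Proof.
move=> jS /andP[r0 r1] uS unS u'S u'nS.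
have uK i : `|u ord0 i - 2 * (K ord0 i)%:~R| <= 1.
  have [iS|iS] := boolP (i \in S); last by rewrite unS.
  exact: le_trans (uS _ iS) r1.
have u'K i : `|u' ord0 i - 2 * (K ord0 i)%:~R| <= 1.
  have [iS|iS] := boolP (i \in S); last by rewrite u'nS// unS.
  by rewrite u'S// normrM normfV (gtr0_norm r0) ler_pdivrMr// mul1r uS.
have ures i : i \in S -> `|res (u ord0 i)| = r * `|res (u' ord0 i)|.
  move=> iS; rewrite (@res_cell _ (K ord0 i))// (@res_cell _ (K ord0 i) (u' _ _))//.
  by rewrite u'S// normrM normfV (gtr0_norm r0) [RHS]mulrC divfK// gt_eqF.
have unres i : i \notin S -> `|res (u ord0 i)| = 1 /\ `|res (u' ord0 i)| = 1.
  move=> iS; rewrite (@res_cell _ (K ord0 i))// (@res_cell _ (K ord0 i) (u' _ _))//.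
  by rewrite u'nS// unS.
have out S' (v : 'rV[R]_n) : ~~ (S' \subset S) ->
    (forall i, i \notin S -> `|res (v ord0 i)| = 1) -> 1 <= face_depth S' v.
  move=> /fintype.subsetPn[i iS' iS] h; rewrite -(h _ iS).
  exact: face_depth_ge.
(* More than j coordinates are free, and on any j + 1 of them the residues are at most r. *)
have ur : depth u <= r.
  have [S0 S0S cS0] : exists2 S0 : {set 'I_n}, S0 \subset S & #|S0| = j.+1.
    exists [set x in take j.+1 (enum S)]%SET.
      by apply/fintype.subsetP => x; rewrite inE => /mem_take; rewrite mem_enum.
    rewrite cardsE (card_uniqP _) ?size_takel// ?take_uniq ?enum_uniq//.
    by rewrite -cardE.
  apply: (@le_trans _ _ (face_depth S0 u)).
    by apply: bigmin_le_cond; rewrite cS0.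
  apply/bigmax_leP; split; first exact: ltW.
  move=> i /(fintype.subsetP S0S) iS; rewrite ures// -[leRHS]mulr1.
  by rewrite ler_wpM2l ?(ltW r0)// res_le1.
(* A set not contained in [S] meets a coordinate of residue 1, so it cannot lower either minimum
   below its known bound; on sets inside [S] every residue is scaled by r. *)
have dE : depth u = r * depth u'.
  apply/eqP; rewrite eq_le; apply/andP; split.
    rewrite mulrC -ler_pdivrMr//; apply/bigmin_geP; split.
      by rewrite ler_pdivrMr// mul1r.
    move=> S' cS'; rewrite ler_pdivrMr//.
    have [S'S|S'S] := boolP (S' \subset S); last first.
      rewrite (le_trans ur)// -[leLHS]mul1r ler_wpM2r ?(ltW r0)//.
      by apply: out => // i /unres[].
    apply: (@le_trans _ _ (face_depth S' u)); first exact: bigmin_le_cond.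
    apply/bigmax_leP; split; first by rewrite mulr_ge0 ?face_depth_ge0// ltW.
    move=> i iS'; rewrite ures ?(fintype.subsetP S'S)// mulrC ler_wpM2r ?(ltW r0)//.
    exact: face_depth_ge.
  apply/bigmin_geP; split.
    by rewrite -[leRHS]mulr1 ler_pM ?(ltW r0) ?depth_ge0 ?depth_le1.
  move=> S' cS'.
  have [S'S|S'S] := boolP (S' \subset S); last first.
    apply: (@le_trans _ _ 1); last by apply: out => // i /unres[].
    by rewrite -[leRHS]mulr1 ler_pM ?(ltW r0) ?depth_ge0 ?depth_le1.
  rewrite mulrC -ler_pdivlMr//.
  apply: (@le_trans _ _ (face_depth S' u')); first exact: bigmin_le_cond.
  apply/bigmax_leP; split.
    by rewrite divr_ge0 ?face_depth_ge0// ltW.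
  move=> i iS'; rewrite ler_pdivlMr// mulrC -ures ?(fintype.subsetP S'S)//.
  exact: face_depth_ge.
apply/rowP => i; rewrite !mxE.
rewrite (@push_cellE _ (K ord0 i)) ?depth_le1//.
rewrite (@push_cellE _ (K ord0 i) (depth u)) ?depth_le1//; congr (_ + _).
have [iS|iS] := boolP (i \in S); last first.
  by rewrite u'nS// !push1 ?depth_le1// unS.
rewrite u'S// dE /push.
set w := u ord0 i - _.
have -> : Num.max (r * depth u') `|w| = r * Num.max (depth u') `|w / r|.
  rewrite maxr_pMr ?(ltW r0)// normrM normfV (gtr0_norm r0); congr Num.max.
  by rewrite [RHS]mulrC divfK// gt_eqF.
by rewrite invfM mulrA.
Qed.

End depth.

(** * Measurability and lower integrals *)

Lemma if_ge0 {R : realType} (b : bool) (t : \bar R) :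
  (0 <= t)%E -> (0 <= if b then t else 0)%E.
Proof. by case: b. Qed.

Section measurability.
Context d (T : measurableType d) {R : realType}.
Implicit Types (b : T -> bool).

Lemma measurable_fun_if0 b (f : T -> \bar R) : measurable_fun setT b ->
  measurable_fun setT f ->
  measurable_fun setT (fun t => if b t then f t else 0%E).
Proof.
move=> mb mf; by apply: measurable_fun_if => //; exact: measurable_funTS.
Qed.

Lemma measurable_mem d' (T' : measurableType d') (A : set T') (f : T -> T') :
  measurable A -> measurable_fun setT f ->
  measurable_fun setT (fun t => f t \in A).
Proof.
move=> mA mf; apply: (measurable_fun_bool true).
rewrite setTI (_ : _ @^-1` _ = f @^-1` A); last first.
  by apply/seteqP; split => t /= => [/set_mem//|At]; exact: mem_set.
by rewrite -[X in measurable X]setTI; exact: mf.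
Qed.

Lemma measurable_fun_bigmax (I : Type) (s : seq I) (P : pred I) (x : R)
    (F : I -> T -> R) : (forall i, measurable_fun setT (F i)) ->
  measurable_fun setT (fun t => \big[Num.max/x]_(i <- s | P i) F i t).
Proof.
move=> mF; elim: s => [|i s IH].
  by under eq_fun do rewrite big_nil; exact: measurable_cst.
under eq_fun do rewrite big_cons.
by case: (P i) => //; exact: measurable_maxr.
Qed.

Lemma measurable_fun_bigmin (I : Type) (s : seq I) (P : pred I) (x : R)
    (F : I -> T -> R) : (forall i, measurable_fun setT (F i)) ->
  measurable_fun setT (fun t => \big[Num.min/x]_(i <- s | P i) F i t).
Proof.
move=> mF; elim: s => [|i s IH].
  by under eq_fun do rewrite big_nil; exact: measurable_cst.
under eq_fun do rewrite big_cons.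
by case: (P i) => //; exact: measurable_minr.
Qed.

Section rV.
Context {n : nat}.
Implicit Types (f g : T -> 'rV[R]_n).

Lemma measurable_coordT f i : measurable_fun setT f ->
  measurable_fun setT (fun t => f t ord0 i).
Proof. by move=> mf; exact: (measurableT_comp (@measurable_coord R n i)). Qed.

Lemma measurable_rV_norm f : measurable_fun setT f ->
  measurable_fun setT (fun t => `|f t|).
Proof.
move=> mf; under eq_fun do rewrite rV_normE.
apply: measurable_fun_bigmax => i.
by apply: measurableT_comp => //; exact: measurable_coordT.
Qed.

Lemma measurable_rVB f g : measurable_fun setT f -> measurable_fun setT g ->
  measurable_fun setT (fun t => f t - g t).
Proof.
move=> mf mg; apply: measurable_fun_rVP => i; under eq_fun do rewrite !mxE.
by apply: measurable_funB; exact: measurable_coordT.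
Qed.

Lemma measurable_rVD f g : measurable_fun setT f -> measurable_fun setT g ->
  measurable_fun setT (fun t => f t + g t).
Proof.
move=> mf mg; apply: measurable_fun_rVP => i; under eq_fun do rewrite !mxE.
by apply: measurable_funD; exact: measurable_coordT.
Qed.

Lemma measurable_rVZ f (a : R) : measurable_fun setT f ->
  measurable_fun setT (fun t => a *: f t).
Proof.
move=> mf; apply: measurable_fun_rVP => i; under eq_fun do rewrite !mxE.
by apply: measurable_funM => //; exact: measurable_coordT.
Qed.

Lemma measurable_dist f g : measurable_fun setT f -> measurable_fun setT g ->
  measurable_fun setT (fun t => `|f t - g t|).
Proof. by move=> mf mg; apply: measurable_rV_norm; exact: measurable_rVB. Qed.

End rV.

Lemma measurable_funV_ge0 (f : T -> R) : (forall t, 0 <= f t) ->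
  measurable_fun setT f -> measurable_fun setT (fun t => (f t)^-1).
Proof.
move=> f0 mf; under eq_fun do rewrite -powR_inv1//.
exact: (measurableT_comp (measurable_powR _)).
Qed.

End measurability.

Section rV_sets.
Context {R : realType} {n : nat}.
Implicit Types (x y : 'rV[R]_n) (r : R).
Local Notation mu := (lebesgue_rV R n).

Lemma rV_cballE x r : 0 <= r ->
  [set y : 'rV[R]_n | `|y - x| <= r] =
  [set y | forall i, (`[x ord0 i - r, x ord0 i + r]%classic) (y ord0 i)].
Proof.
move=> r0; apply/seteqP; split => y /=.
  move=> /rV_norm_leP h i; have := h r0 i.
  by rewrite !mxE in_itv/= ler_distl.
move=> h; apply/rV_norm_leP => // i; have := h i.
by rewrite !mxE in_itv/= ler_distl.
Qed.

Lemma lebesgue_rV_cball x r : 0 <= r ->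
  mu [set y : 'rV[R]_n | `|y - x| <= r] = ((2 * r) ^+ n)%:E.
Proof.
move=> r0; rewrite rV_cballE// (@lebesgue_rV_box R n
  (fun i => `[x ord0 i - r, x ord0 i + r]%classic)); last first.
  by move=> i; exact: measurable_itv.
rewrite (eq_bigr (fun=> (2 * r)%:E)); last first.
  move=> i _; rewrite lebesgue_measure_itv/= lte_fin.
  have [r1|r1] := ltP (x ord0 i - r) (x ord0 i + r).
    by congr (_%:E); ring.
  by congr (_%:E); lra.
elim: n => [|k IH]; first by rewrite big_ord0 expr0.
by rewrite big_ord_recl IH exprS EFinM.
Qed.

Lemma measurable_cball x r : measurable [set y : 'rV[R]_n | `|y - x| <= r].
Proof.
have -> : [set y : 'rV[R]_n | `|y - x| <= r] =
    setT `&` (fun y => `|y - x| <= r) @^-1` [set true].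
  by rewrite setTI; apply/seteqP; split => y /=.
apply: (measurable_fun_ler _ (measurable_cst r)) => //.
by apply: measurable_dist.
Qed.

(** The sigma-algebra is generated by the coordinates rather than by the open sets. An open set is
    the union of the countably many closed cubes with rational center and radius 1/(k+1) that it
    contains. *)
Lemma open_measurable_rV (U : set 'rV[R]_n) : open U -> measurable U.
Proof.
move=> oU.
pose B (z : 'rV[rat]_n * nat) : set 'rV[R]_n :=
  [set y | `|y - map_mx ratr z.1| <= z.2.+1%:R^-1].
have -> : U = \bigcup_z (if `[< B z `<=` U >] then B z else set0).
  apply/seteqP; split => [x Ux|x [z _]]; last by case: asboolP => // BU; exact: BU.
  have /nbhs_ballP[e /= e0 eU] : nbhs x U by exact: open_nbhs_nbhs.
  pose k := Num.truncn (2 / e); have k0 : (0 < k.+1%:R^-1 :> R) by rewrite invr_gt0.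
  have ke : k.+1%:R^-1 + k.+1%:R^-1 < e.
    have := truncnS_gt (2 / e); rewrite -/k => ke.
    rewrite (_ : _ + _ = 2 / k.+1%:R); last by ring.
    by rewrite ltr_pdivrMr// mulrC -ltr_pdivrMr.
  have /choice[q qP] : forall i : 'I_n, exists q : rat,
      `|x ord0 i - ratr q| <= k.+1%:R^-1.
    move=> i; have xk : x ord0 i - k.+1%:R^-1 < x ord0 i by rewrite ltrBlDr ltrDl.
    have [q] := rat_in_itvoo xk.
    rewrite in_itv/= ltrBlDr => /andP[q1 q2]; exists q.
    by rewrite ler_distl lerBlDr (ltW q1) (le_trans (ltW q2))// lerDl ltW.
  exists (\row_i q i, k) => //.
  have Bx : B (\row_i q i, k) x.
    apply/rV_norm_leP; first exact: ltW.
    by move=> i; rewrite !mxE.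
  case: asboolP => // -[] y By; apply: eU.
  rewrite mx_norm_ball /ball_/=; apply: le_lt_trans ke.
  apply: le_trans (ler_distD (map_mx ratr (\row_i q i)) _ _) _.
  by apply: lerD => //; rewrite distrC.
apply: countable_bigcupT_measurable => //.
move=> z; case: asboolP => // _; exact: measurable_cball.
Qed.

End rV_sets.

Section raw_monotonicity.
Context d (T : measurableType d) {R : realType} (mu : {measure set T -> \bar R}).
Import HBNNSimple.
Local Open Scope ereal_scope.

(* The integral of a nonnegative function is its lower integral, which is
   monotone without any measurability assumption. *)
Lemma ae_ge0_le_integral_raw (D E : set T) (f g : T -> \bar R) :
  (forall x, D x -> 0 <= f x) -> (forall x, E x -> 0 <= g x) ->
  {ae mu, forall x, D x -> E x /\ f x <= g x} ->
  \int[mu]_(x in D) f x <= \int[mu]_(x in E) g x.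
Proof.
move=> f0 g0 [N [mN N0 fg]].
rewrite (ge0_integralE _ f0) (ge0_integralE _ g0).
apply: ge_ereal_sup => _ [h hf <-].
have mNC : measurable (~` N) by exact: measurableC.
(* A simple function below f is set to 0 on the exceptional null set, which keeps its integral and
   puts it below g everywhere. *)
have -> : sintegral mu h = sintegral mu (proj_nnsfun h mNC).
  have -> : sintegral mu h = \int[mu]_x (h x)%:E.
    by rewrite integral_nnsfun// patch_setT.
  have -> : sintegral mu (proj_nnsfun h mNC) = \int[mu]_x (proj_nnsfun h mNC x)%:E.
    by rewrite integral_nnsfun// patch_setT.
  apply: ge0_ae_eq_integral => //.
  - exact/measurable_EFinP.
  - exact/measurable_EFinP/measurable_funP.
  - by move=> x _; rewrite lee_fin.
  - by move=> x _; rewrite lee_fin.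
  - exists N; split => // x /= xN; apply: contrapT => Nx; apply: xN => _.
    by rewrite /= mindicE mem_set ?mulr1.
apply: ereal_sup_ubound; exists (proj_nnsfun h mNC) => // x /=.
rewrite mindicE; have [xN|xN] := boolP (x \in ~` N); last first.
  by rewrite mulr0; exact: erestrict_ge0.
rewrite mulr1 (le_trans (hf x))//.
rewrite !patchE; case: ifPn => [/set_mem Dx|Dx]; last first.
  by case: ifPn => // /set_mem; exact: g0.
have [Ex fgx] : E x /\ f x <= g x.
  move: xN; rewrite inE /= => xN; apply: contrapT => h'; apply: xN.
  by apply: fg => /= /(_ Dx).
by rewrite mem_set.
Qed.

Lemma ge0_le_integral_raw (D E : set T) (f g : T -> \bar R) :
  (forall x, D x -> 0 <= f x) -> (forall x, E x -> 0 <= g x) ->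
  (forall x, D x -> E x /\ f x <= g x) ->
  \int[mu]_(x in D) f x <= \int[mu]_(x in E) g x.
Proof.
by move=> f0 g0 fg; apply: ae_ge0_le_integral_raw => //; apply: aeW.
Qed.

End raw_monotonicity.

(** * Translations and averages over the origin of the mesh *)

Section translation.
Context {R : realType}.
Local Open Scope ereal_scope.

(** The translated measure agrees with Lebesgue measure on half-open intervals, hence everywhere by
    uniqueness. *)
Lemma ge0_integral_lebesgue_shift (t : R) (g : measurableTypeR R -> \bar R) :
  measurable_fun setT g -> (forall x, 0 <= g x) ->
  \int[@lebesgue_measure R]_x g (x + t)%R = \int[@lebesgue_measure R]_x g x.
Proof.
move=> mg g0.
have ms : measurable_fun setT (fun x : measurableTypeR R => (x + t)%R : measurableTypeR R).
  by apply: measurable_funD => //; exact: measurable_cst.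
rewrite [RHS](@eq_measure_integral _ _ _ _ (pushforward (@lebesgue_measure R)
    (fun x : measurableTypeR R => (x + t)%R : measurableTypeR R))); last first.
  move=> /= A mA _; apply: lebesgue_measure_unique => //= _ [[a b]] _ <-.
  rewrite /pushforward (_ : _ @^-1` _ = `]a - t, b - t]%classic)%R; last first.
    by apply/seteqP; split => x /=; rewrite !in_itv/= ltrBlDr lerBrDr.
  rewrite !lebesgue_measure_itv/= !lte_fin ltrD2r.
  by case: ifPn => // _; rewrite -!EFinB; congr (_%:E); ring.
by rewrite ge0_integral_pushforward//= => x _.
Qed.

Lemma ge0_integral_rVS n (g : 'rV[R]_n.+1 -> \bar R) :
  measurable_fun setT g -> (forall x, 0 <= g x) ->
  \int[lebesgue_rV R n.+1]_x g x =
  \int[@lebesgue_measure R]_a \int[lebesgue_rV R n]_y g (consrV (a, y)).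
Proof.
move=> mg g0.
rewrite (_ : \int[_]_x g x = \int[pushforward ((@lebesgue_measure R) \x (lebesgue_rV R n)) (@consrV R n)]_x g x)//.
rewrite ge0_integral_pushforward//=; last exact: measurable_consrV.
rewrite fubini_tonelli1//=.
by apply: (measurableT_comp mg); exact: measurable_consrV.
Qed.

Lemma ge0_integral_rV_shift n (t : 'rV[R]_n) (g : 'rV[R]_n -> \bar R) :
  measurable_fun setT g -> (forall x, 0 <= g x) ->
  \int[lebesgue_rV R n]_x g (x + t)%R = \int[lebesgue_rV R n]_x g x.
Proof.
elim: n t g => [|n IH] t g mg g0.
  by apply: eq_integral => x _; congr g; apply/rowP; case.
have mgt : measurable_fun setT (fun x : 'rV[R]_n.+1 => g (x + t)%R).
  apply: (measurableT_comp mg); apply: measurable_rVD => //; exact: measurable_cst.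
rewrite (ge0_integral_rVS mg g0) (ge0_integral_rVS mgt (fun x => g0 _)).
pose t' : 'rV[R]_n := (\row_i t ord0 (lift ord0 i))%R.
pose F (a : measurableTypeR R) := \int[lebesgue_rV R n]_y g (consrV (a, y)).
transitivity (\int[@lebesgue_measure R]_a F (a + t ord0 ord0)%R).
  apply: eq_integral => a _.
  rewrite /F -(IH t' (fun y => g (consrV ((a + t ord0 ord0)%R, y))))//.
    apply: eq_integral => y _; congr g; apply/rowP => i; rewrite !mxE.
    by case: unliftP => [k|] ->//=; rewrite !mxE.
  apply: (measurableT_comp mg); apply: (measurableT_comp (@measurable_consrV R n)).
  exact: pair1_measurable.
rewrite ge0_integral_lebesgue_shift//.
  apply: (@measurable_fun_fubini_tonelli_F _ _ _ _ R (lebesgue_rV R n)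
    (fun z : measurableTypeR R * 'rV[R]_n => g (consrV z))) => //.
  by apply: (measurableT_comp mg); exact: measurable_consrV.
by move=> a; apply: integral_ge0.
Qed.

(* Averaging over the origin [T] of the mesh turns the singular composition
   with [Phi] into a translation. *)
Lemma integral_mesh_average n (Phi : 'rV[R]_n -> 'rV[R]_n)
    (w g : 'rV[R]_n -> \bar R) :
  measurable_fun setT Phi -> measurable_fun setT w -> measurable_fun setT g ->
  (forall x, 0 <= w x) -> (forall x, 0 <= g x) ->
  \int[lebesgue_rV R n]_T \int[lebesgue_rV R n]_x
     (w (x - T)%R * g (T + Phi (x - T))%R) =
  (\int[lebesgue_rV R n]_u w u) * \int[lebesgue_rV R n]_x g x.
Proof.
move=> mPhi mw mg w0 g0.
pose h (z : 'rV[R]_n * 'rV[R]_n) := w z.2 * g (z.1 + Phi z.2)%R.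
have mh : measurable_fun setT h.
  apply: emeasurable_funM; first exact: (measurableT_comp mw).
  apply: (measurableT_comp mg); apply: measurable_rVD => //.
  exact: measurableT_comp.
transitivity (\int[lebesgue_rV R n]_T \int[lebesgue_rV R n]_u h (T, u)).
  apply: eq_integral => T _.
  rewrite -(@ge0_integral_rV_shift _ T (fun x => w (x - T)%R * _))//.
  - by apply: eq_integral => u _; rewrite addrK.
  - have mT : measurable_fun setT (fun x : 'rV[R]_n => x - T)%R.
      by apply: measurable_rVB => //; exact: measurable_cst.
    have mhT : measurable_fun setT (fun u => h (T, u)).
      by apply: measurableT_comp => //; exact: pair1_measurable.
    exact: (measurableT_comp mhT mT).
  - by move=> x; rewrite mule_ge0.
(* For fixed u the argument of [g] is T translated by the constant vector [Phi u], so the integral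
   over T no longer sees [Phi]. *)
rewrite fubini_tonelli//; last by move=> z; rewrite mule_ge0.
transitivity (\int[lebesgue_rV R n]_u (w u * \int[lebesgue_rV R n]_x g x)).
  apply: eq_integral => u _; rewrite /h /= ge0_integralZl//.
    by congr (_ * _); exact: ge0_integral_rV_shift.
  apply: (measurableT_comp mg); apply: measurable_rVD => //; exact: measurable_cst.
under eq_integral do rewrite muleC.
rewrite (@ge0_integralZl _ _ _ _ setT measurableT w mw)//; first exact: muleC.
exact: integral_ge0.
Qed.

End translation.

Section measurable_mesh_proj.
Context {R : realType} {n : nat}.
Variable j : nat.

Lemma measurable_cell : measurable_fun setT (fun t : R => (cell t)%:~R : R).
Proof.
apply: nondecreasing_measurable => // x y xy.
by rewrite ler_int; apply: le_floor; rewrite ler_pM2r ?lerD2r.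
Qed.

Lemma measurable_res : measurable_fun setT (@res R).
Proof.
apply: measurable_funB => //; apply: measurable_funM => //.
exact: measurable_cell.
Qed.

Lemma measurable_depth : measurable_fun setT (@depth R n j).
Proof.
apply: measurable_fun_bigmin => S; apply: measurable_fun_bigmax => i.
apply: measurableT_comp => //.
by apply: measurableT_comp; [exact: measurable_res|exact: measurable_coord].
Qed.

Lemma measurable_mesh_proj : measurable_fun setT (@mesh_proj R n j).
Proof.
apply: measurable_fun_rVP => i; under eq_fun do rewrite mxE.
have mc := @measurable_coord R n i.
apply: measurable_funD.
  apply: measurable_funM => //.
  exact: (measurableT_comp measurable_cell mc).
have mr := measurableT_comp measurable_res mc.
apply: measurable_funM => //; apply: measurable_funV_ge0.
  by move=> u; rewrite le_max depth_ge0.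
apply: measurable_maxr; first exact: measurable_depth.
exact: measurableT_comp.
Qed.

End measurable_mesh_proj.

(** * Dyadic layers *)

Section dyadic.
Context {R : realType}.

Lemma nneseries_geometric_le (M q : R) : 0 <= M -> 0 <= q < 1 ->
  (\sum_(0 <= k <oo) (M * q ^+ k)%:E <= (M / (1 - q))%:E)%E.
Proof.
move=> M0 /andP[q0 q1]; apply: lime_le.
  by apply: is_cvg_nneseries => k _ _; rewrite lee_fin mulr_ge0// exprn_ge0.
apply: nearW => k; rewrite sumEFin lee_fin -mulr_sumr ler_wpM2l//.
rewrite -[leRHS]div1r ler_pdivlMr ?subr_gt0// mulrC big_mkord.
by rewrite -opprB mulNr -subrX1 opprB lerBlDr lerDl exprn_ge0.
Qed.

(** Serves both singular integrals: the tail of the kernel, with growing balls as layers, and the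
    weight, with layers shrinking to its singular set. *)
Lemma integral_le_layers d (T : measurableType d) (mu : {measure set T -> \bar R})
    (f : T -> \bar R) (D : nat -> set T) (c : nat -> R) (M q : R) :
  (forall k, measurable (D k)) -> (forall k, 0 <= c k) -> 0 <= M -> 0 <= q < 1 ->
  (forall x, 0 <= f x)%E ->
  (forall x, f x <= \sum_(0 <= k <oo) (c k * \1_(D k) x)%:E)%E ->
  (forall k, (c k)%:E * mu (D k) <= (M * q ^+ k)%:E)%E ->
  (\int[mu]_x f x <= (M / (1 - q))%:E)%E.
Proof.
move=> mD c0 M0 q01 f0 fD cD.
have D0 k x : (0 <= (c k * \1_(D k) x)%:E)%E by rewrite lee_fin mulr_ge0.
apply: (@le_trans _ _ (\int[mu]_x \sum_(0 <= k <oo) (c k * \1_(D k) x)%:E)%E).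
  apply: ge0_le_integral_raw => // x _.
  by apply: nneseries_ge0.
rewrite integral_nneseries//; last first.
  by move=> k; apply/measurable_EFinP; apply: measurable_funM.
apply: le_trans (nneseries_geometric_le M0 q01).
apply: lee_nneseries => k _; first by move=> _; apply: integral_ge0.
under eq_integral do rewrite EFinM.
rewrite ge0_integralZl_EFin//; last exact/measurable_EFinP.
by rewrite integral_indic// setIT.
Qed.

Lemma nneseries_ge_term (c : nat -> R) k : (forall i, 0 <= c i) ->
  ((c k)%:E <= \sum_(0 <= i <oo) (c i)%:E)%E.
Proof.
move=> c0; apply: (@le_trans _ _ (\sum_(0 <= i < k.+1) (c i)%:E)%E); last first.
  by apply: nneseries_lim_ge => i _ _; rewrite lee_fin.
by rewrite big_nat_recr//= leeDr// sume_ge0// => i _; rewrite lee_fin.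
Qed.

(** Takes care of the points of depth 0: they lie in all the layers, and the weight is infinite
    there. *)
Lemma nneseries_unbounded (c : nat -> R) : (forall i, 1 <= c i) ->
  (\sum_(0 <= i <oo) (c i)%:E = +oo)%E.
Proof.
move=> c1; apply/eqyP => A A0.
pose k := (Num.truncn A).+1.
apply: (@le_trans _ _ (\sum_(0 <= i < k) (c i)%:E)%E); last first.
  by apply: nneseries_lim_ge => i _ _; rewrite lee_fin (le_trans ler01).
rewrite sumEFin lee_fin (le_trans (ltW (truncnS_gt A)))//.
rewrite -/k -[leLHS](_ : \sum_(0 <= i < k) 1 = _); last first.
  by rewrite big_mkord sumr_const card_ord.
exact: ler_sum.
Qed.

Lemma dyadic_scale (r : R) : 1 <= r -> exists k, 2 ^+ k <= r <= 2 ^+ k.+1.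
Proof.
move=> r1.
have ex : exists k, r <= 2 ^+ k.+1.
  exists (Num.truncn r); apply: le_trans (ltW (truncnS_gt _)) _.
  by rewrite -natrX ler_nat ltnW// ltn_expl.
have := ex_minnP ex; case=> -[|k] rk kmin; first by exists 0%N; rewrite expr0 r1.
exists k.+1; rewrite rk andbT leNgt; apply/negP => /ltW /kmin.
by rewrite ltnn.
Qed.

Lemma powR2_lt1 (s : R) : 0 < s -> 0 <= 2 `^ (- s) < 1.
Proof.
move=> s0; rewrite powR_ge0/= powRN invf_lt1 ?powR_gt0//.
by rewrite /powR gt_eqF// expR_gt1 mulr_gt0// ln_gt0// ltr1n.
Qed.

End dyadic.

Section kernel_tail.
Context {R : realType} {n : nat}.
Implicit Types (x y : 'rV[R]_n) (s r : R).

(** The Gagliardo kernel for the sup norm. In the sections on the kernel, the weight and the energy,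
    [s] stands for the product s p of the theorem. For positive [s] the kernel is 0 on the diagonal,
    by the convention on inverses. *)
Definition kern s x y : R := (`|x - y| `^ (n%:R + s))^-1.

Lemma kern_ge0 s x y : 0 <= kern s x y.
Proof. by rewrite invr_ge0 powR_ge0. Qed.

Lemma kern_sym s x y : kern s x y = kern s y x.
Proof. by rewrite /kern distrC. Qed.

Lemma le_kern s x y r : 0 < s -> 0 < r -> r <= `|x - y| ->
  kern s x y <= (r `^ (n%:R + s))^-1.
Proof.
move=> s0 r0 rxy; have xy0 := lt_le_trans r0 rxy.
rewrite /kern lef_pV2 ?posrE ?powR_gt0//.
by apply: ge0_ler_powR => //; rewrite ?nnegrE ?addr_ge0// ltW.
Qed.

Lemma measurable_kern d (T : measurableType d) s (f g : T -> 'rV[R]_n) :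
  measurable_fun setT f -> measurable_fun setT g ->
  measurable_fun setT (fun t => kern s (f t) (g t)).
Proof.
move=> mf mg; apply: measurable_funV_ge0; first by move=> t; exact: powR_ge0.
apply: (measurableT_comp (measurable_powR _)); exact: measurable_dist.
Qed.

Lemma powRVn s k : ((2 : R) ^+ k) `^ (- s) = (2 `^ (- s)) ^+ k.
Proof. by rewrite -(@powR_mulrn R 2 k)// powRAC powR_mulrn ?powR_ge0. Qed.

Definition tail_const s : R := 4 ^+ n / (1 - 2 `^ (- s)).

Lemma tail_const_ge0 s : 0 < s -> 0 <= tail_const s.
Proof.
move=> /powR2_lt1/andP[_ q1]; apply: divr_ge0; first exact: exprn_ge0.
by rewrite subr_ge0 ltW.
Qed.

(** On the shell 2^k r <= |x - y| <= 2^(k+1) r the kernel is at most (2^k r)^(-n-s), and the shell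
    lies in a cube of volume (4 2^k r)^n. The shells therefore contribute 4^n r^(-s) times a
    geometric series of ratio 2^(-s). *)
Lemma integral_kern_tail s x r : 0 < s -> 0 < r ->
  (\int[lebesgue_rV R n]_y (if (r <= `|x - y|)%R then (kern s x y)%:E else 0)
    <= (tail_const s * r `^ (- s))%:E)%E.
Proof.
move=> s0 r0.
pose D k := [set y : 'rV[R]_n | `|y - x| <= 2 ^+ k.+1 * r].
pose c k := ((2 ^+ k * r) `^ (n%:R + s))^-1.
have c0 k : 0 <= c k by rewrite invr_ge0 powR_ge0.
rewrite (_ : tail_const s * _ = (4 ^+ n * r `^ (- s)) / (1 - 2 `^ (- s))); last first.
  by rewrite /tail_const mulrAC.
apply: (@integral_le_layers _ _ _ _ _ D c) => //.
- by move=> k; exact: measurable_cball.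
- by rewrite mulr_ge0 ?powR_ge0// exprn_ge0.
- exact: powR2_lt1.
- by move=> y; case: ifP => // _; rewrite lee_fin kern_ge0.
- move=> y; case: ifPn => [ry|_]; last first.
    by apply: nneseries_ge0 => k _ _; rewrite lee_fin mulr_ge0.
  have [k /andP[k1 k2]] : exists k, 2 ^+ k <= `|x - y| / r <= 2 ^+ k.+1.
    by apply: dyadic_scale; rewrite ler_pdivlMr// mul1r.
  apply: le_trans (@nneseries_ge_term _ (fun k => c k * \1_(D k) y) k _); last first.
    by move=> i; rewrite mulr_ge0.
  rewrite lee_fin indicE mem_set ?mulr1; last first.
    by rewrite /D/= distrC -ler_pdivrMr.
  apply: le_kern => //; first by rewrite mulr_gt0// exprn_gt0.
  by rewrite -ler_pdivlMr.
- move=> k; have /lebesgue_rV_cball Dk : 0 <= 2 ^+ k.+1 * r.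
    by rewrite mulr_ge0 ?exprn_ge0// ltW.
  rewrite [X in (_ * X)%E](Dk n x).
  rewrite -EFinM lee_fin /c.
  set a := 2 ^+ k * r; have a0 : 0 < a by rewrite mulr_gt0// exprn_gt0.
  rewrite (_ : 2 * (2 ^+ k.+1 * r) = 4 * a); last by rewrite /a exprS; ring.
  rewrite -powRN opprD powRD ?(gt_eqF a0) ?implybT// powR_invn ?(ltW a0)//.
  have : a ^+ n != 0 by rewrite expf_neq0// gt_eqF.
  rewrite [(4 * a) ^+ n]exprMn mulrAC [_^-1 * (_ * _)]mulrCA; move: (a ^+ n) => A /mulVf ->; rewrite mulr1.
  by rewrite -mulrA ler_wpM2l ?exprn_ge0// /a powRM ?exprn_ge0 ?(ltW r0)// powRVn mulrC.
Qed.

End kernel_tail.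

(** * Integrability of the weight near the singular set of the projections *)

Section weight.
Context {R : realType}.

Lemma measure_seq_cover d (T : measurableType d) (mu : {measure set T -> \bar R})
    (I : Type) (s : seq I) (A : I -> set T) (B : set T) (c : R) :
  (forall i, measurable (A i)) -> measurable B ->
  B `<=` \big[setU/set0]_(i <- s) A i -> (forall i, mu (A i) <= c%:E)%E ->
  (mu B <= ((size s)%:R * c)%:E)%E.
Proof.
move=> mA mB BA Ac.
have mU : forall s' : seq I, measurable (\big[setU/set0]_(i <- s') A i).
  by move=> s'; elim/big_rec: _ => // i C _ mC; exact: measurableU.
apply: (@le_trans _ _ (mu (\big[setU/set0]_(i <- s) A i))).
  by apply: le_measure; rewrite ?inE.
elim: s {BA} => [|i s IH]; first by rewrite big_nil measure0 mul0r.
rewrite big_cons/= -natr1 mulrDl mul1r addrC EFinD.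
apply: (@le_trans _ _ (mu (A i) + mu (\big[setU/set0]_(i <- s) A i))%E).
  exact: measureU2.
by apply: leeD; [exact: Ac|exact: IH].
Qed.

Definition layer1 (e B t : R) : set R :=
  [set v | `|v| <= B /\ `|res (e^-1 * v)| <= t].

Lemma measurable_layer1 e B t : measurable (layer1 e B t).
Proof.
rewrite (_ : layer1 e B t = setT `&`
    (fun v => (`|v| <= B) && (`|res (e^-1 * v)| <= t)) @^-1` [set true]).
  have : measurable_fun setT (fun v : R => (`|v| <= B) && (`|res (e^-1 * v)| <= t)).
    apply: measurable_and; apply: measurable_fun_ler => //.
    apply: measurableT_comp => //; apply: (measurableT_comp measurable_res).
    exact: measurable_funM.
  exact.
by rewrite setTI; apply/seteqP; split => v /= => [[-> ->]|/andP[]].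
Qed.

(** The layer is covered by 2 N + 1 intervals of length 2 e t around even multiples of e, with e N
    <= B + e. The total length is at most (4 (B + e) + 2 e) t, and e <= B gives 10 B t. *)
Lemma lebesgue_layer1 e B t : 0 < e -> e <= B -> 0 <= t ->
  ((@lebesgue_measure R) (layer1 e B t) <= (10 * B * t)%:E)%E.
Proof.
move=> e0 eB t0.
have B0 : 0 < B by exact: lt_le_trans eB.
pose N := (Num.truncn (B / e)).+1.
pose A (i : nat) : set (measurableTypeR R) :=
  `[2 * e * (i%:R - N%:R) - e * t, 2 * e * (i%:R - N%:R) + e * t]%classic.
have Ac i : ((@lebesgue_measure R) (A i) <= (2 * (e * t))%:E)%E.
  rewrite lebesgue_measure_itv/= lte_fin; case: ifPn => _.
    by rewrite -EFinB lee_fin; lra.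
  by rewrite lee_fin mulr_ge0// mulr_ge0// ltW.
have NB : N%:R <= B / e + 1.
  rewrite /N -natr1 lerD2r.
  have Be0 : 0 <= B / e by rewrite divr_ge0// ltW.
  by have /andP[] := truncn_itv Be0.
apply: (@le_trans _ _ ((size (iota 0 (2 * N).+1))%:R * (2 * (e * t)))%:E).
  apply: (measure_seq_cover _ _ _ Ac).
  - by move=> i; exact: measurable_itv.
  - exact: measurable_layer1.
  - move=> v [vB vt]; rewrite -bigcup_seq/=.
    set k := cell (e^-1 * v).
    have rE : e^-1 * v - 2 * k%:~R = res (e^-1 * v) by [].
    have vE : v = e * (e^-1 * v) by rewrite mulrA divff ?mul1r// gt_eqF.
    have kN : `|k| <= N%:Z.
      rewrite -(ler_int R) intr_norm -[leRHS]/(N%:R).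
      have : `|e^-1 * v| <= B / e.
        by rewrite normrM normfV (gtr0_norm e0) mulrC ler_wpM2r// invr_ge0 ltW.
      have := res_itv (e^-1 * v); rewrite -rE => /andP[h1 h2].
      have := truncnS_gt (B / e); rewrite -/N.
      have : 1 <= N%:R :> R by rewrite ler1n.
      by rewrite !ler_norml => N1 h3 /andP[h4 h5]; apply/andP; split; lra.
    have kI : absz (k + N%:Z) \in iota 0 (2 * N).+1 by rewrite mem_iota; lia.
    exists (absz (k + N%:Z)) => //.
    have kE : (absz (k + N%:Z))%:R = k%:~R + N%:R :> R.
      rewrite -[LHS]/((absz (k + N%:Z) : int)%:~R) -[N%:R]/((N%:Z)%:~R) -rmorphD/=.
      by congr (_%:~R); lia.
    rewrite /A/= in_itv/= kE; move: vt; rewrite -rE ler_norml => /andP[h1 h2].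
    rewrite addrK vE; apply/andP; split.
      by rewrite [X in X - _](_ : _ = e * (2 * k%:~R)) -?mulrBr ?ler_pM2l//; [lra|ring].
    by rewrite [X in X + _](_ : _ = e * (2 * k%:~R)) -?mulrDr ?ler_pM2l//; [lra|ring].
rewrite size_iota lee_fin.
have : e * N%:R <= B + e by rewrite mulrC -ler_pdivlMr// mulrDl divff ?gt_eqF.
rewrite -addn1 natrD natrM => h.
rewrite (_ : _ * _ = (2 * (2 * (e * N%:R)) + 2 * e) * t); last by ring.
by rewrite ler_wpM2r//; lra.
Qed.

(* Extended-valued at [a = 0], so that no null set has to be discarded when the
   bounds near the singularities of the projections are stated. *)
Definition inv_powR (s a : R) : \bar R :=
  if a == 0 then +oo%E else (a `^ (- s))%:E.

Lemma inv_powR_ge0 s a : (0 <= inv_powR s a)%E.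
Proof. by rewrite /inv_powR; case: ifP => // _; rewrite lee_fin powR_ge0. Qed.

Lemma inv_powR_ge1 s a : 0 < s -> 0 <= a <= 1 -> (1 <= inv_powR s a)%E.
Proof.
move=> s0 /andP[a0 a1]; rewrite /inv_powR.
case: eqP => [_|/eqP aN0]; first by rewrite leey.
have ap : 0 < a by rewrite lt_neqAle eq_sym aN0.
rewrite lee_fin powRN invf_ge1 ?powR_gt0//.
have <- : 1 `^ s = 1 :> R by rewrite powR1.
by apply: ge0_ler_powR; rewrite ?nnegrE// ltW.
Qed.

Lemma measurable_inv_powR d (T : measurableType d) s (f : T -> R) :
  measurable_fun setT f -> measurable_fun setT (fun t => inv_powR s (f t)).
Proof.
move=> mf; apply: measurable_fun_ifT; [|exact: measurable_cst|].
  exact: (measurable_fun_eqr mf (measurable_cst _)).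
by apply/measurable_EFinP; exact: (measurableT_comp (measurable_powR _) mf).
Qed.

Context {n : nat}.
Variables (j : nat) (s : R).

Definition weight (u : 'rV[R]_n) : \bar R := inv_powR s (depth j u).

Lemma weight_ge0 u : (0 <= weight u)%E. Proof. exact: inv_powR_ge0. Qed.

Lemma measurable_weight : measurable_fun setT weight.
Proof. by apply: measurable_inv_powR; exact: measurable_depth. Qed.

Definition layer (e B t : R) : set 'rV[R]_n :=
  [set u | `|u| <= B /\ depth j (e^-1 *: u) <= t].

Lemma measurable_layer e B t : measurable (layer e B t).
Proof.
rewrite (_ : layer e B t = setT `&`
    (fun v => (`|v| <= B) && (depth j (e^-1 *: v) <= t)) @^-1` [set true]).
  have : measurable_fun setT (fun v : 'rV[R]_n => (`|v| <= B) && (depth j (e^-1 *: v) <= t)).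
    apply: measurable_and; apply: measurable_fun_ler => //.
      exact: measurable_rV_norm.
    by apply: (measurableT_comp (@measurable_depth R n j)); exact: measurable_rVZ.
  exact.
by rewrite setTI; apply/seteqP; split => v /= => [[-> ->]|/andP[]].
Qed.

(** Small depth means that some j + 1 coordinates have small residues. For each of the at most 2^n
    sets of coordinates, the box has j + 1 sides of measure at most 10 B t and the others of length
    2 B <= 10 B. *)
Lemma lebesgue_layer e B t : 0 < e -> e <= B -> 0 <= t <= 1 ->
  (lebesgue_rV R n (layer e B t) <= ((20 * B) ^+ n * t ^+ j.+1)%:E)%E.
Proof.
move=> e0 eB /andP[t0 t1].
have B0 : 0 < B by exact: lt_le_trans eB.
(* At t = 1 the cap in [depth] makes the condition void and [depth_leP] provides no set of
   coordinates; the volume (2 B)^n of the whole cube is enough. *)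
move: t1; rewrite le_eqVlt => /predU1P[->|t1].
  rewrite expr1n mulr1.
  apply: (@le_trans _ _ (lebesgue_rV R n [set u : 'rV[R]_n | `|u - 0| <= B])).
    apply: le_measure; rewrite ?inE.
    - exact: measurable_layer.
    - exact: measurable_cball.
    - by move=> u [uB _]; rewrite /= subr0.
  rewrite lebesgue_rV_cball ?(ltW B0)// lee_fin.
  by apply: lerXn2r; rewrite ?nnegrE; lra.
pose BS (S : {set 'I_n}) i := if i \in S then layer1 e B t else `[- B, B]%classic.
have mBS S i : measurable (BS S i).
  by rewrite /BS; case: ifP => _; [exact: measurable_layer1|exact: measurable_itv].
pose A S := [set u : 'rV[R]_n | forall i, BS S i (u ord0 i)].
pose s_ := seq.filter (fun S : {set 'I_n} => #|S| == j.+1) (enum [set: {set 'I_n}]%SET).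
have sz : (size s_)%:R <= 2 ^+ n :> R.
  rewrite -natrX ler_nat (leq_trans (size_subseq (filter_subseq _ _)))//.
  by rewrite -cardE -powersetT card_powerset cardsT card_ord.
have A_le (S : {set 'I_n}) : #|S| = j.+1 ->
    (lebesgue_rV R n (A S) <= ((10 * B) ^+ n * t ^+ j.+1)%:E)%E.
  move=> cS; rewrite (@lebesgue_rV_box R n (BS S))//.
  have -> : (10 * B) ^+ n * t ^+ j.+1 =
      \prod_(i < n) (10 * B * (if i \in S then t else 1)).
    rewrite big_split/= prodr_const card_ord -big_mkcond/= prodr_const cS//.
  have : (forall i, 0 <= (@lebesgue_measure R) (BS S i) <=
     (10 * B * (if i \in S then t else 1))%:E)%E.
    move=> i; rewrite measure_ge0/= /BS; case: ifPn => _.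
      exact: lebesgue_layer1.
    rewrite lebesgue_measure_itv/= lte_fin; case: ifPn => _; rewrite ?lee_fin.
      by rewrite mulr1; lra.
    by rewrite mulr1 mulr_ge0// ltW.
  move=> h; apply: (@le_trans _ _
      (\prod_(i < n) (10 * B * (if i \in S then t else 1))%:E)%E); last first.
    rewrite le_eqVlt; apply/orP; left; apply/eqP.
    elim: (index_enum _) => [|i r IH]; first by rewrite !big_nil.
    by rewrite !big_cons EFinM IH.
  elim: (index_enum _) => [|i r IH]; first by rewrite !big_nil.
  have /andP[h0 h1] := h i.
  rewrite !big_cons; apply: lee_pmul => //.
  by elim/big_ind: _ => // *; exact: mule_ge0.
apply: (@le_trans _ _ ((size s_)%:R * ((10 * B) ^+ n * t ^+ j.+1))%:E); last first.
  rewrite lee_fin (_ : 20 * B = 2 * (10 * B)); last by ring.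
  rewrite [X in _ <= X * _]exprMn -mulrA ler_wpM2r//.
  by rewrite mulr_ge0 ?exprn_ge0 ?mulr_ge0// ltW.
pose A' (S : {set 'I_n}) := if #|S| == j.+1 then A S else set0.
apply: (@measure_seq_cover _ _ _ _ s_ A').
- move=> S; rewrite /A'; case: ifP => // _.
  rewrite (_ : A S = \bigcap_(i in [set: 'I_n]) ((fun u : 'rV[R]_n => u ord0 i) @^-1` BS S i)).
    apply: fin_bigcap_measurable => // i _; rewrite -[X in measurable X]setTI.
    exact: measurable_coord.
  by apply/seteqP; split => u h i; [move=> _|]; exact: h.
- exact: measurable_layer.
- move=> u [uB ut]; have [S cS hS] := depth_leP t1 ut.
  rewrite -bigcup_seq/=; exists S.
    by rewrite /= mem_filter cS eqxx mem_enum inE.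
  rewrite /A' cS eqxx => i; rewrite /BS; case: ifPn => iS.
    split; first exact: le_trans (rV_coord_le _ _) uB.
    by have := hS i iS; rewrite mxE.
  by rewrite /= in_itv/= -ler_norml (le_trans (rV_coord_le _ _) uB).
- move=> S; rewrite /A'; case: eqP => [/A_le//|_].
  by rewrite measure0 lee_fin mulr_ge0 ?exprn_ge0 ?mulr_ge0// ltW.
Qed.

Definition weight_const (B : R) : R :=
  (20 * B) ^+ n * 2 `^ s / (1 - 2 `^ (s - j.+1%:R)).

(** Between depths 2^(-k-1) and 2^(-k) the weight is at most 2^((k+1) s), on a set of measure
    O(2^(-k (j+1))). The series has ratio 2^(s - (j+1)), which is less than 1 exactly when s < j +
    1; the bound does not depend on e. *)
Lemma integral_weight e B : 0 < s < j.+1%:R -> 0 < e -> e <= B ->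
  (\int[lebesgue_rV R n]_u
     (if (`|u| <= B)%R then weight (e^-1 *: u) else 0) <= (weight_const B)%:E)%E.
Proof.
move=> /andP[s0 sj] e0 eB.
have B0 : 0 < B by exact: lt_le_trans eB.
pose c k : R := (2 ^+ k.+1) `^ s.
have c1 k : 1 <= c k.
  have <- : 1 `^ s = 1 :> R by rewrite powR1.
  by apply: ge0_ler_powR; rewrite ?nnegrE ?(ltW s0) ?exprn_ge0// exprn_ege1// ler1n.
have c0 k : 0 <= c k by exact: le_trans (c1 k).
pose D k := layer e B (2 ^- k).
apply: (@integral_le_layers _ _ _ _ _ D c ((20 * B) ^+ n * 2 `^ s)) => //.
- by move=> k; exact: measurable_layer.
- by rewrite mulr_ge0 ?powR_ge0// exprn_ge0// mulr_ge0// ltW.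
- by rewrite -opprB; apply: powR2_lt1; rewrite subr_gt0.
- by move=> u; case: ifP => // _; exact: weight_ge0.
- move=> u; case: ifPn => [uB|_]; last first.
    by apply: nneseries_ge0 => k _ _; rewrite lee_fin mulr_ge0.
  rewrite /weight /inv_powR; case: eqP => [u0|/eqP u0].
    rewrite nneseries_unbounded// => k.
    rewrite indicE mem_set ?mulr1//; split => //.
    by rewrite u0 invr_ge0 exprn_ge0.
  have up : 0 < depth j (e^-1 *: u) by rewrite lt_neqAle eq_sym u0 depth_ge0.
  have [k /andP[k1 k2]] : exists k, 2 ^+ k <= (depth j (e^-1 *: u))^-1 <= 2 ^+ k.+1.
    by apply: dyadic_scale; rewrite invf_ge1// depth_le1.
  apply: le_trans (@nneseries_ge_term _ (fun k => c k * \1_(D k) u) k _); last first.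
    by move=> i; rewrite mulr_ge0.
  rewrite lee_fin indicE mem_set ?mulr1; last first.
    by split => //; rewrite -[leLHS]invrK lef_pV2 ?posrE ?exprn_gt0// invr_gt0.
  rewrite (_ : _ `^ (- s) = (depth j (e^-1 *: u))^-1 `^ s); last first.
    by rewrite -powR_inv1 ?depth_ge0// -powRrM mulN1r.
  by apply: ge0_ler_powR; rewrite ?nnegrE ?(ltW s0) ?exprn_ge0// invr_ge0 ltW.
- move=> k; have t01 : 0 <= (2 ^- k : R) <= 1.
    by rewrite invr_ge0 exprn_ge0//= invf_le1 ?exprn_gt0// exprn_ege1// ler1n.
  apply: (@le_trans _ _ ((c k)%:E * ((20 * B) ^+ n * (2 ^- k) ^+ j.+1)%:E)%E).
    by rewrite lee_pmul2l// ?lebesgue_layer// lte_fin (lt_le_trans ltr01).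
  rewrite -EFinM lee_fin.
  rewrite (_ : c k = 2 `^ s * (2 `^ s) ^+ k); last first.
    by rewrite /c -exprS -(@powR_mulrn R 2 k.+1)// powRAC powR_mulrn ?powR_ge0.
  have -> : 2 `^ (s - j.+1%:R) = 2 `^ s * 2 ^- j.+1 :> R.
    by rewrite powRD ?pnatr_eq0 ?implybT// powR_invn.
  rewrite [X in _ <= _ * X]exprMn.
  rewrite !exprVn -!exprM (mulnC j.+1) le_eqVlt; apply/orP; left; apply/eqP.
  by ring.
Qed.

End weight.

(** * Energy of the composition with the mesh projection *)

Section pairs.
Context {R : realType} {n m : nat}.
Implicit Types (x y c A B : 'rV[R]_n) (r e : R).
Local Notation mu := (lebesgue_rV R n).

Lemma powRD_le (p a b : R) : 0 <= p -> 0 <= a -> 0 <= b ->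
  (a + b) `^ p <= 2 `^ p * (a `^ p + b `^ p).
Proof.
move=> p0; wlog ab : a b / a <= b => [h a0 b0|a0 b0].
  have [ab|/ltW ba] := leP a b; first exact: h.
  by rewrite addrC [X in _ <= _ * X]addrC; exact: h.
apply: (@le_trans _ _ ((2 * b) `^ p)).
  by apply: ge0_ler_powR; rewrite ?nnegrE ?addr_ge0 ?mulr_ge0//; lra.
by rewrite powRM// ler_wpM2l ?powR_ge0// lerDr powR_ge0.
Qed.

Variables (p : R) (v : 'rV[R]_n -> 'rV[R]_m) (om : set 'rV[R]_n).
Hypotheses (p1 : 1 <= p) (mv : measurable_fun setT v) (mom : measurable om).

Let p0 : 0 < p. Proof. exact: lt_le_trans p1. Qed.

(** The cut-off allows integration over the whole space, and it leaves c in [om] as the only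
    condition in the quasi-triangle inequality. *)
Definition pairs x y : R :=
  if (x \in om) && (y \in om) then `|v x - v y| `^ p else 0.

Lemma pairs_ge0 x y : 0 <= pairs x y.
Proof. by rewrite /pairs; case: ifP => // _; exact: powR_ge0. Qed.

Lemma pairsxx x : pairs x x = 0.
Proof. by rewrite /pairs subrr normr0 powR0 ?gt_eqF// if_same. Qed.

Lemma pairsE x y : om x -> om y -> pairs x y = `|v x - v y| `^ p.
Proof. by move=> ox oy; rewrite /pairs !mem_set. Qed.

Lemma pairs_quasi c x y : om c ->
  pairs x y <= 2 `^ p * (pairs x c + pairs y c).
Proof.
move=> oc; rewrite {1}/pairs; case: ifPn => [/andP[/set_mem ox /set_mem oy]|_].
  rewrite !pairsE//; apply: le_trans (powRD_le (ltW p0) _ _) => //.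
  apply: ge0_ler_powR; rewrite ?nnegrE ?addr_ge0 ?(ltW p0)//.
  by rewrite (distrC (v y)); exact: ler_distD.
by rewrite mulr_ge0 ?powR_ge0// addr_ge0 ?pairs_ge0.
Qed.

Lemma measurable_pairs d (T : measurableType d) (f g : T -> 'rV[R]_n) :
  measurable_fun setT f -> measurable_fun setT g ->
  measurable_fun setT (fun t => pairs (f t) (g t)).
Proof.
move=> mf mg; apply: measurable_fun_ifT => //.
  by apply: measurable_and; exact: measurable_mem.
apply: (measurableT_comp (measurable_powR _)).
by apply: measurable_dist; exact: (measurableT_comp mv).
Qed.

Local Open Scope ereal_scope.

Definition ball_pairs r A : \bar R :=
  \int[mu]_c (if (`|A - c| <= r)%R then (pairs A c)%:E else 0).

Lemma measurable_cball_fun d (T : measurableType d) r (f g : T -> 'rV[R]_n) :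
  measurable_fun setT f -> measurable_fun setT g ->
  measurable_fun setT (fun t => (`|f t - g t| <= r)%R).
Proof. by move=> mf mg; apply: measurable_fun_ler => //; exact: measurable_dist. Qed.

Lemma ball_pairs_ge0 r A : 0 <= ball_pairs r A.
Proof.
by apply: integral_ge0 => c _; case: ifP => // _; rewrite lee_fin pairs_ge0.
Qed.

(** The quasi-triangle inequality is integrated over the sup-norm ball of radius r / 2 about the
    midpoint of A and B: it has measure r^n and lies in both balls of radius r. *)
Lemma pairs_le_ball A B r : (0 < r)%R -> (`|A - B| <= r)%R ->
  (forall c, (`|A - c| <= r)%R -> om c) ->
  (r ^+ n * pairs A B)%:E <= (2 `^ p)%:E * (ball_pairs r A + ball_pairs r B).
Proof.
move=> r0 ABr oc.
pose M : 'rV[R]_n := (2^-1 *: (A + B))%R.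
have half A' B' : (`|A' - B'| <= r -> `|A' - 2^-1 *: (A' + B')| <= r / 2)%R.
  move=> h; rewrite (_ : (_ - _)%R = (2^-1 *: (A' - B'))%R); last first.
    by apply/rowP => i; rewrite !mxE; lra.
  by rewrite normrZ gtr0_norm ?invr_gt0// mulrC ler_wpM2r// invr_ge0.
have near c : (`|c - M| <= r / 2 -> `|A - c| <= r /\ `|B - c| <= r)%R.
  move=> cM; split.
    apply: le_trans (ler_distD M _ _) _; rewrite (distrC M c).
    by have := half A B ABr; rewrite -/M; lra.
  apply: le_trans (ler_distD M _ _) _; rewrite (distrC M c).
  have : (`|B - A| <= r)%R by rewrite distrC.
  by move=> /half; rewrite (addrC B A) -/M; lra.
have mb A' : measurable_fun setT
    (fun c => if (`|A' - c| <= r)%R then (pairs A' c)%:E else 0).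
  apply: measurable_fun_if0; first exact: measurable_cball_fun.
  by apply/measurable_EFinP; exact: measurable_pairs.
have b0 A' c : 0 <= (if (`|A' - c| <= r)%R then (pairs A' c)%:E else 0).
  by case: ifP => // _; rewrite lee_fin pairs_ge0.
have -> : (r ^+ n * pairs A B)%:E =
    \int[mu]_(c in [set c | (`|c - M| <= r / 2)%R]) (cst (pairs A B)%:E c).
  rewrite integral_cst; last exact: measurable_cball.
  rewrite [X in _ * X](@lebesgue_rV_cball R n) ?divr_ge0 ?(ltW r0)//.
  by rewrite -EFinM mulrC; congr (_ * _ ^+ n)%:E; lra.
rewrite /ball_pairs -ge0_integralD//.
rewrite -ge0_integralZl//; last 2 first.
- exact: emeasurable_funD.
- by move=> c _; rewrite adde_ge0.
apply: ge0_le_integral_raw.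
- by move=> c _; rewrite lee_fin pairs_ge0.
- by move=> c _; rewrite mule_ge0// ?adde_ge0// lee_fin powR_ge0.
- move=> c /near[Ac Bc]; split => //.
  rewrite Ac Bc -EFinD -EFinM lee_fin /cst; apply: pairs_quasi.
  exact: oc.
Qed.

End pairs.

(** * Gagliardo estimate for a projection with Lipschitz constant 4 / a *)

Section mesh_estimate.
Context {R : realType} {n m : nat}.
Implicit Types (x y c A B : 'rV[R]_n).
Local Notation mu := (lebesgue_rV R n).

Variables (p s : R) (v : 'rV[R]_n -> 'rV[R]_m) (om U : set 'rV[R]_n).
Variables (e : R) (Phi : 'rV[R]_n -> 'rV[R]_n) (a : 'rV[R]_n -> R).
Hypotheses (p1 : 1 <= p) (s0 : 0 < s) (mv : measurable_fun setT v).
Hypotheses (mom : measurable om) (mU : measurable U) (e0 : 0 < e).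
Hypotheses (mPhi : measurable_fun setT Phi) (ma : measurable_fun setT a).
Hypothesis a01 : forall x, 0 <= a x <= 1.
Hypothesis Phi_dist : forall x, `|Phi x - x| <= e.
Hypothesis Phi_lip : forall x y, `|x - y| <= e ->
  a x * `|Phi x - Phi y| <= 4 * `|x - y|.
Hypothesis Uom : forall x c, U x -> `|x - c| <= 5 * e -> om c.

Local Notation P := (pairs p v om).
Local Notation K := (kern s).

Let Pm d (T : measurableType d) (f g : T -> 'rV[R]_n) :
  measurable_fun setT f -> measurable_fun setT g ->
  measurable_fun setT (fun t => P (f t) (g t)).
Proof. exact: measurable_pairs. Qed.

Local Open Scope ereal_scope.

Let integral_param_measurable d1 (X : measurableType d1) (h : X * 'rV[R]_n -> \bar R) :
  measurable_fun setT h -> (forall z, 0 <= h z) ->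
  measurable_fun setT (fun t : X => \int[mu]_y h (t, y)).
Proof. by move=> mh h0; exact: (measurable_fun_fubini_tonelli_F h). Qed.

Let K0 x y : 0 <= (K x y)%:E. Proof. by rewrite lee_fin kern_ge0. Qed.

Let PK0 x y (z w : 'rV[R]_n) : 0 <= (P x y * K z w)%:E.
Proof. by rewrite lee_fin mulr_ge0 ?pairs_ge0 ?kern_ge0. Qed.

(** The radius is 3 e because |Phi(x) - Phi(y)| <= 3 e as soon as |x - y| <= e. Points c that close
    to Phi(x) are within 4 e of x, hence in [om] by the margin 5 e. *)
Definition energy A : \bar R :=
  \int[mu]_c (if (`|A - c| <= 3 * e)%R then (P A c * K A c)%:E else 0).

Lemma energy_ge0 A : 0 <= energy A.
Proof.
by apply: integral_ge0 => c _; apply: if_ge0; exact: PK0.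
Qed.

Lemma measurable_energy : measurable_fun setT energy.
Proof.
apply: (integral_param_measurable (h := fun z : 'rV[R]_n * 'rV[R]_n =>
  if (`|z.1 - z.2| <= 3 * e)%R then (P z.1 z.2 * K z.1 z.2)%:E else 0)).
  apply: measurable_fun_if0; first exact: measurable_cball_fun.
  by apply/measurable_EFinP/measurable_funM; [exact: Pm|exact: measurable_kern].
by move=> z; apply: if_ge0; exact: PK0.
Qed.

Definition wt x : \bar R := inv_powR s (a x).

(* Dominates the average of [P (Phi x)] over the ball of center [Phi x] and
   radius [|Phi x - Phi y|], in a form where [c] can be integrated last. *)
Definition near_kernel x y : \bar R :=
  \int[mu]_c (if ((a x * `|Phi x - c| <= 4 * `|x - y|) && (`|Phi x - c| <= 3 * e))%R
    then ((`|Phi x - c| ^+ n)^-1 * P (Phi x) c)%:E else 0).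

Let nk_ge0 (b : bool) x c :
  0 <= (if b then ((`|Phi x - c| ^+ n)^-1 * P (Phi x) c)%:E else 0).
Proof.
case: ifP => // _.
by rewrite lee_fin mulr_ge0 ?invr_ge0 ?exprn_ge0 ?pairs_ge0.
Qed.

Lemma near_kernel_ge0 x y : 0 <= near_kernel x y.
Proof. by apply: integral_ge0 => c _; exact: nk_ge0. Qed.

Let measurable_nk d (T : measurableType d) (f g h : T -> 'rV[R]_n) :
  measurable_fun setT f -> measurable_fun setT g -> measurable_fun setT h ->
  measurable_fun setT (fun t =>
    if ((a (f t) * `|Phi (f t) - h t| <= 4 * `|f t - g t|) &&
        (`|Phi (f t) - h t| <= 3 * e))%R
    then ((`|Phi (f t) - h t| ^+ n)^-1 * P (Phi (f t)) (h t))%:E else 0).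
Proof.
move=> mf mg mh; have mPf := measurableT_comp mPhi mf.
have md := measurable_dist mPf mh.
apply: measurable_fun_if0.
  apply: measurable_and; last exact: measurable_fun_ler.
  apply: measurable_fun_ler; apply: measurable_funM => //.
    exact: (measurableT_comp ma mf).
  exact: measurable_dist.
apply/measurable_EFinP/measurable_funM; last exact: Pm.
apply: measurable_funV_ge0; first by move=> t; exact: exprn_ge0.
exact: measurable_funX.
Qed.

Lemma measurable_near_kernel :
  measurable_fun setT (fun z : 'rV[R]_n * 'rV[R]_n => near_kernel z.1 z.2).
Proof.
apply: (integral_param_measurable (h := fun w : ('rV[R]_n * 'rV[R]_n) * 'rV[R]_n =>
    if ((a w.1.1 * `|Phi w.1.1 - w.2| <= 4 * `|w.1.1 - w.1.2|) &&
        (`|Phi w.1.1 - w.2| <= 3 * e))%R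
    then ((`|Phi w.1.1 - w.2| ^+ n)^-1 * P (Phi w.1.1) w.2)%:E else 0)) => //.
by apply: measurable_nk => //; exact: measurableT_comp.
Qed.

(** Take the averages at radius r = |Phi(x) - Phi(y)|. In the ball |Phi(x) - c| <= r, the factor
    r^(-n) is at most |Phi(x) - c|^(-n), and the Lipschitz bound gives a(x) |Phi(x) - c| <= a(x) r
    <= 4 |x - y|. Thus Phi(y) disappears from the term of x, and symmetrically. *)
Lemma near_pairs x y : U x -> (`|x - y| <= e)%R ->
  (P (Phi x) (Phi y))%:E <= (2 `^ p)%:E * (near_kernel x y + near_kernel y x).
Proof.
move=> Ux xy; set r := (`|Phi x - Phi y|)%R.
have [r0|r0] := eqVneq r 0%R.
  have -> : Phi x = Phi y by apply/eqP; rewrite -subr_eq0 -normr_eq0 -/r r0.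
  rewrite pairsxx// mule_ge0 ?lee_fin ?powR_ge0//.
  by rewrite adde_ge0// near_kernel_ge0.
have rp : (0 < r)%R by rewrite lt_neqAle eq_sym r0 normr_ge0.
have r3 : (r <= 3 * e)%R.
  apply: le_trans (ler_distD x _ _) _; have := Phi_dist x.
  have := ler_distD y x (Phi y); rewrite (distrC y) => h1.
  by have := Phi_dist y; move: xy h1; lra.
have oc c : (`|Phi x - c| <= r)%R -> om c.
  move=> xc; apply: (Uom Ux); apply: le_trans (ler_distD (Phi x) _ _) _.
  by have := Phi_dist x; rewrite distrC; move: xc r3 e0; lra.
have := pairs_le_ball p1 mv mom rp (lexx _) oc.
have rn0 : (0 < r ^+ n)%R by rewrite exprn_gt0.
have ball_nk x' y' : r = (`|Phi x' - Phi y'|)%R -> (`|x' - y'| <= e)%R ->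
    (r ^- n)%:E * ball_pairs p v om r (Phi x') <= near_kernel x' y'.
  move=> rE xy'; rewrite /ball_pairs -ge0_integralZl//; last 3 first.
  - apply: measurable_fun_if0; first exact: measurable_cball_fun.
    by apply/measurable_EFinP; exact: Pm.
  - by move=> c _; case: ifP => // _; rewrite lee_fin pairs_ge0.
  - by rewrite lee_fin invr_ge0 ltW.
  apply: ge0_le_integral_raw => //.
    move=> c _; case: ifP => _; rewrite ?mule0//.
    by rewrite -EFinM lee_fin mulr_ge0 ?pairs_ge0// invr_ge0 ltW.
  move=> c _; split => //; case: ifPn => [cr|_]; last by rewrite mule0.
  rewrite (le_trans cr r3) andbT ifT; last first.
    apply: le_trans (Phi_lip xy'); rewrite -rE ler_wpM2l//.
    by case/andP: (a01 x').
  rewrite -EFinM lee_fin; have [->|cA] := eqVneq c (Phi x').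
    by rewrite pairsxx// !mulr0.
  have cp : (0 < `|Phi x' - c|)%R by rewrite normr_gt0 subr_eq0 eq_sym.
  rewrite ler_wpM2r ?pairs_ge0// lef_pV2 ?posrE ?exprn_gt0//.
  by rewrite lerXn2r// nnegrE// ltW.
rewrite EFinM -lee_pdivlMl// => h; apply: le_trans h _.
rewrite muleCA; apply: lee_wpmul2l; first by rewrite lee_fin powR_ge0.
rewrite ge0_muleDr ?ball_pairs_ge0//; apply: leeD; first exact: ball_nk.
by apply: ball_nk; rewrite distrC.
Qed.

Definition near_const : R := (@tail_const R n s * 4 `^ s)%R.

Lemma near_const_ge0 : (0 <= near_const)%R.
Proof. by rewrite mulr_ge0 ?powR_ge0// tail_const_ge0. Qed.

Lemma wt_ge0 x : 0 <= wt x. Proof. exact: inv_powR_ge0. Qed.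

(** For fixed c the constraint keeps y at distance at least a(x) |Phi(x) - c| / 4 from x. The kernel
    tail yields a(x)^(-s) |Phi(x) - c|^(-s) up to a constant, and the factor |Phi(x) - c|^(-n)
    completes this to the kernel at (Phi(x), c). Where a(x) = 0, the right-hand side is infinite or
    [pairs] vanishes. *)
Lemma near_tail x c : 
  ((`|Phi x - c| ^+ n)^-1 * P (Phi x) c)%:E *
    \int[mu]_y (if (a x * `|Phi x - c| <= 4 * `|x - y|)%R then (K x y)%:E else 0)
  <= (near_const)%:E * wt x * (P (Phi x) c * K (Phi x) c)%:E.
Proof.
have [P0|P0] := eqVneq (P (Phi x) c) 0%R.
  by rewrite P0 mulr0 mul0r !(mul0e, mule0).
have Pp : (0 < P (Phi x) c)%R by rewrite lt_neqAle eq_sym P0 pairs_ge0.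
have dp : (0 < `|Phi x - c|)%R.
  rewrite normr_gt0 subr_eq0; apply: contraNneq P0 => ->.
  by rewrite pairsxx.
have Kp : (0 < K (Phi x) c)%R by rewrite invr_gt0 powR_gt0.
have tc0 : (0 < near_const)%R.
  rewrite mulr_gt0 ?powR_gt0// divr_gt0 ?exprn_gt0// subr_gt0.
  by case/andP: (powR2_lt1 s0).
rewrite /wt /inv_powR; case: eqP => [_|/eqP a0].
  by rewrite gt0_muley ?lte_fin// gt0_mulye ?lte_fin ?mulr_gt0// leey.
have ap : (0 < a x)%R by rewrite lt_neqAle eq_sym a0; case/andP: (a01 x).
set d := (`|Phi x - c|)%R in dp *.
have rp : (0 < a x * d / 4)%R by rewrite divr_gt0// mulr_gt0.
apply: (@le_trans _ _ ((d ^- n * P (Phi x) c)%:E *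
    (@tail_const R n s * (a x * d / 4) `^ (- s))%:E)).
  apply: lee_wpmul2l.
    by rewrite lee_fin mulr_ge0 ?pairs_ge0// invr_ge0 exprn_ge0// ltW.
  apply: le_trans (integral_kern_tail x s0 rp).
  apply: ge0_le_integral_raw.
  - by move=> y _; apply: if_ge0; exact: K0.
  - by move=> y _; apply: if_ge0; exact: K0.
  - move=> y _; split => //; rewrite ler_pdivrMr// (mulrC (`|x - y|)%R).
    exact: lexx.
rewrite -!EFinM lee_fin /near_const /kern -/d.
rewrite !powRM ?invr_ge0 ?mulr_ge0 ?(ltW ap) ?(ltW dp)//.
rewrite -powRN opprD powRD ?(gt_eqF dp) ?implybT// powR_invn ?(ltW dp)//.
rewrite (_ : (4^-1 `^ (- s) = 4 `^ s)%R); last first.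
  by rewrite -powR_inv1// -powRrM mulrN mulN1r opprK.
rewrite le_eqVlt; apply/orP; left; apply/eqP.
by move: (d ^- n)%R => D; ring.
Qed.

Lemma integral_near x :
  \int[mu]_y ((K x y)%:E * near_kernel x y) <= near_const%:E * wt x * energy (Phi x).
Proof.
rewrite /energy -ge0_integralZl//; last 3 first.
- apply: measurable_fun_if0; first exact: measurable_cball_fun.
  by apply/measurable_EFinP/measurable_funM; [exact: Pm|exact: measurable_kern].
- by move=> c _; apply: if_ge0; exact: PK0.
- by rewrite mule_ge0 ?wt_ge0// lee_fin near_const_ge0.
pose h (z : 'rV[R]_n * 'rV[R]_n) : \bar R := (K x z.1)%:E *
  (if ((a x * `|Phi x - z.2| <= 4 * `|x - z.1|) && (`|Phi x - z.2| <= 3 * e))%R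
    then ((`|Phi x - z.2| ^+ n)^-1 * P (Phi x) z.2)%:E else 0).
have mh : measurable_fun setT h.
  apply: emeasurable_funM.
    by apply/measurable_EFinP; apply: measurable_kern.
  by apply: (@measurable_nk _ _ (cst x)).
have h0 z : 0 <= h z by rewrite mule_ge0// lee_fin kern_ge0.
have -> : \int[mu]_y ((K x y)%:E * near_kernel x y) =
    \int[mu]_y \int[mu]_c h (y, c).
  apply: eq_integral => y _; rewrite /near_kernel -ge0_integralZl//.
  by apply: (@measurable_nk _ _ (cst x) (cst y) id).
(* With y integrated first, [near_tail] applies for each c. *)
rewrite fubini_tonelli//.
apply: ge0_le_integral_raw.
- by move=> c _; apply: integral_ge0 => y _; exact: h0.
- move=> c _; case: ifP => _; rewrite ?mule0//.
  by rewrite !mule_ge0 ?wt_ge0// lee_fin near_const_ge0.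
- move=> c _; split => //; case: ifPn => c3; last first.
    by rewrite mule0 integral0_eq// => y _; rewrite /h/= (negbTE c3) andbF mule0.
  apply: le_trans (near_tail x c).
  rewrite -ge0_integralZl//; last 3 first.
  + apply: measurable_fun_if0; last first.
      by apply/measurable_EFinP; apply: measurable_kern.
    apply: measurable_fun_ler => //; apply: measurable_funM => //.
    exact: measurable_dist.
  + by move=> y _; apply: if_ge0; exact: K0.
  + by rewrite lee_fin mulr_ge0 ?pairs_ge0// invr_ge0 exprn_ge0.
  apply: ge0_le_integral_raw.
  + by move=> y _; exact: h0.
  + move=> y _; case: ifP => _; rewrite ?mule0//.
    by rewrite mule_ge0 ?lee_fin ?kern_ge0// mulr_ge0 ?pairs_ge0// invr_ge0 exprn_ge0.
  + move=> y _; split => //; rewrite /h/= c3 andbT.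
    by case: ifP => _; rewrite ?mule0// muleC.
Qed.


Lemma ball_pairs_energy A :
  ball_pairs p v om e A <= (e `^ (n%:R + s))%:E * energy A.
Proof.
rewrite /energy -ge0_integralZl//; last 3 first.
- apply: measurable_fun_if0; first exact: measurable_cball_fun.
  by apply/measurable_EFinP/measurable_funM; [exact: Pm|exact: measurable_kern].
- by move=> c _; apply: if_ge0; exact: PK0.
- by rewrite lee_fin powR_ge0.
apply: ge0_le_integral_raw.
- by move=> c _; case: ifP => // _; rewrite lee_fin pairs_ge0.
- by move=> c _; rewrite mule_ge0 ?if_ge0 ?PK0// lee_fin powR_ge0.
- move=> c _; split => //; case: ifPn => [Ac|_]; last first.
    by rewrite mule_ge0 ?if_ge0 ?PK0// lee_fin powR_ge0.
  rewrite ifT; last by move: Ac e0; lra.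
  rewrite -EFinM lee_fin; have [->|cA] := eqVneq c A.
    by rewrite pairsxx// mul0r mulr0.
  have cp : (0 < `|A - c|)%R by rewrite normr_gt0 subr_eq0 eq_sym.
  rewrite mulrCA -[leLHS]mulr1 ler_wpM2l ?pairs_ge0//.
  rewrite /kern ler_pdivlMr ?powR_gt0// mul1r.
  by apply: ge0_ler_powR; rewrite ?nnegrE ?addr_ge0// ltW.
Qed.

(** Averages at radius e. On |A - c| <= e with c different from A, 1 <= e^(n+s) times the kernel,
    and the division by e^n leaves e^s. *)
Lemma phi_pairs x : U x ->
  (P (Phi x) x)%:E <= (2 `^ p * e `^ s)%:E * (energy (Phi x) + energy x).
Proof.
move=> Ux.
have oc c : (`|Phi x - c| <= e)%R -> om c.
  move=> xc; apply: (Uom Ux); apply: le_trans (ler_distD (Phi x) _ _) _.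
  by have := Phi_dist x; rewrite distrC; move: xc e0; lra.
have := pairs_le_ball p1 mv mom e0 (Phi_dist x) oc.
rewrite EFinM -lee_pdivlMl ?exprn_gt0// => h; apply: le_trans h _.
rewrite muleCA EFinM -muleA; apply: lee_wpmul2l; first by rewrite lee_fin powR_ge0.
have -> : (e `^ s = e ^- n * e `^ (n%:R + s))%R.
  rewrite powRD ?(gt_eqF e0) ?implybT// powR_mulrn ?(ltW e0)// mulrA mulVf ?mul1r//.
  by rewrite expf_neq0// gt_eqF.
rewrite EFinM -muleA; apply: lee_wpmul2l; first by rewrite lee_fin invr_ge0 exprn_ge0// ltW.
rewrite ge0_muleDr ?energy_ge0//.
by apply: leeD; exact: ball_pairs_energy.
Qed.

Lemma wt_ge1 x : 1 <= wt x. Proof. exact: inv_powR_ge1. Qed.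

Lemma measurable_wt : measurable_fun setT wt.
Proof. exact: measurable_inv_powR. Qed.

Definition weighted_energy : \bar R :=
  \int[mu]_x (if x \in U then wt x * energy (Phi x) else 0).

Definition plain_energy : \bar R := \int[mu]_x (if x \in U then energy x else 0).

Let X := weighted_energy.
Let Y := plain_energy.

Let mX : measurable_fun setT (fun x => if x \in U then wt x * energy (Phi x) else 0).
Proof.
apply: measurable_fun_if0; first exact: measurable_mem.
apply: emeasurable_funM; first exact: measurable_wt.
exact: (measurableT_comp measurable_energy).
Qed.

Let mY : measurable_fun setT (fun x => if x \in U then energy x else 0).
Proof.
by apply: measurable_fun_if0; [exact: measurable_mem|exact: measurable_energy].
Qed.

Let X0 x : 0 <= (if x \in U then wt x * energy (Phi x) else 0).
Proof. by case: ifP => // _; rewrite mule_ge0 ?wt_ge0 ?energy_ge0. Qed.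

Let Y0 x : 0 <= (if x \in U then energy x else 0).
Proof. by case: ifP => // _; rewrite energy_ge0. Qed.

Lemma integral_phi_pairs :
  \int[mu]_x (if x \in U then (P (Phi x) x)%:E else 0) <=
  (2 `^ p * e `^ s)%:E * (X + Y).
Proof.
rewrite /X /Y /weighted_energy /plain_energy -ge0_integralD//.
rewrite -ge0_integralZl//; last 3 first.
- exact: emeasurable_funD.
- by move=> x _; rewrite adde_ge0.
- by rewrite lee_fin mulr_ge0 ?powR_ge0.
apply: ge0_le_integral_raw.
- by move=> x _; case: ifP => // _; rewrite lee_fin pairs_ge0.
- by move=> x _; rewrite mule_ge0 ?adde_ge0// lee_fin mulr_ge0 ?powR_ge0.
move=> x _; split => //; case: ifPn => [/set_mem Ux|_]; last by rewrite adde0 mule0.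
apply: le_trans (phi_pairs Ux) _; apply: lee_wpmul2l.
  by rewrite lee_fin mulr_ge0 ?powR_ge0.
apply: leeD => //; rewrite -[leLHS]mul1e; apply: lee_wpmul2r; first exact: energy_ge0.
exact: wt_ge1.
Qed.

Let dbl (f : 'rV[R]_n * 'rV[R]_n -> \bar R) := \int[mu]_x \int[mu]_y f (x, y).

Let dblE f : measurable_fun setT f -> (forall z, 0 <= f z) ->
  dbl f = \int[mu \x mu]_z f z.
Proof. by move=> mf f0; rewrite fubini_tonelli1. Qed.

Let dblD f g : measurable_fun setT f -> measurable_fun setT g ->
  (forall z, 0 <= f z) -> (forall z, 0 <= g z) ->
  dbl (fun z => f z + g z) = dbl f + dbl g.
Proof.
move=> mf mg f0 g0; rewrite !dblE//; first by rewrite ge0_integralD.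
- exact: emeasurable_funD.
- by move=> z; rewrite adde_ge0.
Qed.

Let dbl5 f1 f2 f3 f4 f5 :
  measurable_fun setT f1 -> measurable_fun setT f2 -> measurable_fun setT f3 ->
  measurable_fun setT f4 -> measurable_fun setT f5 ->
  (forall z, 0 <= f1 z) -> (forall z, 0 <= f2 z) -> (forall z, 0 <= f3 z) ->
  (forall z, 0 <= f4 z) -> (forall z, 0 <= f5 z) ->
  dbl (fun z => f1 z + f2 z + f3 z + (f4 z + f5 z)) =
  dbl f1 + dbl f2 + dbl f3 + (dbl f4 + dbl f5).
Proof.
move=> m1 m2 m3 m4 m5 p_1 p_2 p_3 p_4 p_5.
have m12 := emeasurable_funD m1 m2; have m45 := emeasurable_funD m4 m5.
have m123 := emeasurable_funD m12 m3.
have p12 z : 0 <= f1 z + f2 z by exact: adde_ge0.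
have p45 z : 0 <= f4 z + f5 z by exact: adde_ge0.
have p123 z : 0 <= f1 z + f2 z + f3 z by exact: adde_ge0.
rewrite (dblD m123 m45 p123 p45) (dblD m12 m3 p12 p_3).
by rewrite (dblD m1 m2 p_1 p_2) (dblD m4 m5 p_4 p_5).
Qed.

Let dbl_swap f : measurable_fun setT f -> (forall z, 0 <= f z) ->
  dbl (fun z => f (z.2, z.1)) = dbl f.
Proof. by move=> mf f0; rewrite /dbl/= -(fubini_tonelli f). Qed.

(** Pairs with |x - y| <= e are charged to [A1] and its transpose for v o Phi, and to [A2] for v.
    For the other pairs the difference is regrouped as (v(Phi x) - v(x)) - (v(Phi y) - v(y)) and
    charged to [A3] and its transpose. The radius 3 e in [A2] makes its integral the plain
    energy. *)
Let A1 (z : 'rV[R]_n * 'rV[R]_n) : \bar R :=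
  if z.1 \in U then (2 `^ p)%:E * ((K z.1 z.2)%:E * near_kernel z.1 z.2) else 0.

Let A2 (z : 'rV[R]_n * 'rV[R]_n) : \bar R :=
  if z.1 \in U then
    if (`|z.1 - z.2| <= 3 * e)%R then (P z.1 z.2 * K z.1 z.2)%:E else 0
  else 0.

Let A3 (z : 'rV[R]_n * 'rV[R]_n) : \bar R :=
  if z.1 \in U then
    if (e <= `|z.1 - z.2|)%R then (P (Phi z.1) z.1 * K z.1 z.2)%:E else 0
  else 0.

Let A1_ge0 z : 0 <= A1 z.
Proof.
rewrite /A1; case: ifP => // _.
by rewrite !mule_ge0 ?near_kernel_ge0// lee_fin ?powR_ge0 ?kern_ge0.
Qed.

Let A2_ge0 z : 0 <= A2 z.
Proof.
by rewrite /A2; do 2 apply: if_ge0; exact: PK0.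
Qed.

Let A3_ge0 z : 0 <= A3 z.
Proof.
by rewrite /A3; do 2 apply: if_ge0; exact: PK0.
Qed.

Let mA1 : measurable_fun setT A1.
Proof.
apply: measurable_fun_if0; first exact: measurable_mem.
apply: emeasurable_funM => //; apply: emeasurable_funM.
  by apply/measurable_EFinP; exact: measurable_kern.
exact: measurable_near_kernel.
Qed.

Let mA2 : measurable_fun setT A2.
Proof.
apply: measurable_fun_if0; first exact: measurable_mem.
apply: measurable_fun_if0; first exact: measurable_cball_fun.
by apply/measurable_EFinP/measurable_funM; [exact: Pm|exact: measurable_kern].
Qed.

Let mA3 : measurable_fun setT A3.
Proof.
apply: measurable_fun_if0; first exact: measurable_mem.
apply: measurable_fun_if0.
  by apply: measurable_fun_ler => //; exact: measurable_dist.
apply/measurable_EFinP/measurable_funM; last exact: measurable_kern.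
by apply: Pm => //; exact: measurableT_comp.
Qed.

Let dblA1 : dbl A1 <= (2 `^ p * near_const)%:E * (X + Y).
Proof.
apply: (@le_trans _ _ ((2 `^ p * near_const)%:E * X)); last first.
  apply: lee_wpmul2l; first by rewrite lee_fin mulr_ge0 ?powR_ge0 ?near_const_ge0.
  by apply: leeDl; apply: integral_ge0 => x _; exact: Y0.
rewrite /X /weighted_energy -ge0_integralZl//; last first.
  by rewrite lee_fin mulr_ge0 ?powR_ge0 ?near_const_ge0.
apply: ge0_le_integral_raw.
- by move=> x _; apply: integral_ge0 => y _; exact: A1_ge0.
- by move=> x _; rewrite mule_ge0// lee_fin mulr_ge0 ?powR_ge0 ?near_const_ge0.
move=> x _; split => //; rewrite /A1/=; case: ifPn => _; last first.
  by rewrite mule0 integral0.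
rewrite ge0_integralZl//; last 2 first.
- apply: emeasurable_funM.
    by apply/measurable_EFinP; exact: measurable_kern.
  exact: (measurableT_comp measurable_near_kernel (@pair1_measurable _ _ _ _ x)).
- by move=> y _; rewrite mule_ge0 ?near_kernel_ge0// lee_fin kern_ge0.
rewrite EFinM -!muleA; apply: lee_wpmul2l; first by rewrite lee_fin powR_ge0.
by rewrite muleA; exact: integral_near.
Qed.

Let dblA2 : dbl A2 <= X + Y.
Proof.
apply: (@le_trans _ _ Y); last by apply: leeDr; apply: integral_ge0 => x _; exact: X0.
apply: ge0_le_integral_raw => //; first by move=> x _; apply: integral_ge0 => y _; exact: A2_ge0.
move=> x _; split => //; rewrite /A2/=; case: ifPn => _ //.
by rewrite integral0.
Qed.

(** The kernel tail beyond distance e gives e^(-s), which cancels the e^s of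
    [integral_phi_pairs]. *)
Let dblA3 : dbl A3 <= (@tail_const R n s * 2 `^ p)%:E * (X + Y).
Proof.
apply: (@le_trans _ _ ((@tail_const R n s * e `^ (- s))%:E *
   \int[mu]_x (if x \in U then (P (Phi x) x)%:E else 0))); last first.
  have -> : (@tail_const R n s * 2 `^ p =
     @tail_const R n s * e `^ (- s) * (2 `^ p * e `^ s))%R.
    rewrite powRN; have : (e `^ s != 0)%R by rewrite gt_eqF// powR_gt0.
    by move=> es; field.
  rewrite [in leRHS]EFinM -muleA; apply: lee_wpmul2l.
    by rewrite lee_fin mulr_ge0 ?powR_ge0// tail_const_ge0.
  exact: integral_phi_pairs.
have t0 : (0 <= @tail_const R n s * e `^ (- s))%R.
  by rewrite mulr_ge0 ?powR_ge0// tail_const_ge0.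
rewrite -ge0_integralZl//; last 2 first.
- apply: measurable_fun_if0; first exact: measurable_mem.
  by apply/measurable_EFinP; exact: Pm.
- by move=> x _; case: ifP => // _; rewrite lee_fin pairs_ge0.
apply: ge0_le_integral_raw.
- by move=> x _; apply: integral_ge0 => y _; exact: A3_ge0.
- move=> x _; rewrite mule_ge0//; case: ifP => // _; by rewrite lee_fin pairs_ge0.
move=> x _; split => //; rewrite /A3/=; case: ifPn => _; last first.
  by rewrite mule0 integral0.
rewrite muleC; apply: (@le_trans _ _ ((P (Phi x) x)%:E *
    \int[mu]_y (if (e <= `|x - y|)%R then (K x y)%:E else 0))); last first.
  by apply: lee_wpmul2l; [rewrite lee_fin pairs_ge0|exact: integral_kern_tail].
rewrite -ge0_integralZl//; last 3 first.
- apply: measurable_fun_if0.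
    by apply: measurable_fun_ler => //; exact: measurable_dist.
  by apply/measurable_EFinP; exact: measurable_kern.
- by move=> y _; apply: if_ge0; exact: K0.
- by rewrite lee_fin pairs_ge0.
apply: ge0_le_integral_raw.
- by move=> y _; apply: if_ge0; exact: PK0.
- by move=> y _; rewrite mule_ge0 ?if_ge0 ?K0// lee_fin pairs_ge0.
by move=> y _; split => //; case: ifP => _; rewrite ?mule0.
Qed.

Let quot (z : 'rV[R]_n * 'rV[R]_n) : \bar R :=
  if (z.1 \in U) && (z.2 \in U) then
    (`|v (Phi z.1) - v (Phi z.2) - (v z.1 - v z.2)| `^ p * K z.1 z.2)%:E
  else 0.

(** The outer factor comes from splitting the p-th power; inside, [A1] and [A3] count twice because
    of their transposes, and [A2] counts once. *)
Definition mesh_const : R :=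
  (2 `^ p * (2 * (2 `^ p * near_const) + 1 + 2 * (@tail_const R n s * 2 `^ p)))%R.

Let Phi_om x : U x -> om (Phi x).
Proof.
move=> Ux; apply: (Uom Ux); rewrite distrC; apply: le_trans (Phi_dist x) _.
by rewrite ler_peMl ?(ltW e0)//; lra.
Qed.

Let U_om x : U x -> om x.
Proof. by move=> Ux; apply: (Uom Ux); rewrite subrr normr0 mulr_ge0// ltW. Qed.

Let S z := (A1 z + A1 (z.2, z.1)) + A2 z + (A3 z + A3 (z.2, z.1)).

Let S0 z : 0 <= S z.
Proof.
apply: adde_ge0; [apply: adde_ge0; [apply: adde_ge0|]|apply: adde_ge0].
- exact: A1_ge0.
- exact: A1_ge0.
- exact: A2_ge0.
- exact: A3_ge0.
- exact: A3_ge0.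
Qed.

Let quot_le z : quot z <= (2 `^ p)%:E * S z.
Proof.
have := S0 z; case: z => x y; rewrite /quot/= => Sxy.
have tp : 0 <= (2 `^ p)%:E :> \bar R by rewrite lee_fin powR_ge0.
case: ifPn => [/andP[xU yU]|_]; last exact: mule_ge0.
have [Ux Uy] := (set_mem xU, set_mem yU).
have Kxy := kern_ge0 s x y.
have [xy|/ltW xy] := leP (`|x - y|)%R e.
  apply: (@le_trans _ _ ((2 `^ p)%:E * ((P (Phi x) (Phi y))%:E * (K x y)%:E +
      (P x y)%:E * (K x y)%:E))).
    rewrite -!EFinM lee_fin -mulrDl mulrA.
    apply: ler_wpM2r => //; rewrite !pairsE//; [|exact: U_om|exact: U_om|exact: Phi_om|exact: Phi_om].
    apply: le_trans (powRD_le (le_trans ler01 p1) (normr_ge0 _) (normr_ge0 _)).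
    apply: ge0_ler_powR; rewrite ?nnegrE ?addr_ge0//; first exact: le_trans p1.
    exact: ler_normB.
  apply: lee_wpmul2l => //; rewrite -[leLHS]adde0.
  apply: leeD; last by apply: adde_ge0; exact: A3_ge0.
  apply: leeD; last first.
    by rewrite /A2/= xU ifT//; move: xy e0; lra.
  rewrite /A1/= xU yU (kern_sym s y x) -ge0_muleDr; last 2 first.
  - by rewrite mule_ge0 ?near_kernel_ge0// lee_fin.
  - by rewrite mule_ge0 ?near_kernel_ge0// lee_fin.
  rewrite -ge0_muleDr ?near_kernel_ge0// muleCA muleC; apply: lee_wpmul2l => //.
  exact: near_pairs.
apply: (@le_trans _ _ ((2 `^ p)%:E * ((P (Phi x) x)%:E * (K x y)%:E +
    (P (Phi y) y)%:E * (K x y)%:E))).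
  rewrite -!EFinM lee_fin -mulrDl mulrA.
  apply: ler_wpM2r => //; rewrite !pairsE//;
    [|exact: Phi_om|exact: U_om|exact: Phi_om|exact: U_om].
  apply: le_trans (powRD_le (le_trans ler01 p1) (normr_ge0 _) (normr_ge0 _)).
  apply: ge0_ler_powR; rewrite ?nnegrE ?addr_ge0//; first exact: le_trans p1.
  rewrite (_ : (_ - _ - _)%R = (v (Phi x) - v x - (v (Phi y) - v y))%R); last first.
    by apply/rowP => i; rewrite !mxE; lra.
  exact: ler_normB.
apply: lee_wpmul2l => //; rewrite -[leLHS]add0e.
apply: leeD.
  by apply: adde_ge0; [apply: adde_ge0; exact: A1_ge0|exact: A2_ge0].
have -> : A3 (x, y) = (P (Phi x) x)%:E * (K x y)%:E.
  by rewrite /A3 /= xU xy EFinM.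
have -> : A3 (y, x) = (P (Phi y) y)%:E * (K x y)%:E.
  by rewrite /A3 /= yU distrC xy kern_sym EFinM.
exact: lexx.
Qed.

Lemma mesh_gagliardo_le :
  \int[mu]_x \int[mu]_y (if (x \in U) && (y \in U) then
    (`|v (Phi x) - v (Phi y) - (v x - v y)| `^ p * K x y)%:E else 0)
  <= mesh_const%:E * (X + Y).
Proof.
have XY0 : 0 <= X + Y by rewrite adde_ge0//; apply: integral_ge0.
have sw f : measurable_fun setT f ->
    measurable_fun setT (fun z : 'rV[R]_n * 'rV[R]_n => f (z.2, z.1) : \bar R).
  move=> mf; apply: (measurableT_comp mf).
  exact: measurable_fun_pair.
have m1 := sw _ mA1; have m3 := sw _ mA3.
have m11 := emeasurable_funD mA1 m1; have m33 := emeasurable_funD mA3 m3.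
have m112 := emeasurable_funD m11 mA2.
have mS : measurable_fun setT S by exact: (emeasurable_funD m112 m33).
have tp : (0 <= 2 `^ p :> R)%R by exact: powR_ge0.
apply: (@le_trans _ _ (dbl (fun z => (2 `^ p)%:E * S z))).
  apply: ge0_le_integral_raw.
  - move=> x _; apply: integral_ge0 => y _; apply: if_ge0.
    by rewrite lee_fin mulr_ge0 ?powR_ge0 ?kern_ge0.
  - by move=> x _; apply: integral_ge0 => y _; rewrite mule_ge0.
  move=> x _; split => //; apply: ge0_le_integral_raw.
  - move=> y _; apply: if_ge0.
    by rewrite lee_fin mulr_ge0 ?powR_ge0 ?kern_ge0.
  - by move=> y _; rewrite mule_ge0.
  by move=> y _; split => //; exact: (quot_le (x, y)).
rewrite dblE; last 2 first.
- exact: measurable_funeM.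
- by move=> z; rewrite mule_ge0.
rewrite ge0_integralZl// -dblE//.
rewrite /mesh_const EFinM -muleA; apply: lee_wpmul2l => //.
have -> : dbl S = dbl A1 + dbl A1 + dbl A2 + (dbl A3 + dbl A3).
  rewrite -[in X in _ + X + _ + _](dbl_swap mA1 A1_ge0).
  rewrite -[in X in _ + (_ + X)](dbl_swap mA3 A3_ge0).
  exact: (dbl5 mA1 m1 mA2 mA3 m3 A1_ge0 (fun z => A1_ge0 _) A2_ge0 A3_ge0
    (fun z => A3_ge0 _)).
have nc0 : (0 <= 2 `^ p * near_const)%R by rewrite mulr_ge0 ?near_const_ge0.
have tc0 : (0 <= @tail_const R n s * 2 `^ p)%R by rewrite mulr_ge0 ?tail_const_ge0.
have c_ge0 (c : R) : (0 <= c)%R -> 0 <= c%:E :> \bar R by rewrite lee_fin.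
have two (c : R) (t : \bar R) : (0 <= c)%R -> t <= c%:E * (X + Y) ->
    t + t <= (2 * c)%:E * (X + Y).
  move=> cp tc; rewrite mulrDl mul1r EFinD ge0_muleDl ?c_ge0//.
  exact: leeD.
have split3 (c c' : R) (t : \bar R) : (0 <= c)%R -> (0 <= c')%R ->
    (c + 1 + c')%:E * t = c%:E * t + t + c'%:E * t.
  move=> cp c'p; rewrite EFinD ge0_muleDl ?c_ge0 ?addr_ge0//.
  by rewrite EFinD ge0_muleDl ?c_ge0// mul1e.
rewrite split3; [|exact: mulr_ge0|exact: mulr_ge0].
apply: leeD; last exact: two.
by apply: leeD; [exact: two|exact: dblA2].
Qed.

End mesh_estimate.

(** * Smallness of the energy and choice of the origin *)

Section small_energy.
Context {R : realType} {n m : nat}.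
Local Notation mu := (lebesgue_rV R n).
Variables (p s : R) (v : 'rV[R]_n -> 'rV[R]_m) (om : set 'rV[R]_n).
Hypotheses (p1 : 1 <= p) (mv : measurable_fun setT v) (mom : measurable om).
Local Open Scope ereal_scope.

(** Dominated convergence: restricted to |x - c| <= 3/(k+1), the integrand is eventually 0 at each
    point off the diagonal, and it vanishes on the diagonal anyway. *)
Lemma energy_small :
  \int[mu]_x \int[mu]_c (pairs p v om x c * kern s x c)%:E < +oo ->
  forall eta : R, (0 < eta)%R -> exists2 d : R, (0 < d)%R &
    forall e, (0 < e <= d)%R -> \int[mu]_x energy p s v om e x <= eta%:E.
Proof.
move=> fin eta eta0.
pose g (z : 'rV[R]_n * 'rV[R]_n) := (pairs p v om z.1 z.2 * kern s z.1 z.2)%:E.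
pose f (k : nat) (z : 'rV[R]_n * 'rV[R]_n) : \bar R :=
  if (`|z.1 - z.2| <= 3 * k.+1%:R^-1)%R then g z else 0.
have g0 z : 0 <= g z by rewrite lee_fin mulr_ge0 ?pairs_ge0 ?kern_ge0.
have f0 k z : 0 <= f k z by rewrite /f; case: ifP => _; [exact: g0|exact: lexx].
have mg : measurable_fun setT g.
  apply/measurable_EFinP/measurable_funM; first exact: measurable_pairs.
  exact: measurable_kern.
have mf k : measurable_fun setT (f k).
  by apply: measurable_fun_if0 => //; exact: measurable_cball_fun.
have H1 : {ae mu \x mu, forall z, setT z -> f ^~ z @ \oo --> (cst 0 : _ -> \bar R) z}.
  apply: aeW => -[x c] _ /=; apply: cvg_near_cst.
  have [->|xc] := eqVneq x c.
    by apply: nearW => k; rewrite /f /g/= pairsxx// mul0r if_same.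
  have d0 : (0 < `|x - c| / 3)%R by rewrite divr_gt0// normr_gt0 subr_eq0.
  near=> k; rewrite /f/= ifF//; apply/negbTE; rewrite -ltNge mulrC -ltr_pdivlMr//.
  by near: k; exact: near_infty_natSinv_lt (PosNum d0).
have H2 : (mu \x mu).-integrable setT g.
  apply/integrableP; split => //.
  under eq_integral do rewrite gee0_abs//.
  by rewrite fubini_tonelli1.
have H3 : {ae mu \x mu, forall z k, setT z -> `|f k z| <= g z}.
  apply: aeW => z k _; rewrite gee0_abs// /f.
  by case: ifP => _; [exact: lexx|exact: g0].
have [_ _] := dominated_convergence measurableT mf (measurable_cst _) H1 H2 H3.
rewrite integral0 => /fine_cvgP[_ /cvgrPdist_lt/(_ _ eta0)].
move=> [k _ /(_ k (leqnn k))]; rewrite sub0r normrN => small.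
exists (k.+1%:R^-1)%R => // e /andP[e0 ek].
apply: (@le_trans _ _ (\int[mu \x mu]_z f k z)).
  rewrite (fubini_tonelli1 _ (mf k) (f0 k)).
  apply: ge0_le_integral_raw.
  - by move=> x _; apply: energy_ge0.
  - by move=> x _; apply: integral_ge0 => y _; exact: f0.
  move=> x _; split => //; apply: ge0_le_integral_raw.
  - by move=> c _; case: ifP => // _; exact: (g0 (x, c)).
  - by move=> c _; exact: f0.
  move=> c _; split=> [//|]; case: ifPn => xc; last exact: f0.
  by rewrite /f/= ifT; [exact: lexx|apply: le_trans xc _; rewrite ler_wpM2l].
have Ig : \int[mu \x mu]_z g z < +oo by rewrite fubini_tonelli1.
have If : \int[mu \x mu]_z f k z \is a fin_num.
  rewrite ge0_fin_numE; last by apply: integral_ge0 => z _; exact: f0.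
  apply: le_lt_trans Ig; apply: ge0_le_integral_raw => // z _; split => //.
  by rewrite /f; case: ifP => _; [exact: lexx|exact: g0].
rewrite -(fineK If) lee_fin ltW//; apply: le_lt_trans small.
exact: ler_norm.
Unshelve. all: by end_near.
Qed.

End small_energy.

Section choose_origin.
Context {R : realType} {n : nat}.
Local Notation mu := (lebesgue_rV R n).
Implicit Types (T x u : 'rV[R]_n).

Definition mesh_map (j : nat) (e : R) T x : 'rV[R]_n :=
  T + e *: mesh_proj j (e^-1 *: (x - T)).

Definition mesh_depth (j : nat) (e : R) T x : R := depth j (e^-1 *: (x - T)).

Lemma measurable_rescale (e : R) d (X : measurableType d) (f : X -> 'rV[R]_n) T :
  measurable_fun setT f -> measurable_fun setT (fun t : X => e^-1 *: (f t - T)).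
Proof.
by move=> mf; apply: measurable_rVZ; apply: measurable_rVB => //; exact: measurable_cst.
Qed.

Lemma measurable_mesh_map j e T : measurable_fun setT (mesh_map j e T).
Proof.
apply: measurable_rVD; first exact: measurable_cst.
apply: measurable_rVZ; apply: (measurableT_comp (@measurable_mesh_proj R n j)).
exact: measurable_rescale.
Qed.

Lemma measurable_mesh_depth j e T : measurable_fun setT (mesh_depth j e T).
Proof.
by apply: (measurableT_comp (@measurable_depth R n j)); exact: measurable_rescale.
Qed.

Lemma mesh_map_dist j e T x : 0 < e -> `|mesh_map j e T x - x| <= e.
Proof.
move=> e0; set u := e^-1 *: (x - T).
have -> : mesh_map j e T x - x = e *: (mesh_proj j u - u).
  rewrite scalerBr scalerA divff ?gt_eqF// scale1r opprB addrA /mesh_map -/u.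
  by rewrite (addrC _ T).
by rewrite normrZ gtr0_norm// -[leRHS]mulr1 ler_wpM2l ?(ltW e0)// mesh_proj_dist.
Qed.

Lemma mesh_map_lip j e T x y : 0 < e -> `|x - y| <= e ->
  mesh_depth j e T x * `|mesh_map j e T x - mesh_map j e T y| <= 4 * `|x - y|.
Proof.
move=> e0 xy; rewrite /mesh_map /mesh_depth.
set u := e^-1 *: (x - T); set w := e^-1 *: (y - T).
have uw : `|u - w| = e^-1 * `|x - y|.
  rewrite /u /w -scalerBr normrZ gtr0_norm ?invr_gt0//; congr (_ * `|_|).
  by rewrite opprB addrA subrK.
have uw1 : `|u - w| <= 1 by rewrite uw mulrC ler_pdivrMr// mul1r.
rewrite (_ : _ - _ = e *: (mesh_proj j u - mesh_proj j w)); last first.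
  by rewrite opprD addrACA subrr add0r scalerBr.
rewrite normrZ gtr0_norm// mulrCA (le_trans (ler_wpM2l (ltW e0) (mesh_proj_lip j uw1)))//.
by rewrite uw mulrCA mulVKf ?gt_eqF.
Qed.

Local Open Scope ereal_scope.

(** If all origins were bad, integrating over those with |T| <= B would give at least c (2 B)^n,
    against the averaged bound. For such T and x in U one has |x - T| <= 2 B, so only the weight on
    that ball matters. *)
Lemma exists_origin (j : nat) (s e B c : R) (U : set 'rV[R]_n) (g : 'rV[R]_n -> \bar R) :
  (0 < s < j.+1%:R)%R -> (0 < e)%R -> (e <= B)%R -> (0 <= c)%R ->
  (forall x, U x -> `|x| <= B)%R ->
  measurable_fun setT g -> (forall x, 0 <= g x) ->
  (weight_const j s (n := n) (B + B))%:E * \int[mu]_x g x < (c * (2 * B) ^+ n)%:E ->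
  exists T, \int[mu]_x (if x \in U then
    weight j s (e^-1 *: (x - T)) * g (mesh_map j e T x) else 0) <= c%:E.
Proof.
move=> s0j e0 eB c0 UB mg g0 small.
have B0 : (0 < B)%R by exact: lt_le_trans eB.
apply: contrapT => /forallNP bad.
pose w u := if (`|u| <= B + B)%R then weight j s (e^-1 *: u) else 0.
have w0 u : 0 <= w u.
  by rewrite /w; case: ifP => _; [exact: weight_ge0|exact: lexx].
have mw : measurable_fun setT w.
  apply: measurable_fun_if0.
    by apply: measurable_fun_ler => //; exact: measurable_rV_norm.
  apply: (measurableT_comp (@measurable_weight R n j s)).
  exact: measurable_rVZ.
pose H T := \int[mu]_x (w (x - T)%R * g (T + e *: mesh_proj j (e^-1 *: (x - T)))%R).
have avg : \int[mu]_T H T <= (weight_const j s (n := n) (B + B))%:E * \int[mu]_x g x.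
  rewrite /H (@integral_mesh_average R n (fun u => e *: mesh_proj j (e^-1 *: u))%R w g)//.
    apply: lee_wpmul2r; first exact: integral_ge0.
    by apply: integral_weight => //; rewrite (le_trans eB)// lerDl ltW.
  apply: measurable_rVZ; apply: (measurableT_comp (@measurable_mesh_proj R n j)).
  exact: measurable_rVZ.
have : (c * (2 * B) ^+ n)%:E <= \int[mu]_T H T.
  rewrite EFinM; have /(lebesgue_rV_cball 0) <- := ltW B0.
  rewrite -integral_cst; last exact: measurable_cball.
  apply: ge0_le_integral_raw.
  - by move=> T _; rewrite lee_fin.
  - by move=> T _; apply: integral_ge0 => x _; rewrite mule_ge0.
  move=> T /=; rewrite subr0 => TB; split=> //.
  have /negP := bad T; rewrite -ltNge => /ltW cT; apply: le_trans cT _.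
  apply: ge0_le_integral_raw.
  - by move=> x _; case: ifP => _; [rewrite mule_ge0 ?weight_ge0|exact: lexx].
  - by move=> x _; rewrite mule_ge0.
  move=> x _; split => //; case: ifPn => [/set_mem Ux|_]; last by rewrite mule_ge0.
  rewrite /w ifT//; apply: le_trans (ler_normB _ _) _.
  by apply: lerD => //; exact: UB.
move=> /(fun h => le_trans h avg) /le_lt_trans /(_ small).
by rewrite ltxx.
Qed.

End choose_origin.

(** * Meshes and homogeneous extensions *)

Section homogeneity.
Context {R : realType} {n : nat}.
Implicit Types (M : mesh R n) (X Y : 'rV[R]_n) (K : 'rV[int]_n).
Implicit Types (S : {set 'I_n}) (b : {ffun 'I_n -> bool}).

Lemma mesh_map_face_step (j l : nat) M K S b X :
  let e := mesh_radius M in let c := face_center M K S b in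
  (j <= l)%N -> #|S| = l.+1 -> face M K S b X -> X != c ->
  mesh_map j e (mesh_origin M) (c + (e / `|X - c|) *: (X - c)) =
  mesh_map j e (mesh_origin M) X.
Proof.
move=> e c jl cS fX Xc; have e0 : 0 < e by exact: mesh_radius_gt0.
have Xc0 : 0 < `|X - c| by rewrite normr_gt0 subr_eq0.
have cE i : c ord0 i = mesh_origin M ord0 i + 2 * e * (K ord0 i)%:~R +
    (if i \in S then 0 else (-1) ^+ b i * e) by rewrite !mxE.
have XS i : i \in S -> `|X ord0 i - c ord0 i| <= e by move=> iS; exact: (fX i).1.
have XnS i : i \notin S -> X ord0 i = c ord0 i by move=> iS; exact: (fX i).2.
clearbody c; clear fX.
(* In the unit mesh the projection from the center divides the free coordinates by r = |X - c| /
   e. *)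
congr (_ + _ *: _); apply: (@mesh_proj_face_step _ _ _ K S (`|X - c| / e)).
- by rewrite cS.
- rewrite divr_gt0//= ler_pdivrMr// mul1r; apply/rV_norm_leP; first exact: ltW.
  move=> i; rewrite !mxE; have [/XS//|/XnS ->] := boolP (i \in S).
  by rewrite subrr normr0 ltW.
- move=> i iS; rewrite !mxE.
  rewrite (_ : _ - _ = (X ord0 i - c ord0 i) / e); last first.
    by rewrite cE iS; field; rewrite gt_eqF.
  rewrite normrM normfV (gtr0_norm e0) ler_wpM2r ?invr_ge0 ?(ltW e0)//.
  by have := rV_coord_le (X - c) i; rewrite !mxE.
- move=> i iS; rewrite !mxE (XnS i iS) cE (negbTE iS).
  rewrite (_ : _ - _ = (-1) ^+ b i); last by field; rewrite gt_eqF.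
  by rewrite normrX normrN1 expr1n.
- move=> i iS; move: (cE i); rewrite iS addr0 !mxE => ->.
  by field; rewrite !gt_eqF.
- move=> i iS; have := XnS i iS; rewrite !mxE => ->.
  by rewrite subrr mulr0 addr0.
Qed.

Lemma homogeneous_ext_mesh_map (V : Type) (h : 'rV[R]_n -> V) (j d : nat) M X (w : V) :
  homogeneous_ext M (h \o mesh_map j (mesh_radius M) (mesh_origin M)) j d X w ->
  h (mesh_map j (mesh_radius M) (mesh_origin M) X) = w.
Proof.
elim: d X => [|d IH] X /=; first by case.
move=> [K [S [b [KM cS fX Xc /IH <-]]]].
by rewrite -(mesh_map_face_step (leq_addr d j) cS fX Xc).
Qed.

End homogeneity.

Section covering_mesh.
Context {R : realType} {n : nat}.

Lemma covering_mesh_cells (A : set 'rV[R]_n) (e B : R) (T : 'rV[R]_n) :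
  0 < e -> (forall x, A x -> `|x| <= B) ->
  exists cells : {fset 'rV[int]_n},
    (forall x, A x -> exists2 K, K \in cells &
       forall i, `|x ord0 i - (T ord0 i + 2 * e * (K ord0 i)%:~R)| <= e) /\
    (forall K, K \in cells -> exists2 x, A x &
       forall i, `|x ord0 i - (T ord0 i + 2 * e * (K ord0 i)%:~R)| <= e).
Proof.
move=> e0 AB.
(* A cube K that meets [A] satisfies 2 e |K_i| <= e + B + |T|, so its index is bounded by [N] and
   the cubes meeting [A] are finitely many. *)
pose N := (Num.truncn ((B + `|T|) / e)).+1.
pose C : set 'rV[int]_n := [set K | exists2 x, A x &
       forall i, `|x ord0 i - (T ord0 i + 2 * e * (K ord0 i)%:~R)| <= e].
have CN K : C K -> forall i, `|K ord0 i| <= N%:Z.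
  move=> [x Ax xK] i; rewrite -(ler_int R) intr_norm -[leRHS]/(N%:R).
  have := truncnS_gt ((B + `|T|) / e); rewrite -/N ltr_pdivrMr// => h.
  have N1 : 1 <= N%:R :> R by rewrite ler1n.
  have : `|2 * e * (K ord0 i)%:~R| <= e + `|x ord0 i| + `|T ord0 i|.
    have -> : 2 * e * (K ord0 i)%:~R =
      - (x ord0 i - (T ord0 i + 2 * e * (K ord0 i)%:~R)) + x ord0 i - T ord0 i.
      by ring.
    apply: le_trans (ler_normB _ _) _; rewrite lerD2r.
    by apply: le_trans (ler_normD _ _) _; rewrite lerD2r normrN.
  rewrite !normrM (gtr0_norm e0) ger0_norm// => h2.
  have h3 := le_trans (rV_coord_le x i) (AB _ Ax).
  have h4 := rV_coord_le T i.
  rewrite -(ler_pM2r e0); nra.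
have finC : finite_set C.
  apply: (@sub_finite_set _ _ ((fun t : {ffun 'I_n -> 'I_(2 * N).+1} =>
     \row_i ((t i : nat)%:Z - N%:Z)) @` setT)); last first.
    by apply: finite_image; exact: finite_finset.
  move=> K /CN KN; have KN' i : (absz (K ord0 i + N%:Z)%R < (2 * N).+1)%N.
    have aux (k : int) (N' : nat) : `|k| <= N'%:Z -> (absz (k + N'%:Z)%R < (2 * N').+1)%N by lia.
    exact: aux.
  exists [ffun i => Ordinal (KN' i)] => //.
  have aux (k : int) (N' : nat) : `|k| <= N'%:Z -> (absz (k + N'%:Z)%R)%:Z - N'%:Z = k by lia.
  by apply/rowP => i; rewrite !mxE ffunE/=; exact: aux.
exists (fset_set C); split; last by move=> K; rewrite in_fset_set// inE.
move=> x Ax; pose K : 'rV[int]_n := \row_i cell ((x ord0 i - T ord0 i) / e).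
have KP i : `|x ord0 i - (T ord0 i + 2 * e * (K ord0 i)%:~R)| <= e.
  rewrite mxE; have := res_le1 ((x ord0 i - T ord0 i) / e); rewrite /res.
  set k := (cell _)%:~R => h.
  rewrite (_ : _ - _ = e * ((x ord0 i - T ord0 i) / e - 2 * k)); last first.
    by field; rewrite gt_eqF.
  by rewrite normrM (gtr0_norm e0) -[leRHS]mulr1 ler_wpM2l// ltW.
by exists K => //; rewrite in_fset_set// inE; exists x.
Qed.

Lemma compact_margin (A W : set 'rV[R]_n) : compact A -> open W -> A `<=` W ->
  exists2 d : R, 0 < d & forall x y, A x -> `|x - y| < d -> W y.
Proof.
move=> /compact_near_coveringP cA oW AW.
have [] := cA R (0^'+) (fun e x => forall y, `|x - y| < e -> W y) _ _.
  move=> x /AW Wx.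
  have /nbhs_ballP[r /= r0 rW] : nbhs x W by exact: open_nbhs_nbhs.
  have r2 : 0 < r / 2 by rewrite divr_gt0.
  exists (ball x (r / 2), [set e | e < r / 2]) => /=.
    by split; [exact: nbhsx_ballx|exact: nbhs_right_lt].
  move=> [x' e] /= [xx' er] y x'y; apply: rW.
  move: xx'; rewrite !mx_norm_ball /ball_/= => xx'.
  by apply: le_lt_trans (ler_distD x' _ _) _; lra.
move=> d /= d0 dP; exists (d / 2); first by rewrite divr_gt0.
move=> x y Ax xy; apply: (dP (d / 2)) Ax _ xy => /=; last by rewrite divr_gt0.
by rewrite sub0r normrN gtr0_norm ?divr_gt0//; lra.
Qed.

End covering_mesh.

(** * Sobolev norms of almost everywhere equal maps *)

Section enorm.
Context {R : realType} {d : nat}.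
Implicit Types x : 'rV[R]_d.

Lemma norm_le_enorm x : `|x| <= enorm x.
Proof.
apply/rV_norm_leP; first exact: sqrtr_ge0.
move=> i; rewrite /enorm -sqrtr_sqr ler_wsqrtr// (bigD1 i)//= lerDl.
by apply: sumr_ge0 => k _; exact: sqr_ge0.
Qed.

Lemma enorm_le_norm x : enorm x <= Num.sqrt d%:R * `|x|.
Proof.
have -> : Num.sqrt d%:R * `|x| = Num.sqrt (d%:R * `|x| ^+ 2).
  by rewrite sqrtrM// sqrtr_sqr normr_id.
rewrite /enorm ler_wsqrtr//.
rewrite mulr_natl -[X in _ *+ X]card_ord -sumr_const.
apply: ler_sum => i _; rewrite -[leLHS]real_normK ?num_real//.
by rewrite lerXn2r ?nnegrE// rV_coord_le.
Qed.

Lemma enorm_ge0 x : 0 <= enorm x. Proof. exact: sqrtr_ge0. Qed.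

End enorm.

Section sobolev_transfer.
Context {R : realType} {n m : nat}.
Local Notation mu := (lebesgue_rV R n).
Variables (s p : R).
Hypotheses (p1 : 1 <= p) (s0 : 0 < s).
Implicit Types (U D : set 'rV[R]_n) (u w : 'rV[R]_n -> 'rV[R]_m).
Local Notation K := (kern (s * p)).

Let p0 : 0 < p. Proof. exact: lt_le_trans p1. Qed.
Let sp0 : 0 < s * p. Proof. exact: mulr_gt0. Qed.

Local Open Scope ereal_scope.

(** This and [gagliardo_int] are sup-norm versions of the p-th powers of the norms, with the domain
    moved into the integrand. They are applied to Borel maps, for which Tonelli is available; the
    original map is reached only through inequalities between lower integrals. *)
Definition Lp_int U w : \bar R :=
  \int[mu]_x (if x \in U then (`|w x| `^ p)%:E else 0).

Definition gagliardo_int U w : \bar R :=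
  \int[mu]_x \int[mu]_y
    (if (x \in U) && (y \in U) then (`|w x - w y| `^ p * K x y)%:E else 0).

Definition dim_const : R := (Num.sqrt m%:R `^ p)%R.

Lemma dim_const_ge0 : (0 <= dim_const)%R. Proof. exact: powR_ge0. Qed.

Lemma enorm_powR_le (y : 'rV[R]_m) : (enorm y `^ p <= dim_const * `|y| `^ p)%R.
Proof.
rewrite -powRM ?sqrtr_ge0//; apply: ge0_ler_powR; rewrite ?nnegrE ?enorm_ge0 ?(ltW p0)//.
exact: enorm_le_norm.
Qed.

Lemma norm_powR_le_enorm (y : 'rV[R]_m) : (`|y| `^ p <= enorm y `^ p)%R.
Proof.
apply: ge0_ler_powR; rewrite ?nnegrE ?enorm_ge0 ?(ltW p0)//.
exact: norm_le_enorm.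
Qed.

Lemma quotient_le_kern (y y' : 'rV[R]_m) (x x' : 'rV[R]_n) :
  (enorm (y - y') `^ p / enorm (x - x') `^ (n%:R + s * p) <=
   dim_const * (`|y - y'| `^ p * K x x'))%R.
Proof.
have a0 : (0 < n%:R + s * p)%R by rewrite ltr_wpDl.
have [->|xx] := eqVneq x x'.
  rewrite subrr (_ : enorm 0 = 0)%R; last first.
    apply/eqP; rewrite eq_le enorm_ge0 andbT.
    by apply: le_trans (enorm_le_norm _) _; rewrite normr0 mulr0.
  by rewrite powR0 ?gt_eqF// invr0 mulr0 !mulr_ge0 ?powR_ge0 ?kern_ge0.
have xp : (0 < `|x - x'|)%R by rewrite normr_gt0 subr_eq0.
rewrite mulrA; apply: ler_pM; rewrite ?powR_ge0 ?invr_ge0 ?powR_ge0//.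
  exact: enorm_powR_le.
rewrite lef_pV2 ?posrE ?powR_gt0//; last exact: lt_le_trans (norm_le_enorm _).
by apply: ge0_ler_powR; rewrite ?nnegrE ?enorm_ge0 ?(ltW a0)// norm_le_enorm.
Qed.

Let quot_ge0 (y : 'rV[R]_m) (x : 'rV[R]_n) :
  0 <= (enorm y `^ p / enorm x `^ (n%:R + s * p))%:E :> \bar R.
Proof. by rewrite lee_fin mulr_ge0 ?powR_ge0// invr_ge0 powR_ge0. Qed.

Let pow_ge0 (y : 'rV[R]_m) : 0 <= (`|y| `^ p)%:E :> \bar R.
Proof. by rewrite lee_fin powR_ge0. Qed.

Let powK_ge0 (y : 'rV[R]_m) (x x' : 'rV[R]_n) : 0 <= (`|y| `^ p * K x x')%:E :> \bar R.
Proof. by rewrite lee_fin mulr_ge0 ?powR_ge0 ?kern_ge0. Qed.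

Let mpow w : measurable_fun setT w -> measurable_fun setT (fun x => (`|w x| `^ p)%:E).
Proof.
move=> mw; apply/measurable_EFinP; apply: (measurableT_comp (measurable_powR _)).
exact: measurable_rV_norm.
Qed.

Let mgag U w : measurable U -> measurable_fun setT w ->
  measurable_fun setT (fun z : 'rV[R]_n * 'rV[R]_n => if (z.1 \in U) && (z.2 \in U)
    then (`|w z.1 - w z.2| `^ p * K z.1 z.2)%:E else 0).
Proof.
move=> mU mw; apply: measurable_fun_if0.
  by apply: measurable_and; exact: measurable_mem.
apply/measurable_EFinP/measurable_funM; last exact: measurable_kern.
apply: (measurableT_comp (measurable_powR _)); apply: measurable_dist.
  exact: (measurableT_comp mw).
exact: (measurableT_comp mw).
Qed.

Let mgag1 U w x : measurable U -> measurable_fun setT w ->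
  measurable_fun setT (fun y => if (x \in U) && (y \in U)
    then (`|w x - w y| `^ p * K x y)%:E else 0).
Proof.
by move=> mU mw; exact: (measurableT_comp (mgag mU mw) (@pair1_measurable _ _ _ _ x)).
Qed.

Let mgag2 U w : measurable U -> measurable_fun setT w ->
  measurable_fun setT (fun x => \int[mu]_y (if (x \in U) && (y \in U)
    then (`|w x - w y| `^ p * K x y)%:E else 0)).
Proof.
move=> mU mw; have mf := mgag mU mw.
apply: (measurable_fun_fubini_tonelli_F (m2 := mu) _ mf).
by move=> z; apply: if_ge0; exact: powK_ge0.
Qed.

Let gagZ U w (c : R) : (0 <= c)%R -> measurable U -> measurable_fun setT w ->
  c%:E * gagliardo_int U w = \int[mu]_x \int[mu]_y
    (c%:E * if (x \in U) && (y \in U) then (`|w x - w y| `^ p * K x y)%:E else 0).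
Proof.
move=> c0 mU mw; rewrite /gagliardo_int -ge0_integralZl//; last 2 first.
- exact: mgag2.
- by move=> x _; apply: integral_ge0 => y _; apply: if_ge0; exact: powK_ge0.
apply: eq_integral => x _; rewrite ge0_integralZl//; first exact: mgag1.
by move=> y _; apply: if_ge0; exact: powK_ge0.
Qed.

Lemma Lp_norm_le D U u w : D `<=` U -> measurable U -> measurable_fun setT w ->
  {ae mu, forall x, D x -> u x = w x} ->
  Lp_norm p D u <= (dim_const%:E * Lp_int U w) `^ p^-1.
Proof.
move=> DU mU mw uw; rewrite /Lp_norm.
have I0 : 0 <= \int[mu]_(x in D) (enorm (u x) `^ p)%:E.
  by apply: integral_ge0 => x _; rewrite lee_fin powR_ge0.
have J0 : 0 <= dim_const%:E * Lp_int U w.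
  rewrite mule_ge0 ?lee_fin ?dim_const_ge0//; apply: integral_ge0 => x _.
  by apply: if_ge0; exact: pow_ge0.
apply: gt0_ler_poweR; rewrite ?invr_ge0 ?(ltW p0) ?in_itv/= ?leey ?andbT//.
rewrite /Lp_int -ge0_integralZl//; last 3 first.
- by apply: measurable_fun_if0; [exact: measurable_mem|exact: mpow].
- by move=> x _; apply: if_ge0; exact: pow_ge0.
- by rewrite lee_fin dim_const_ge0.
apply: ae_ge0_le_integral_raw.
- by move=> x _; rewrite lee_fin powR_ge0.
- move=> x _; rewrite mule_ge0 ?lee_fin ?dim_const_ge0//.
  by apply: if_ge0; exact: pow_ge0.
apply: filterS uw => x uwx Dx; split=> //.
rewrite uwx// mem_set; last exact: DU.
by rewrite -EFinM lee_fin enorm_powR_le.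
Qed.

Lemma gagliardo_seminorm_le D U u w : D `<=` U -> measurable U ->
  measurable_fun setT w -> {ae mu, forall x, D x -> u x = w x} ->
  gagliardo_seminorm s p D u <= (dim_const%:E * gagliardo_int U w) `^ p^-1.
Proof.
move=> DU mU mw uw; rewrite /gagliardo_seminorm.
have J1 x : 0 <= \int[mu]_y (dim_const%:E *
    if (x \in U) && (y \in U) then (`|w x - w y| `^ p * K x y)%:E else 0).
  apply: integral_ge0 => y _; rewrite mule_ge0 ?lee_fin ?dim_const_ge0//.
  by apply: if_ge0; exact: powK_ge0.
have I0 : 0 <= \int[mu]_(x in D) \int[mu]_(y in D)
    (enorm (u x - u y) `^ p / enorm (x - y) `^ (n%:R + s * p))%:E.
  by apply: integral_ge0 => x _; apply: integral_ge0 => y _; exact: quot_ge0.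
have Z := gagZ dim_const_ge0 mU mw.
have J0 : 0 <= dim_const%:E * gagliardo_int U w.
  by rewrite Z; apply: integral_ge0 => x _; exact: J1.
apply: gt0_ler_poweR; rewrite ?invr_ge0 ?(ltW p0) ?in_itv/= ?leey ?andbT//.
rewrite Z; apply: ae_ge0_le_integral_raw.
- by move=> x _; apply: integral_ge0 => y _; exact: quot_ge0.
- by move=> x _; exact: J1.
apply: filterS (uw) => x uwx Dx; split=> //.
apply: ae_ge0_le_integral_raw.
- by move=> y _; exact: quot_ge0.
- move=> y _; rewrite mule_ge0 ?lee_fin ?dim_const_ge0//.
  by apply: if_ge0; exact: powK_ge0.
apply: filterS uw => y uwy Dy; split=> //.
rewrite uwx// uwy// !mem_set; [|exact: DU|exact: DU].
by rewrite -EFinM lee_fin quotient_le_kern.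
Qed.

Let poweR_fin (x : \bar R) : 0 <= x -> x `^ p^-1 < +oo -> x < +oo.
Proof.
case: x => [x|//|//] _; first by move=> _; exact: ltry.
by rewrite poweRyr ?invr_eq0 ?gt_eqF// ltxx.
Qed.

Lemma Lp_int_lty U u w : measurable U -> measurable_fun setT w ->
  {ae mu, forall x, U x -> u x = w x} ->
  Lp_norm p U u < +oo -> Lp_int U w < +oo.
Proof.
move=> mU mw uw /poweR_fin h.
apply: le_lt_trans (h _); last first.
  by apply: integral_ge0 => x _; rewrite lee_fin powR_ge0.
rewrite /Lp_int [leRHS]integral_mkcond.
apply: ae_ge0_le_integral_raw.
- by move=> x _; apply: if_ge0; exact: pow_ge0.
- by move=> x _; apply: erestrict_ge0 => y _; rewrite lee_fin powR_ge0.
apply: filterS uw => x uwx _; split=> //; rewrite patchE.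
case: ifPn => [/set_mem/uwx ->|_]; last exact: lexx.
by rewrite lee_fin norm_powR_le_enorm.
Qed.

Lemma gagliardo_int_lty U u w : (0 < n)%N -> measurable U -> measurable_fun setT w ->
  {ae mu, forall x, U x -> u x = w x} ->
  gagliardo_seminorm s p U u < +oo -> gagliardo_int U w < +oo.
Proof.
move=> n0 mU mw uw /poweR_fin h.
have {}h := h _; have {}h := h (integral_ge0 _ (fun x _ => integral_ge0 _ (fun y _ => quot_ge0 _ _))).
pose a := (n%:R + s * p)%R.
have a0 : (0 < a)%R by rewrite ltr_wpDl.
(* The Euclidean distance may exceed the sup distance by the factor sqrt n, which enters the kernel
   with the exponent n + s p. *)
pose c : R := (Num.sqrt n%:R `^ a)%R.
have c0 : (0 < c)%R by rewrite powR_gt0// sqrtr_gt0 ltr0n.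
suff : (c^-1)%:E * gagliardo_int U w < +oo.
  case: (gagliardo_int U w) => [r|//|//]; first by move=> _; exact: ltry.
  by rewrite gt0_muley ?ltxx// lte_fin invr_gt0.
rewrite gagZ//; last by rewrite invr_ge0 ltW.
apply: le_lt_trans h; rewrite [leRHS]integral_mkcond.
have ci0 : 0 <= (c^-1)%:E :> \bar R by rewrite lee_fin invr_ge0 ltW.
apply: ae_ge0_le_integral_raw.
- move=> x _; apply: integral_ge0 => y _; rewrite mule_ge0//.
  by apply: if_ge0; exact: powK_ge0.
- move=> x _; apply: erestrict_ge0 => y _; apply: integral_ge0 => y' _.
  exact: quot_ge0.
apply: filterS (uw) => x uwx _; split=> //; rewrite patchE.
have [xU|_] := boolP (x \in U); last first.
  by rewrite integral0_eq// => y _; rewrite mule0.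
rewrite [leRHS]integral_mkcond.
apply: ae_ge0_le_integral_raw.
- by move=> y _; rewrite mule_ge0//; apply: if_ge0; exact: powK_ge0.
- by move=> y _; apply: erestrict_ge0 => y' _; exact: quot_ge0.
apply: filterS uw => y uwy _; split=> //; rewrite patchE.
have [yU|_] := boolP (y \in U); last by rewrite mule0.
rewrite /= uwx ?uwy; [|exact: set_mem|exact: set_mem].
rewrite -EFinM lee_fin mulrCA; apply: ler_pM; rewrite ?powR_ge0//.
- by rewrite mulr_ge0 ?kern_ge0// invr_ge0 ltW.
- exact: norm_powR_le_enorm.
rewrite /kern -/a /c -invfM -powRM ?sqrtr_ge0//.
have [->|xy] := eqVneq x y.
  rewrite subrr normr0 mulr0 (_ : enorm 0 = 0)%R//.
  apply/eqP; rewrite eq_le enorm_ge0 andbT.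
  by apply: le_trans (enorm_le_norm _) _; rewrite normr0 mulr0.
have xp : (0 < enorm (x - y))%R.
  by apply: lt_le_trans (norm_le_enorm _); rewrite normr_gt0 subr_eq0.
rewrite lef_pV2 ?posrE ?powR_gt0//; last exact: lt_le_trans (enorm_le_norm _).
apply: ge0_ler_powR; rewrite ?nnegrE ?enorm_ge0 ?(ltW a0)//.
exact: enorm_le_norm.
Qed.

End sobolev_transfer.

(** * Approximation *)

Lemma mesh_const_ge0 (R : realType) (n : nat) (p s : R) :
  0 < s -> 0 <= @mesh_const R n p s.
Proof.
move=> s0; have nc := @near_const_ge0 R n s s0.
have tc := @tail_const_ge0 R n s s0; have tp := powR_ge0 (2 : R) p.
apply: mulr_ge0 => //; apply: addr_ge0; [apply: addr_ge0 => //|];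
  by apply: mulr_ge0 => //; exact: mulr_ge0.
Qed.

Section Borel_approximation.
Context {R : realType} {n m : nat}.
Local Notation mu := (lebesgue_rV R n).
Variables (s p : R) (v : 'rV[R]_n -> 'rV[R]_m) (om : set 'rV[R]_n).
Hypotheses (p1 : 1 <= p) (s0 : 0 < s).
Hypotheses (mv : measurable_fun setT v) (mom : measurable om).

Local Open Scope ereal_scope.

Lemma pairs_kern_lty : gagliardo_int s p om v < +oo ->
  \int[mu]_x \int[mu]_c (pairs p v om x c * kern (s * p) x c)%:E < +oo.
Proof.
apply: le_lt_trans; rewrite le_eqVlt; apply/orP; left; apply/eqP.
apply: eq_integral => x _; apply: eq_integral => c _.
by rewrite /pairs; case: ifP => _; rewrite ?mul0r.
Qed.

(** [N] is to be the null set where the Borel representative is not a legitimate value of f. The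
    last conclusion makes v o Phi independent, almost everywhere on U, of the values of v on [N]. *)
Lemma exists_good_mesh (j : nat) (B d c : R) (U N : set 'rV[R]_n) :
  (s * p < j.+1%:R)%R -> gagliardo_int s p om v < +oo ->
  measurable U -> (forall x, U x -> `|x| <= B)%R -> (0 < d)%R ->
  (forall x y, U x -> `|x - y| <= 5 * d -> om y)%R -> (0 < c)%R ->
  measurable N -> mu N = 0 ->
  exists e T, let Phi := mesh_map j e T in
    [/\ (0 < e <= d)%R,
        Lp_int p U (fun x => v (Phi x) - v x)%R <= (2 `^ p * (c + c))%:E,
        gagliardo_int s p U (fun x => v (Phi x) - v x)%R
          <= (@mesh_const R n p (s * p) * (c + c))%:E &
        {ae mu, forall x, U x -> ~ N (Phi x)}].
Proof.
move=> spj /pairs_kern_lty fin mU UB d0 Uom c0 mN N0.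
have p0 : (0 < p)%R by exact: lt_le_trans p1.
have sp0 : (0 < s * p)%R by exact: mulr_gt0.
pose B1 : R := Num.max B 1%R.
have B10 : (0 < B1)%R by rewrite lt_max ltr01 orbT.
pose W0 : R := @weight_const R n j (s * p) (B1 + B1).
have W00 : (0 <= W0)%R.
  apply: divr_ge0.
    by rewrite mulr_ge0 ?powR_ge0// exprn_ge0// mulr_ge0// addr_ge0// ltW.
  have : (0 < j.+1%:R - s * p)%R by rewrite subr_gt0.
  by move=> /powR2_lt1; rewrite opprB => /andP[_ /ltW]; rewrite subr_ge0.
(* The first bound controls the plain energy; the second one makes W0 eta < c (2 B1)^n, as
   [exists_origin] requires. *)
pose eta : R := (Num.min c (c * (2 * B1) ^+ n / (2 * (W0 + 1))))%R.
have cB0 : (0 < c * (2 * B1) ^+ n)%R by rewrite mulr_gt0// exprn_gt0// mulr_gt0.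
have W10 : (0 < 2 * (W0 + 1))%R by rewrite mulr_gt0// ltr_wpDl.
have eta0 : (0 < eta)%R by rewrite lt_min c0 divr_gt0.
have [d2 d20 small] := energy_small p1 mv mom fin eta0.
(* The bound 1 gives e^(s p) <= 1, [d] keeps the margin inside [om], [d2] makes the energy small,
   and [B1] is what the bound of the weight asks for. *)
pose e : R := (Num.min (Num.min 1 d) (Num.min d2 B1))%R.
have e0 : (0 < e)%R by rewrite !lt_min ltr01 d0 d20.
have e1 : (e <= 1)%R by rewrite !ge_min lexx.
have ed : (e <= d)%R by rewrite !ge_min lexx orbT.
have ed2 : (e <= d2)%R by rewrite !ge_min lexx !orbT.
have eB : (e <= B1)%R by rewrite !ge_min lexx !orbT.
have {}small : \int[mu]_x energy p (s * p) v om e x <= eta%:E.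
  by apply: small; rewrite e0.
have mE := measurable_energy p (s * p) e mv mom.
have E0 x : 0 <= energy p (s * p) v om e x by exact: energy_ge0.
(* The infinite value costs nothing in the average over the origins, but it penalizes an origin
   whose projection sends a set of positive measure into [N]. *)
pose g x := if x \in N then +oo else energy p (s * p) v om e x.
have mg : measurable_fun setT g.
  by apply: measurable_fun_ifT => //; exact: measurable_mem.
have g0 x : 0 <= g x by rewrite /g; case: ifP => _; [exact: leey|exact: E0].
have Eg x : energy p (s * p) v om e x <= g x.
  by rewrite /g; case: ifP => _; [exact: leey|exact: lexx].
have Ig : \int[mu]_x g x = \int[mu]_x energy p (s * p) v om e x.
  apply: ge0_ae_eq_integral => //; exists N; split=> // x /= h.
  apply: contrapT => Nx; apply: h => _; rewrite /g ifF//.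
  by apply/negP => /set_mem.
have [T HT] : exists T, \int[mu]_x (if x \in U then
    weight j (s * p) (e^-1 *: (x - T)) * g (mesh_map j e T x) else 0) <= c%:E.
  apply: (@exists_origin _ _ _ _ _ B1) => //.
  - by rewrite sp0.
  - exact: ltW.
  - by move=> x /UB xB; rewrite le_max xB.
  rewrite Ig -/W0; apply: (@le_lt_trans _ _ (W0%:E * eta%:E)).
    by apply: lee_wpmul2l => //; rewrite lee_fin.
  rewrite -EFinM lte_fin.
  apply: (@le_lt_trans _ _ (W0 * (c * (2 * B1) ^+ n / (2 * (W0 + 1)))))%R.
    by rewrite ler_wpM2l// ge_min lexx orbT.
  rewrite mulrCA -[ltRHS]mulr1 ltr_pM2l// ltr_pdivrMr//.
  by move: W00; lra.
pose a := mesh_depth j e T.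
have mPhi : measurable_fun setT (mesh_map j e T) by exact: measurable_mesh_map.
have ma : measurable_fun setT a by exact: measurable_mesh_depth.
have a01 x : (0 <= a x <= 1)%R by exact: depth_itv.
have Pdist x : (`|mesh_map j e T x - x| <= e)%R by exact: mesh_map_dist.
have Plip x y : (`|x - y| <= e)%R ->
    (a x * `|mesh_map j e T x - mesh_map j e T y| <= 4 * `|x - y|)%R.
  exact: mesh_map_lip.
have Uom' x y : U x -> (`|x - y| <= 5 * e)%R -> om y.
  by move=> Ux xy; apply: (Uom _ _ Ux); apply: le_trans xy _; rewrite ler_wpM2l.
have Xc : weighted_energy p (s * p) v om U e (mesh_map j e T) a <= c%:E.
  apply: le_trans HT; apply: ge0_le_integral_raw.
  - move=> x _; case: ifP => _; last exact: lexx.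
    by apply: mule_ge0; [exact: wt_ge0|exact: E0].
  - move=> x _; case: ifP => _; last exact: lexx.
    by apply: mule_ge0; [exact: weight_ge0|exact: g0].
  move=> x _; split=> //; case: ifP => _; last exact: lexx.
  by apply: lee_wpmul2l; [exact: wt_ge0|exact: Eg].
have Yc : plain_energy p (s * p) v om U e <= c%:E.
  apply: (@le_trans _ _ eta%:E); last by rewrite lee_fin ge_min lexx.
  apply: le_trans small; apply: ge0_le_integral_raw.
  - by move=> x _; case: ifP => _; [exact: E0|exact: lexx].
  - by move=> x _; exact: E0.
  by move=> x _; split=> //; case: ifP => _; [exact: lexx|exact: E0].
have XYc : weighted_energy p (s * p) v om U e (mesh_map j e T) a +
    plain_energy p (s * p) v om U e <= (c + c)%:E by rewrite EFinD; exact: leeD.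
have cc0 : (0 <= c + c)%R by rewrite addr_ge0// ltW.
exists e, T; split.
- by rewrite e0.
- apply: (@le_trans _ _ (\int[mu]_x
      (if x \in U then (pairs p v om (mesh_map j e T x) x)%:E else 0))).
    apply: ge0_le_integral_raw.
    + move=> x _; case: ifP => _; last exact: lexx.
      by rewrite lee_fin powR_ge0.
    + move=> x _; case: ifP => _; last exact: lexx.
      by rewrite lee_fin pairs_ge0.
    move=> x _; split=> //; case: ifPn => [/set_mem Ux|_]; last exact: lexx.
    rewrite pairsE//.
      apply: (Uom' _ _ Ux); rewrite distrC (le_trans (Pdist x))// ler_peMl ?ler1n//.
      exact: ltW.
    by apply: (Uom' _ _ Ux); rewrite subrr normr0 mulr_ge0// ltW.
  apply: le_trans (integral_phi_pairs p1 sp0 mv mom mU e0 mPhi ma a01 Pdist Uom') _.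
  apply: (@le_trans _ _ ((2 `^ p * e `^ (s * p))%:E * (c + c)%:E)).
    by apply: lee_wpmul2l => //; rewrite lee_fin mulr_ge0 ?powR_ge0.
  rewrite -EFinM lee_fin ler_wpM2r// -[leRHS]mulr1 ler_wpM2l ?powR_ge0//.
  have <- : (1 `^ (s * p) = 1 :> R)%R by rewrite powR1.
  by apply: ge0_ler_powR; rewrite ?nnegrE ?(ltW e0) ?(ltW sp0).
- apply: (@le_trans _ _ ((@mesh_const R n p (s * p))%:E * (c + c)%:E)); last first.
    by rewrite -EFinM.
  have := mesh_gagliardo_le p1 sp0 mv mom mU e0 mPhi ma a01 Pdist Plip Uom'.
  move=> /(fun h => le_trans h (lee_wpmul2l _ XYc)) h.
  apply: le_trans (h _); last first.
    by rewrite lee_fin mesh_const_ge0.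
  have swap x y : (v (mesh_map j e T x) - v x - (v (mesh_map j e T y) - v y) =
      v (mesh_map j e T x) - v (mesh_map j e T y) - (v x - v y))%R.
    by apply/rowP => i; rewrite !mxE; ring.
  rewrite le_eqVlt; apply/orP; left; apply/eqP.
  apply: eq_integral => x _; apply: eq_integral => y _.
  by rewrite swap.
- have mh : measurable_fun setT (fun x => if x \in U then
    weight j (s * p) (e^-1 *: (x - T)) * g (mesh_map j e T x) else 0).
    apply: measurable_fun_if0; first exact: measurable_mem.
    apply: emeasurable_funM; last exact: (measurableT_comp mg).
    apply: (measurableT_comp (@measurable_weight R n j (s * p))).
    exact: measurable_rescale.
  have h0 x : 0 <= (if x \in U then
    weight j (s * p) (e^-1 *: (x - T)) * g (mesh_map j e T x) else 0).
    case: ifP => _; last exact: lexx.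
    by apply: mule_ge0; [exact: weight_ge0|exact: g0].
  have ih : mu.-integrable setT (fun x => if x \in U then
    weight j (s * p) (e^-1 *: (x - T)) * g (mesh_map j e T x) else 0).
    apply/integrableP; split => //; under eq_integral do rewrite gee0_abs//.
    by apply: le_lt_trans HT _; exact: ltry.
  (* An integrable function is finite almost everywhere, whereas this one is infinite wherever
     Phi(x) is in [N], the weight being at least 1. *)
  have := integrable_ae measurableT ih; apply: filterS => x /(_ Logic.I) + Ux Nx.
  rewrite mem_set// /g mem_set// gt0_muley//.
  by apply: lt_le_trans (inv_powR_ge1 sp0 (depth_itv j _)); exact: lte01.
Qed.

End Borel_approximation.

Lemma lte_mulr_pinfty (R : realType) (c : R) (t : \bar R) :
  0 <= c -> (t < +oo)%E -> (c%:E * t < +oo)%E.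
Proof. by move=> c0; apply: lte_mul_pinfty; rewrite ?lee_fin. Qed.

Section integrals_sum.
Context {R : realType} {n m : nat}.
Local Notation mu := (lebesgue_rV R n).
Variables (s p : R).
Hypotheses (p1 : 1 <= p) (s0 : 0 < s).
Implicit Types (U V : set 'rV[R]_n) (w : 'rV[R]_n -> 'rV[R]_m).
Local Open Scope ereal_scope.

Let pow_ge0 (y : 'rV[R]_m) : 0 <= (`|y| `^ p)%:E :> \bar R.
Proof. by rewrite lee_fin powR_ge0. Qed.

Let powK_ge0 (y : 'rV[R]_m) (x x' : 'rV[R]_n) :
  0 <= (`|y| `^ p * kern (s * p) x x')%:E :> \bar R.
Proof. by rewrite lee_fin mulr_ge0 ?powR_ge0 ?kern_ge0. Qed.

Let tri (y z : 'rV[R]_m) : (`|y| `^ p <= 2 `^ p * (`|y - z| `^ p + `|z| `^ p))%R.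
Proof.
have p0 : (0 <= p)%R by exact: le_trans p1.
apply: le_trans (powRD_le p0 (normr_ge0 _) (normr_ge0 _)).
apply: ge0_ler_powR; rewrite ?nnegrE ?addr_ge0//.
by rewrite -{1}(subrK z y); exact: ler_normD.
Qed.

Let c2 : 0 <= (2 `^ p)%:E :> \bar R. Proof. by rewrite lee_fin powR_ge0. Qed.

(** With w1 = v o Phi and w2 = v, the bounds on the difference show that the approximation itself
    has finite norm; likewise for the Gagliardo part below. *)
Lemma Lp_int_sum U V w1 w2 : U `<=` V -> measurable U -> measurable V ->
  measurable_fun setT w1 -> measurable_fun setT w2 ->
  Lp_int p U (fun x => w1 x - w2 x)%R < +oo -> Lp_int p V w2 < +oo ->
  Lp_int p U w1 < +oo.
Proof.
move=> UV mU mV m1 m2 h1 h2.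
pose f (W : set 'rV[R]_n) (w : 'rV[R]_n -> 'rV[R]_m) x : \bar R := if x \in W then (`|w x| `^ p)%:E else 0.
have mf W w : measurable W -> measurable_fun setT w -> measurable_fun setT (f W w).
  move=> mW mw; apply: measurable_fun_if0; first exact: measurable_mem.
  apply/measurable_EFinP; apply: (measurableT_comp (measurable_powR _)).
  exact: measurable_rV_norm.
have f0 W w x : 0 <= f W w x by apply: if_ge0; exact: pow_ge0.
have mB : measurable_fun setT (fun x => w1 x - w2 x)%R by exact: measurable_rVB.
have mfB := mf _ _ mU mB; have mf2 := mf _ _ mV m2.
apply: (@le_lt_trans _ _ ((2 `^ p)%:E *
    (\int[mu]_x f U (fun x => w1 x - w2 x)%R x + \int[mu]_x f V w2 x))); last first.
  by apply: lte_mulr_pinfty; [exact: powR_ge0|exact: (lte_add_pinfty h1 h2)].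
rewrite -(ge0_integralD _ measurableT (fun x _ => f0 _ _ x) mfB (fun x _ => f0 _ _ x) mf2).
rewrite -(ge0_integralZl _ measurableT (emeasurable_funD mfB mf2)); last 2 first.
- by move=> x _; apply: adde_ge0; exact: f0.
- exact: c2.
apply: ge0_le_integral_raw.
- by move=> x _; exact: (f0 U w1).
- by move=> x _; apply: mule_ge0; [exact: c2|apply: adde_ge0; exact: f0].
move=> x _; split=> [//|]; have [xU|xU] := boolP (x \in U); last first.
  by apply: mule_ge0; [exact: c2|apply: adde_ge0; exact: f0].
rewrite /f/= xU (mem_set (UV _ (set_mem xU))) -EFinD -EFinM lee_fin.
exact: tri.
Qed.

Lemma gagliardo_int_sum U V w1 w2 : U `<=` V -> measurable U -> measurable V ->
  measurable_fun setT w1 -> measurable_fun setT w2 ->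
  gagliardo_int s p U (fun x => w1 x - w2 x)%R < +oo ->
  gagliardo_int s p V w2 < +oo ->
  gagliardo_int s p U w1 < +oo.
Proof.
move=> UV mU mV m1 m2 h1 h2.
pose f (W : set 'rV[R]_n) (w : 'rV[R]_n -> 'rV[R]_m) (z : 'rV[R]_n * 'rV[R]_n) : \bar R :=
  if (z.1 \in W) && (z.2 \in W)
  then (`|w z.1 - w z.2| `^ p * kern (s * p) z.1 z.2)%:E else 0.
have mf W w : measurable W -> measurable_fun setT w -> measurable_fun setT (f W w).
  move=> mW mw; apply: measurable_fun_if0.
    by apply: measurable_and; exact: measurable_mem.
  apply/measurable_EFinP/measurable_funM; last exact: measurable_kern.
  apply: (measurableT_comp (measurable_powR _)); apply: measurable_dist.
    exact: (measurableT_comp mw).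
  exact: (measurableT_comp mw).
have f0 W w z : 0 <= f W w z by apply: if_ge0; exact: powK_ge0.
have gE W w : measurable W -> measurable_fun setT w ->
    gagliardo_int s p W w = \int[mu \x mu]_z f W w z.
  by move=> mW mw; rewrite (fubini_tonelli1 _ (mf _ _ mW mw) (f0 W w)).
have mB : measurable_fun setT (fun x => w1 x - w2 x)%R by exact: measurable_rVB.
rewrite (gE U _ mU mB) in h1; rewrite (gE V w2 mV m2) in h2; rewrite (gE U w1 mU m1).
have mfB := mf _ _ mU mB; have mf2 := mf _ _ mV m2.
apply: (@le_lt_trans _ _ ((2 `^ p)%:E * (\int[mu \x mu]_z f U (fun x => w1 x - w2 x)%R z
    + \int[mu \x mu]_z f V w2 z))); last first.
  by apply: lte_mulr_pinfty; [exact: powR_ge0|exact: (lte_add_pinfty h1 h2)].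
rewrite -(ge0_integralD _ measurableT (fun z _ => f0 _ _ z) mfB (fun z _ => f0 _ _ z) mf2).
rewrite -(ge0_integralZl _ measurableT (emeasurable_funD mfB mf2)); last 2 first.
- by move=> z _; apply: adde_ge0; exact: f0.
- exact: c2.
apply: ge0_le_integral_raw.
- by move=> z _; exact: f0.
- by move=> z _; apply: mule_ge0; [exact: c2|apply: adde_ge0; exact: f0].
move=> [x y] _; split=> [//|].
have [|xyU] := boolP ((x \in U) && (y \in U)); last first.
  rewrite {1}/f/= (negbTE xyU).
  by apply: mule_ge0; [exact: c2|apply: adde_ge0; exact: f0].
move=> xyU; rewrite /f/= xyU; case/andP: xyU => xU yU.
rewrite (mem_set (UV _ (set_mem xU))) (mem_set (UV _ (set_mem yU)))/=.
rewrite -EFinD -EFinM lee_fin -mulrDl mulrA ler_wpM2r ?kern_ge0//.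
apply: le_trans (tri _ (w2 x - w2 y)%R) _.
rewrite (_ : (_ - _ - (_ - _) = w1 x - w2 x - (w1 y - w2 y))%R)//.
by apply/rowP => i; rewrite !mxE; ring.
Qed.

End integrals_sum.

Lemma ae_exists_in_open (R : realType) (n : nat) (W N : set 'rV[R]_n) x :
  open W -> W x -> lebesgue_rV R n N = 0%E -> measurable N ->
  exists2 y, W y & ~ N y.
Proof.
move=> oW Wx N0 mN; apply: contrapT => h.
have WN : W `<=` N by move=> y Wy; apply: contrapT => Ny; apply: h; exists y.
have /nbhs_ballP[r /= r0 rW] : nbhs x W by exact: open_nbhs_nbhs.
have r2 : 0 < r / 2 by rewrite divr_gt0.
have : (lebesgue_rV R n [set y : 'rV[R]_n | `|y - x| <= r / 2]%R <= lebesgue_rV R n N)%E.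
  apply: le_measure; rewrite ?inE//; first exact: measurable_cball.
  move=> y /= yx; apply/WN/rW; rewrite mx_norm_ball /ball_/= distrC.
  by apply: le_lt_trans yx _; lra.
rewrite N0 lebesgue_rV_cball ?(ltW r2)// lee_fin leNgt exprn_gt0//.
by rewrite mulr_gt0.
Qed.

Lemma poweR_root_le (R : realType) (p h c C : R) (t : \bar R) :
  1 <= p -> 0 <= h -> 0 <= c -> c * C <= h `^ p -> (0 <= t <= C%:E)%E ->
  ((c%:E * t) `^ p^-1 <= h%:E)%E.
Proof.
move=> p1 h0 c0 cC /andP[t0 tC]; have p0 : 0 < p by exact: lt_le_trans p1.
have -> : h = (h `^ p) `^ p^-1 by rewrite -powRrM mulfV ?gt_eqF// powRr1.
rewrite -poweR_EFin; apply: gt0_ler_poweR.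
- by rewrite invr_ge0 ltW.
- by rewrite in_itv/= leey andbT mule_ge0.
- by rewrite in_itv/= leey andbT lee_fin powR_ge0.
apply: (@le_trans _ _ (c%:E * C%:E)%E); first by apply: lee_wpmul2l.
by rewrite -EFinM lee_fin.
Qed.

Lemma mesh_approximation (R : realType) (n m : nat) (F : set 'rV[R]_m) (s p : R)
    (Omega omega : set 'rV[R]_n) (f : 'rV[R]_n -> 'rV[R]_m) (j : nat) (eta : R) :
  (0 < n)%N -> 0 < s -> 1 <= p -> s * p < j.+1%:R ->
  open omega -> bounded_set omega -> closure Omega `<=` omega ->
  sobolev s p omega F f -> 0 < eta ->
  exists (M : mesh R n) (g : 'rV[R]_n -> 'rV[R]_m),
    [/\ closure Omega `<=` mesh_set M /\ mesh_set M `<=` omega,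
        forall x, mesh_set M x -> F (g x),
        piecewise_homogeneous j M g,
        sobolev s p (mesh_set M) F g &
        (sobolev_norm s p Omega (fun x => g x - f x)%R <= eta%:E)%E].
Proof.
move=> n0 s0 p1 spj oW bW OW [[v mv fv] fin fF] eta0.
have p0 : 0 < p by exact: lt_le_trans p1.
have mW := open_measurable_rV oW.
have LP0 D u : (0 <= @Lp_norm R n m p D u)%E by exact: poweR_ge0.
have GA0 D u : (0 <= @gagliardo_seminorm R n m s p D u)%E by exact: poweR_ge0.
have LV : (Lp_int p omega v < +oo)%E.
  apply: (Lp_int_lty p1 mW mv fv); apply: le_lt_trans fin.
  by apply: leeDl; exact: GA0.
have GV : (gagliardo_int s p omega v < +oo)%E.
  apply: (gagliardo_int_lty p1 s0 n0 mW mv fv); apply: le_lt_trans fin.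
  by apply: leeDr; exact: LP0.
have [N [mN N0 WN]] : exists N, [/\ measurable N, lebesgue_rV R n N = 0%E &
    forall y, omega y -> ~ N y -> F (v y) /\ f y = v y].
  have [N [mN N0 NP]] : {ae lebesgue_rV R n, forall y, omega y -> F (v y) /\ f y = v y}.
    apply: filterS2 fv fF => y fvy fFy Wy; split; last exact: fvy.
    by rewrite -fvy//; exact: fFy.
  exists N; split => // y Wy Ny; apply: contrapT => h; apply: Ny; apply: NP => /=.
  by move=> /(_ Wy).
have [B WB] : exists B : R, forall x, omega x -> `|x| <= B.
  have [M0 [_ HM]] := bW; exists (M0 + 1) => x Wx.
  by apply: HM => //; rewrite ltrDl.
have cO : compact (closure Omega).
  apply: bounded_closed_compact; last exact: closed_closure.
  have [M0 [M0r HM]] := bW; exists M0; split=> // M1 M01 x /OW Wx.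
  exact: HM Wx.
have [d0 d00 dW] := compact_margin cO oW OW.
(* 3 d for the neighborhood [U] of the closure of Omega, plus the margin 5 d of the estimates. A
   cube that meets this closure has side 2 e <= 2 d, hence lies in [U]. *)
pose d := d0 / 8; have dp : 0 < d by rewrite divr_gt0.
pose U := \bigcup_(z in closure Omega) ball z (3 * d).
have mU : measurable U.
  apply: open_measurable_rV; apply: bigcup_open => z _.
  exact: ball_open.
have UP x : U x -> exists2 z, closure Omega z & `|z - x| < 3 * d.
  by move=> [z Oz]; rewrite mx_norm_ball => zx; exists z.
have UW5 x y : U x -> `|x - y| <= 5 * d -> omega y.
  move=> /UP[z Oz zx] xy; apply: (dW z) => //.
  by apply: le_lt_trans (ler_distD x _ _) _; rewrite /d in zx xy; lra.
have UW : U `<=` omega.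
  by move=> x Ux; apply: (UW5 x x Ux); rewrite subrr normr0 mulr_ge0// ltW.
have OU : Omega `<=` U.
  move=> x Ox; exists x; first exact: subset_closure.
  by apply: ballxx; rewrite mulr_gt0.
(* One constant for both parts of the norm, so that a single c makes each of them at most eta / 2;
   the 2 absorbs c + c. *)
pose Q : R := @dim_const R m p * (2 `^ p + @mesh_const R n p (s * p)) * 2.
have mc0 : 0 <= @mesh_const R n p (s * p) by apply: mesh_const_ge0; rewrite mulr_gt0.
have dc0 : 0 <= @dim_const R m p by exact: dim_const_ge0.
have Q0 : 0 <= Q by rewrite mulr_ge0// mulr_ge0// addr_ge0// powR_ge0.
pose h := eta / 2; have h0 : 0 < h by rewrite divr_gt0.
pose c := h `^ p / (Q + 1).
have c0 : 0 < c by rewrite divr_gt0 ?powR_gt0// ltr_wpDl.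
have Qc : Q * c <= h `^ p.
  rewrite /c mulrCA -[leRHS]mulr1 ler_wpM2l ?powR_ge0//.
  by rewrite ler_pdivrMr ?ltr_wpDl// mul1r lerDl.
have [e [T /= [/andP[e0 ed] LI GI NP]]] :=
  exists_good_mesh p1 s0 mv mW spj GV mU (fun x Ux => WB x (UW x Ux)) dp UW5 c0 mN N0.
set Phi := mesh_map j e T in LI GI NP.
have Phi_om x : U x -> omega (Phi x).
  move=> Ux; apply: (UW5 x _ Ux); rewrite distrC.
  apply: (le_trans (mesh_map_dist j T x e0)); apply: le_trans ed _.
  by rewrite ler_peMl ?ler1n// ltW.
have [cells [cov near]] := covering_mesh_cells T e0 (fun x Ox => WB x (OW x Ox)).
pose M := Mesh T e0 cells.
have ME K i : cube_center M K ord0 i = T ord0 i + 2 * e * (K ord0 i)%:~R by rewrite !mxE.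
have MU : mesh_set M `<=` U.
  move=> y [K /near[x Ox xK] yK]; exists x => //; rewrite mx_norm_ball /ball_/=.
  apply: (@le_lt_trans _ _ (2 * e)); last by move: ed dp; lra.
  apply/rV_norm_leP; first by rewrite mulr_ge0// ltW.
  move=> i; rewrite !mxE; have := yK i; have := xK i; rewrite ME/=.
  set t := T ord0 i + _ => xt yt; apply: le_trans (ler_distD t _ _) _.
  by move: yt; rewrite (distrC (y ord0 i)); move: xt; lra.
have OM : closure Omega `<=` mesh_set M.
  move=> x /cov[K KM xK]; exists K => // i; rewrite ME; exact: xK.
have [y0 y0F] : exists y0, (exists y, F y) -> F y0.
  have [[y Fy]|nF] := pselect (exists y, F y); first by exists y.
  by exists 0.
(* All values on the mesh must lie in F, although v takes values in F only off [N]. After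
   composition with Phi this changes v on a null set only, by the choice of the origin. *)
pose ft y := if `[< F (v y) >] then v y else y0.
have Fft y : (exists y, F y) -> F (ft y).
  by move=> Fy; rewrite /ft; case: asboolP => // _; exact: y0F.
have ftE x : U x -> ~ N (Phi x) -> ft (Phi x) = v (Phi x).
  move=> Ux Nx; have [Fv _] := WN _ (Phi_om _ Ux) Nx.
  by rewrite /ft; case: asboolP.
have mPhi : measurable_fun setT Phi by exact: measurable_mesh_map.
have mvP : measurable_fun setT (fun x => v (Phi x)) by exact: (measurableT_comp mv).
have mvB : measurable_fun setT (fun x => v (Phi x) - v x) by exact: measurable_rVB.
have gM : {ae lebesgue_rV R n, forall x, mesh_set M x -> (ft \o Phi) x = v (Phi x)}.
  by apply: filterS NP => x NPx /MU Ux; apply: ftE => //; exact: NPx.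
have gO : {ae lebesgue_rV R n, forall x, Omega x ->
    (ft \o Phi) x - f x = v (Phi x) - v x}.
  apply: filterS2 NP fv => x NPx fvx Ox; have Ux := OU x Ox.
  by rewrite fvx; [rewrite /= ftE//; exact: NPx|exact: UW].
(* F is nonempty as soon as the mesh has a point: the nonempty open set omega is not contained in
   [N]. *)
have gF x : mesh_set M x -> F ((ft \o Phi) x).
  move=> Mx; apply: Fft.
  have [y Wy Ny] := ae_exists_in_open oW (UW _ (MU _ Mx)) N0 mN.
  by exists (v y); have [] := WN y Wy Ny.
exists M, (ft \o Phi); split.
- by split=> [|x /MU Ux]; [exact: OM|exact: UW].
- exact: gF.
- by move=> X w; exact: homogeneous_ext_mesh_map.
- split.
  + by exists (fun x => v (Phi x)); [exact: mvP|exact: gM].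
  + have L1 : (Lp_int p U (fun x => v (Phi x)) < +oo)%E.
      apply: (Lp_int_sum p1 UW mU mW mvP mv _ LV).
      by apply: le_lt_trans LI _; exact: ltry.
    have G1 : (gagliardo_int s p U (fun x => v (Phi x)) < +oo)%E.
      apply: (gagliardo_int_sum p1 UW mU mW mvP mv _ GV).
      by apply: le_lt_trans GI _; exact: ltry.
    apply: lte_add_pinfty.
      apply: le_lt_trans (Lp_norm_le p1 MU mU mvP gM) _; apply: poweR_lty.
      exact: lte_mulr_pinfty.
    apply: le_lt_trans (gagliardo_seminorm_le p1 s0 MU mU mvP gM) _; apply: poweR_lty.
    exact: lte_mulr_pinfty.
  + by apply: aeW => x; exact: gF.
- have -> : eta = h + h by rewrite /h; lra.
  rewrite EFinD; apply: leeD.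
    apply: le_trans (Lp_norm_le p1 OU mU mvB gO) _.
    apply: (poweR_root_le p1 (ltW h0) dc0) (_ : (_ <= _ <= (2 `^ p * (c + c))%:E)%E).
      apply: le_trans Qc; rewrite -subr_ge0.
      rewrite (_ : _ - _ = @dim_const R m p * @mesh_const R n p (s * p) * (2 * c)); last first.
        by rewrite /Q; ring.
      by apply: mulr_ge0; apply: mulr_ge0 => //; exact: ltW.
    rewrite LI andbT; apply: integral_ge0 => x _; case: ifP => _; last exact: lexx.
    by rewrite lee_fin powR_ge0.
  apply: le_trans (gagliardo_seminorm_le p1 s0 OU mU mvB gO) _.
  apply: (poweR_root_le p1 (ltW h0) dc0)
    (_ : (_ <= _ <= (@mesh_const R n p (s * p) * (c + c))%:E)%E).
    apply: le_trans Qc; rewrite -subr_ge0.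
    rewrite (_ : _ - _ = @dim_const R m p * 2 `^ p * (2 * c)); last first.
      by rewrite /Q; ring.
    by apply: mulr_ge0; apply: mulr_ge0 => //; exact: ltW.
  rewrite GI andbT; apply: integral_ge0 => x _; apply: integral_ge0 => y _.
  case: ifP => _; last exact: lexx.
  by rewrite lee_fin mulr_ge0 ?powR_ge0 ?kern_ge0.
Qed.

Theorem theorem5 (R : realType) (n m : nat) (F : set 'rV[R]_m) (s p : R)
    (Omega omega : set 'rV[R]_n) (f : 'rV[R]_n -> 'rV[R]_m) (j : nat) :
  (2 <= n)%N ->
  0 < s < 1 -> 1 <= p -> s * p < n%:R ->
  smooth_open Omega -> bounded_set Omega ->
  smooth_open omega -> bounded_set omega ->
  closure Omega `<=` omega ->
  sobolev s p omega F f ->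
  Num.floor (s * p) <= j%:Z -> (j <= n - 1)%N ->
  exists (C : nat -> mesh R n) (f_ : nat -> 'rV[R]_n -> 'rV[R]_m),
    [/\ forall k, closure Omega `<=` mesh_set (C k) /\
                  mesh_set (C k) `<=` omega,
        forall k x, mesh_set (C k) x -> F (f_ k x),
        forall k, piecewise_homogeneous j (C k) (f_ k),
        forall k, sobolev s p (mesh_set (C k)) F (f_ k) &
        sobolev_norm s p Omega (fun x => f_ k x - f x)
          @[k --> \oo] --> 0%E].
Proof.
move=> n2 /andP[s0 _] p1 _ _ _ [oW _] bW OW Sf spj _.
have spj1 : s * p < j.+1%:R.
  have /andP[_] := floor_itv (s * p); move/lt_le_trans; apply.
  by rewrite -[leRHS]/((j.+1%:Z)%:~R) ler_int -addn1 PoszD lerD2r.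
have e0 k : (0 : R) < k.+1%:R^-1 by rewrite invr_gt0.
have A k := mesh_approximation (ltnW n2) s0 p1 spj1 oW bW OW Sf (e0 k).
have [C /choice[f_ Cf]] := choice A.
exists C, f_; split.
- by move=> k; have [] := Cf k.
- by move=> k; have [] := Cf k.
- by move=> k; have [] := Cf k.
- by move=> k; have [] := Cf k.
apply: (@squeeze_cvge _ _ _ _ (cst 0%E) _ (fun k => (k.+1%:R^-1)%:E)).
- apply: nearW => k; have [_ _ _ _ ->] := Cf k; rewrite andbT.
  by apply: adde_ge0; exact: poweR_ge0.
- exact: cvg_cst.
- apply: cvg_EFin; first exact: nearW.
  exact: cvg_harmonic.
Qed.
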